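(* Let $1\le q<p\le+\infty$. Then the sequence $d\mapsto m_d(p,q)$, $d\in\{1,2,3,\dots\}$, is nonincreasing and $$\lim_{d\to+\infty}m_d(p,q)=\inf_{d\ge1}m_d(p,q)=\frac qp$$ (with $q/p=0$ if $p=+\infty$). In particular, for every $d\ge 1$, $$\frac qp\le m_d(p,q)\le m_1(p,q)=\frac{\pi_p}{\pi_q}.$$
   Context: For an open set $\Omega\subset\mathbb{R}^d$ with $0<|\Omega|<+\infty$ ($|\cdot|$ is Lebesgue measure) and $1<p<+\infty$, let $$\lambda_p(\Omega)=\inf\left\{\frac{\int_\Omega|\nabla u|^p\,dx}{\int_\Omega|u|^p\,dx}\ :\ u\in C^1_c(\Omega),\ u\not\equiv0\right\}.$$ For the extreme exponents, $\lambda_1^{1/1}(\Omega)=\lambda_1(\Omega):=h(\Omega)$, where $h(\Omega)=\inf\{P(E)/|E| : \overline E\subset\Omega \text{ compact},\ |E|>0\}$ is the Cheeger constant ($P$ is the De Giorgi perimeter), equivalently $h(\Omega)=\inf\{\int_\Omega|\nabla u|\,dx/\int_\Omega|u|\,dx : u\in C^1_c(\Omega),\ u\not\equiv0\}$; and $\lambda_p^{1/p}(\Omega):=\rho(\Omega)^{-1}$ when $p=+\infty$, where $\rho(\Omega)$ is the inradius, i.e. the supremum of the radii of balls contained in $\Omega$. Set $\mathcal{F}_{p,q}(\Omega)=\lambda_p^{1/p}(\Omega)/\lambda_q^{1/q}(\Omega)$, let $\mathcal{A}^d_{all}$ be the class of open sets $\Omega\subset\mathbb{R}^d$ with $0<|\Omega|<+\infty$,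 and $$m_d(p,q)=\inf_{\Omega\in\mathcal{A}^d_{all}}\mathcal{F}_{p,q}(\Omega).$$ Finally $\pi_p:=\lambda_p^{1/p}((0,1))$, the one-dimensional value on the unit interval; explicitly $\pi_p=2\pi\frac{(p-1)^{1/p}}{p\sin(\pi/p)}$ for $1<p<+\infty$ and $\pi_1=\pi_\infty=2$. *)

(* Defs.v *)
From HB Require Import structures.
From mathcomp Require Import all_boot all_order all_algebra.
From mathcomp Require Import all_classical all_reals all_analysis.
From mathcomp Require Import measurable_realfun.

Set Implicit Arguments.
Unset Strict Implicit.
Unset Printing Implicit Defensive.
Import Order.TTheory GRing.Theory Num.Theory.
Import numFieldNormedType.Exports.

Local Open Scope classical_set_scope.
Local Open Scope ring_scope.

Section borel_rV.
Context {R : realType} {d : nat}.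

(* 'rV[R]_d carries its Borel sigma-algebra *)
HB.instance Definition _ := @isMeasurable.Build default_measure_display
  'rV[R]_d <<s (@open 'rV[R]_d) >> (@sigma_algebra0 _ setT _)
  (@sigma_algebraC _ _) (@sigma_algebra_bigcup _ setT _).

Lemma open_measurable_rV (U : set 'rV[R]_d) : open U -> measurable U.
Proof. exact: sub_sigma_algebra. Qed.

Lemma measurable_coord (i : 'I_d) :
  measurable_fun [set: 'rV[R]_d] (fun v : 'rV[R]_d => v ord0 i).
Proof.
apply: (measurability _ (RGenOpens.measurableE R)) => _ [_ [x [y ->]] <-].
rewrite setTI; apply: open_measurable_rV; apply: open_comp; last exact: itv_open.
by move=> v _; exact: coord_continuous.
Qed.

Lemma open_bigcup_rat_ball (U : set 'rV[R]_d) : open U ->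
  U = \bigcup_(c in [set c : 'rV[rat]_d * nat |
        ball (map_mx ratr c.1 : 'rV[R]_d) c.2.+1%:R^-1 `<=` U])
        ball (map_mx ratr c.1 : 'rV[R]_d) c.2.+1%:R^-1.
Proof.
move=> oU; apply/seteqP; split => [v Uv|v [c /= cU cv]]; last exact: cU.
have /nbhs_ballP[e /= e0 eU] : nbhs v U by exact: open_nbhs_nbhs.
have [n ne] : exists n, n.+1%:R^-1 < e / 2.
  have e2 : 0 < e / 2 by rewrite divr_gt0.
  have [n _ /(_ n (leqnn n)) /= ?] := near_infty_natSinv_lt (PosNum e2).
  by exists n.
have n0 : (0 : R) < n.+1%:R^-1 by rewrite invr_gt0.
have qP (i : 'I_d) : exists q : rat, `|v ord0 i - ratr q| < n.+1%:R^-1.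
  have /rat_in_itvoo[q /itvP qi] :
    v ord0 i - n.+1%:R^-1 < v ord0 i + n.+1%:R^-1 by rewrite ltrD2l gtrN.
  by exists q; rewrite distrC ltr_distl !qi.
have [q qv] := choice qP.
pose c : 'rV[rat]_d := \row_i q i.
have cv : ball (map_mx ratr c : 'rV[R]_d) n.+1%:R^-1 v.
  split => // i j; rewrite !mxE (ord1 i).
  by apply: ball_sym; rewrite /ball /=; exact: qv.
exists (c, n) => //= w cw; apply: eU.
apply: le_ball (ball_triangle (ball_sym cv) cw).
by rewrite [leRHS]splitr lerD ?ltW.
Qed.

Lemma measurable_fun_rVP d' (T : measurableType d') (f : T -> 'rV[R]_d) :
  (forall i, measurable_fun [set: T] (fun x => f x ord0 i)) ->
  measurable_fun [set: T] f.
Proof.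
move=> mf; apply: (@measurability _ _ T _ _ f (@open _)) => // _ [U oU <-].
rewrite setTI (open_bigcup_rat_ball oU) preimage_bigcup bigcup_mkcond.
apply: countable_bigcupT_measurable => // -[c n] /=; case: ifPn => // _.
have -> : f @^-1` ball (map_mx ratr c : 'rV[R]_d) n.+1%:R^-1 =
    \bigcap_(i in [set: 'I_d]) (fun x => f x ord0 i) @^-1`
      ball (ratr (c ord0 i) : R) n.+1%:R^-1.
  apply/seteqP; split=> [x [_ xc] i _ /=|x xc].
    by have := xc ord0 i; rewrite !mxE.
  split=> [|i j]; first by rewrite invr_gt0.
  by rewrite (ord1 i) mxE; exact: xc.
apply: fin_bigcap_measurable => // i _.
by rewrite -[X in measurable X]setTI; apply: mf => //; exact: measurable_ball.
Qed.

End borel_rV.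

Section lebesgue_rV.
Context {R : realType}.

Definition rV_cons d (p : R * 'rV[R]_d) : 'rV[R]_d.+1 :=
  \row_i oapp (p.2 ord0) p.1 (unlift ord0 i).

Lemma measurable_rV_cons d : measurable_fun [set: R * 'rV[R]_d] (@rV_cons d).
Proof.
apply: measurable_fun_rVP => i; rewrite /rV_cons.
under eq_fun do rewrite mxE.
case: unliftP => [j _|_] /=; last exact: measurable_fst.
exact: (measurableT_comp (measurable_coord j) measurable_snd).
Qed.

(* image of (Lebesgue measure on R) x m under the identification
   R x R^n = R^(n+1) *)
Definition lebesgue_rV_rec n (m : {measure set 'rV[R]_n -> \bar R}) :
    set 'rV[R]_n.+1 -> \bar R :=
  pushforward (lebesgue_measure \x^ m)%E (@rV_cons n).

HB.instance Definition _ n (m : {measure set 'rV[R]_n -> \bar R}) :=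
  Measure.copy (lebesgue_rV_rec m)
    (measure_function_pushforward__canonical__measure_function_Measure
       (lebesgue_measure \x^ m)%E (@measurable_rV_cons n)).

Fixpoint lebesgue_rV (d : nat) : {measure set 'rV[R]_d -> \bar R} :=
  if d is n.+1 then lebesgue_rV_rec (lebesgue_rV n) else \d_(0 : 'rV[R]_0).

Lemma lebesgue_rV_box d (A : 'I_d -> set R) :
  (forall i, measurable (A i)) ->
  lebesgue_rV d [set v | forall i, A i (v ord0 i)] =
  (\prod_(i < d) lebesgue_measure (A i))%E.
Proof.
have mbox n (B : 'I_n -> set R) : (forall i, measurable (B i)) ->
    measurable [set v : 'rV[R]_n | forall i, B i (v ord0 i)].
  move=> mB.
  have -> : [set v : 'rV[R]_n | forall i, B i (v ord0 i)] =
      \bigcap_(i in [set: 'I_n]) (fun v : 'rV[R]_n => v ord0 i) @^-1` B i.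
    by apply/seteqP; split => [v Bv i _|v Bv i]; [exact: Bv|exact: Bv].
  apply: fin_bigcap_measurable => // i _.
  by rewrite -[X in measurable X]setTI; apply: (@measurable_coord R n i).
elim: d A => [|d IH] A mA /=.
  by rewrite big_ord0 diracE mem_set// => -[].
rewrite big_ord_recl -(IH (A \o lift ord0) (fun i => mA (lift ord0 i))).
have mA' := mbox _ (A \o lift ord0) (fun i => mA (lift ord0 i)).
transitivity ((lebesgue_measure \x^ lebesgue_rV d)%E
    (A ord0 `*` [set v : 'rV[R]_d | forall i, A (lift ord0 i) (v ord0 i)])).
  rewrite /lebesgue_rV_rec /pushforward; congr ((_ \x^ _)%E _).
  apply/seteqP; split => [[x v] /= Av|[x v] /= [Ax Av] i].
    split; first by have := Av ord0; rewrite mxE unlift_none.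
    by move=> i; have := Av (lift ord0 i); rewrite mxE liftK.
  by rewrite mxE; case: unliftP => [j ->|->] //=.
exact: (product_measure2E lebesgue_measure (lebesgue_rV d) (mA ord0) mA').
Qed.

End lebesgue_rV.

Section variational.
Context {R : realType} {d : nat}.
Implicit Types (x v : 'rV[R]_d) (u : 'rV[R]_d -> R) (W E : set 'rV[R]_d).

(* the library norm `|v| on 'rV[R]_d is the sup norm *)
Definition enorm v : R := Num.sqrt (\sum_i v ord0 i ^+ 2).

Definition eball x (r : R) : set 'rV[R]_d := [set y | enorm (y - x) < r].

Definition partial (i : 'I_d) u x : R := 'D_(delta_mx ord0 i) u x.

Definition grad u x : 'rV[R]_d := \row_i partial i u x.

Definition C1 u : Prop :=
  forall i, (forall x, derivable u x (delta_mx ord0 i)) /\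
            continuous (partial i u).

Definition supp u : set 'rV[R]_d := closure [set x | u x != 0].

(* a function of C^1_c(W) is represented by its extension by zero to R^d *)
Definition C1c W u : Prop :=
  [/\ C1 u, compact (supp u) & supp u `<=` W].

Definition rayleigh (p : R) W u : \bar R :=
  ((\int[lebesgue_rV d]_(x in W) (enorm (grad u x) `^ p)%:E) /
   (\int[lebesgue_rV d]_(x in W) (`|u x| `^ p)%:E))%E.

Definition lambda (p : R) W : \bar R :=
  ereal_inf [set rayleigh p W u | u in [set u | C1c W u /\ exists x, u x != 0]].

Definition divergence (phi : 'rV[R]_d -> 'rV[R]_d) x : R :=
  \sum_i partial i (fun y => phi y ord0 i) x.

(* De Giorgi perimeter (in R^d) *)
Definition perimeter E : \bar R :=
  ereal_sup [set (\int[lebesgue_rV d]_(x in E) (divergence phi x)%:E)%E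
            | phi in [set phi : 'rV[R]_d -> 'rV[R]_d |
                (forall i, C1c setT (fun x => phi x ord0 i)) /\
                (forall x, enorm (phi x) <= 1)]].

(* E ranges over Borel sets; this gives the same infimum as Lebesgue measurable
   sets, since a Borel subset of E of the same measure has the same perimeter
   and a smaller closure *)
Definition cheeger W : \bar R :=
  ereal_inf [set (perimeter E / lebesgue_rV d E)%E
            | E in [set E : set 'rV[R]_d | [/\ measurable E, compact (closure E),
                closure E `<=` W & (0 < lebesgue_rV d E)%E]]].

Definition inradius W : \bar R :=
  ereal_sup [set r%:E | r in [set r : R |
    0 < r /\ exists x, eball x r `<=` W]].

(* lambda_p^(1/p) for p in [1, +oo]; -oo is never used *)
Definition lambda_root (p : \bar R) W : \bar R :=
  match p with
  | r%:E => if r == 1 then cheeger W else poweR (lambda r W) r^-1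
  | +oo%E => ((inradius W)^-1)%E
  | -oo%E => 0%E
  end.

Definition F_ratio (p q : \bar R) W : \bar R :=
  (lambda_root p W / lambda_root q W)%E.

Definition A_all : set (set 'rV[R]_d) :=
  [set W | open W /\ (0 < lebesgue_rV d W < +oo)%E].

End variational.

Definition m_inf {R : realType} (d : nat) (p q : \bar R) : \bar R :=
  ereal_inf [set F_ratio p q W | W in @A_all R d].

Definition unit_interval {R : realType} : set 'rV[R]_1 :=
  [set v | 0 < v ord0 ord0 < 1].

Definition pi_ {R : realType} (p : \bar R) : \bar R :=
  lambda_root p (@unit_interval R).

(* Main.v *)
From HB Require Import structures.
Require Import Defs.
From mathcomp Require Import all_boot all_order all_algebra.
From mathcomp Require Import all_classical all_reals all_analysis.
From mathcomp Require Import measurable_realfun.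
From mathcomp Require Import ring lra.

Import Order.TTheory GRing.Theory Num.Theory.
Import numFieldNormedType.Exports.

Local Open Scope classical_set_scope.
Local Open Scope ring_scope.

Set Implicit Arguments.
Unset Strict Implicit.
Unset Printing Implicit Defensive.

(** Write L_p for lambda_p^(1/p) and let W be open of finite positive measure.

    The lower bound is the statement that p L_p(W) is nondecreasing in p. For
    q < p, a test function u for p yields the test function |u|^(p/q) for q; its
    gradient has norm (p/q) |u|^(p/q - 1) |grad u|, and Hoelder's inequality bounds
    its q-energy by (p/q)^q ||u||_p^(p-q) ||grad u||_p^q: this is
    [lambda_monotone]. Hence q/p is a lower bound of the ratio L_p / L_q, once L_q
    is known to be positive ([lambda_gt0], a Poincare inequality). The exponent 1,
    where L_1 is the Cheeger constant, obeys the same rule because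
    [cheeger_lambda1] identifies that constant with the infimum of Rayleigh
    quotients: the coarea inequality gives one direction, the mollification of
    indicator functions the other.

    Balls of large dimension d make the bound sharp. On the ball of radius r, the
    field x/r shows that L_1 >= d/r, so that q L_q >= d/r by monotonicity, while the
    powers (1 - |x|^2)^m, whose integrals over the unit ball satisfy a two-term
    recursion, show that p L_p is at most (1 + o(1)) d for m of moderate size and r
    close to 1 ([lambda_sball_le]). For p = +oo it is enough that the inradius stays
    at least 1 while L_q grows with d.

    The infima do not increase with the dimension because W can be replaced by a
    long cylinder over W: slicing shows that L_q does not decrease, the product of a
    test function with a long plateau shows that L_p increases by at most an
    arbitrarily small amount, and the inradius does not shrink ([m_inf_succ]). The
    limit is therefore the infimum.

    In dimension 1, W is a disjoint union of open intervals, test functions split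
    along these intervals, and scaling gives L_p(W) = pi_p / (2 rho) with rho the
    inradius, for every finite p ([inradius_1d]). The ratio is thus the same for all W. *)

(** * Integration over row vectors *)

Section Integration.
Context {R : realType}.
Local Notation mu := (@lebesgue_measure R).

Lemma rV_cons0 n (x : R) (v : 'rV[R]_n) : rV_cons (x, v) ord0 ord0 = x.
Proof. by rewrite mxE unlift_none. Qed.

Lemma rV_consS n (x : R) (v : 'rV[R]_n) j :
  rV_cons (x, v) ord0 (lift ord0 j) = v ord0 j.
Proof. by rewrite mxE liftK. Qed.

Lemma rV_consK n (w : 'rV[R]_n.+1) :
  rV_cons (w ord0 ord0, \row_j w ord0 (lift ord0 j)) = w.
Proof.
apply/rowP => i; rewrite mxE; case: unliftP => [j ->|->] //=.
by rewrite mxE.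
Qed.

Lemma measurable_box n (A : 'I_n -> set R) : (forall i, measurable (A i)) ->
  measurable [set v : 'rV[R]_n | forall i, A i (v ord0 i)].
Proof.
move=> mA.
have -> : [set v : 'rV[R]_n | forall i, A i (v ord0 i)] =
    \bigcap_(i in [set: 'I_n]) (fun v : 'rV[R]_n => v ord0 i) @^-1` A i.
  by apply/seteqP; split => [v Bv i _|v Bv i]; exact: Bv.
apply: fin_bigcap_measurable => // i _.
by rewrite -[X in measurable X]setTI; apply: (@measurable_coord R n i).
Qed.

Definition cube n (r : R) : set 'rV[R]_n :=
  [set v | forall i, v ord0 i \in `[- r, r]%R].

Lemma measurable_cube n r : measurable (@cube n r).
Proof. by apply: (@measurable_box n (fun=> `[- r, r]%classic)) => i. Qed.

Lemma lebesgue_cube_lty n r : (lebesgue_rV n (@cube n r) < +oo)%E.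
Proof.
rewrite (@lebesgue_rV_box R n (fun=> `[- r, r]%classic))//.
have : (\prod_(i < n) mu `[(- r)%R, r])%E \is a fin_num.
  elim/big_ind : _ => // [x y x0 y0|i _]; first by rewrite fin_numM.
  by rewrite lebesgue_measure_itv/=; case: ifP => _ //; rewrite -EFinB.
by rewrite ltey_eq => ->.
Qed.

Lemma sigma_finite_lebesgue_rV n : sigma_finite setT (@lebesgue_rV R n).
Proof.
exists (fun k => @cube n k%:R); last first.
  by move=> k; split; [exact: measurable_cube | exact: lebesgue_cube_lty].
apply/esym; rewrite -subTset => v _.
have [k vk] : exists k : nat, forall i, `|v ord0 i| <= k%:R.
  exists (\max_i Num.bound `|v ord0 i|)%N => i.
  apply: (le_trans (ltW (archi_boundP _))) => //.
  by rewrite ler_nat (leq_bigmax i).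
by exists k => // i; rewrite in_itv/= -ler_norml.
Qed.

(** A copy of [lebesgue_rV n] that carries the sigma-finiteness required by the
    theorems of Fubini and Tonelli. *)
Definition leb n : set 'rV[R]_n -> \bar R := lebesgue_rV n.
HB.instance Definition _ n := Measure.copy (@leb n) (lebesgue_rV n).
HB.instance Definition _ n :=
  @Measure_isSigmaFinite.Build _ _ _ (@leb n) (@sigma_finite_lebesgue_rV n).

(** [lebesgue_rV] is built by recursion from [\x^], whereas iterated integrals are
    taken against [\x]; both are determined by their values on rectangles. *)
Lemma product_lebE n A : measurable A ->
  (mu \x @leb n)%E A = (mu \x^ lebesgue_rV n)%E A.
Proof.
move=> mA.
apply: (@product_measure_unique _ _ _ _ _ mu (@leb n) (mu \x^ lebesgue_rV n)%E) => //.
by move=> B C mB mC; exact: (product_measure2E mu (lebesgue_rV n) mB mC).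
Qed.

Lemma ge0_integral_rVS_prod n (f : 'rV[R]_n.+1 -> \bar R) :
  measurable_fun setT f -> (forall x, 0 <= f x)%E ->
  (\int[lebesgue_rV n.+1]_x f x =
   \int[mu \x @leb n]_z f (rV_cons z))%E.
Proof.
move=> mf f0.
rewrite /= /lebesgue_rV_rec.
rewrite ge0_integral_pushforward//; last exact: measurable_rV_cons.
rewrite preimage_setT; apply: eq_measure_integral => A mA _ /=.
exact/esym/product_lebE.
Qed.

Lemma ge0_integral_rVS n (f : 'rV[R]_n.+1 -> \bar R) :
  measurable_fun setT f -> (forall x, 0 <= f x)%E ->
  (\int[lebesgue_rV n.+1]_x f x =
   \int[mu]_x \int[lebesgue_rV n]_v f (rV_cons (x, v)))%E.
Proof.
move=> mf f0; rewrite ge0_integral_rVS_prod// fubini_tonelli1//.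
by apply: measurableT_comp => //; exact: measurable_rV_cons.
Qed.

Lemma ge0_integral_rVSr n (f : 'rV[R]_n.+1 -> \bar R) :
  measurable_fun setT f -> (forall x, 0 <= f x)%E ->
  (\int[lebesgue_rV n.+1]_x f x =
   \int[lebesgue_rV n]_v \int[mu]_x f (rV_cons (x, v)))%E.
Proof.
move=> mf f0; rewrite ge0_integral_rVS_prod// fubini_tonelli2//.
by apply: measurableT_comp => //; exact: measurable_rV_cons.
Qed.

Lemma integrable_rVS_prod n (f : 'rV[R]_n.+1 -> \bar R) :
  (lebesgue_rV n.+1).-integrable setT f ->
  (mu \x @leb n)%E.-integrable setT (fun z => f (rV_cons z)).
Proof.
move=> /integrableP[mf fi]; apply/integrableP; split.
  by apply: measurableT_comp => //; exact: measurable_rV_cons.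
rewrite -(@ge0_integral_rVS_prod _ (fun x => `|f x|%E))//.
exact: measurableT_comp.
Qed.

Lemma integral_rVS_prod n (f : 'rV[R]_n.+1 -> \bar R) :
  (lebesgue_rV n.+1).-integrable setT f ->
  (\int[lebesgue_rV n.+1]_x f x =
   \int[mu \x @leb n]_z f (rV_cons z))%E.
Proof.
move=> fi; have fi' := integrable_rVS_prod fi.
have mf := measurable_int _ fi.
rewrite [LHS]integralE [RHS]integralE.
congr (_ - _)%E.
  have H := ge0_integral_rVS_prod (measurable_funepos mf) (funepos_ge0 f).
  by apply: (eq_trans H); apply: eq_integral => z _; rewrite !funeposE.
have H := ge0_integral_rVS_prod (measurable_funeneg mf) (funeneg_ge0 f).
by apply: (eq_trans H); apply: eq_integral => z _; rewrite !funenegE.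
Qed.

Lemma integral_rVS n (f : 'rV[R]_n.+1 -> \bar R) :
  (lebesgue_rV n.+1).-integrable setT f ->
  (\int[lebesgue_rV n.+1]_x f x =
   \int[mu]_x \int[lebesgue_rV n]_v f (rV_cons (x, v)))%E.
Proof.
move=> fi; rewrite integral_rVS_prod//.
by rewrite (integral12_prod_meas1 (integrable_rVS_prod fi)).
Qed.

Lemma integral_rVSr n (f : 'rV[R]_n.+1 -> \bar R) :
  (lebesgue_rV n.+1).-integrable setT f ->
  (\int[lebesgue_rV n.+1]_x f x =
   \int[lebesgue_rV n]_v \int[mu]_x f (rV_cons (x, v)))%E.
Proof.
move=> fi; rewrite integral_rVS_prod//.
by rewrite (integral21_prod_meas1 (integrable_rVS_prod fi)).
Qed.

Lemma ge0_integral_rV0 (f : 'rV[R]_0 -> \bar R) :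
  (\int[lebesgue_rV 0]_x f x = f 0%R)%E.
Proof.
have mf : measurable_fun setT f.
  have -> : f = cst (f 0) by apply/funext => x; congr f; apply/rowP => -[].
  exact: measurable_cst.
by rewrite /= integral_dirac// diracT mul1e.
Qed.

(** Lebesgue measure is the multiple by a of its image under the affine map: the
    two measures agree on half-open intervals. *)
Lemma ge0_integral_affine (a b : R) (f : R -> \bar R) : 0 < a ->
  measurable_fun setT f -> (forall x, 0 <= f x)%E ->
  (\int[mu]_x f (a * x + b)%R = (a^-1)%:E * \int[mu]_x f x)%E.
Proof.
move=> a0 mf f0.
pose g (x : measurableTypeR R) : measurableTypeR R := a * x + b.
have mg : measurable_fun setT g.
  apply: measurable_funD => //; exact: measurable_funM.
have muE A : measurable A -> mu A =
    mscale (NngNum (ltW a0)) (pushforward mu g) A.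
  move: A; apply: (@lebesgue_measure_unique R) => //= _ [[x y] _ <-].
  rewrite /mscale/= /pushforward.
  have -> : g @^-1` `]x, y] = `](x - b) / a, (y - b) / a]%classic.
    apply/seteqP; split => z /=; rewrite !in_itv/= ltr_pdivrMr// ler_pdivlMr//;
    by rewrite ltrBlDr lerBrDr (mulrC z).
  rewrite !lebesgue_measure_itv/= !lte_fin ltr_pM2r ?invr_gt0// ltrD2r.
  case: ifP => xy; last by rewrite mule0.
  by rewrite -!EFinB -EFinM; congr EFin; field; rewrite gt_eqF.
rewrite [X in (_ * X)%E](@eq_measure_integral _ _ _ _ (mscale (NngNum (ltW a0)) (pushforward mu g))); last first.
  by move=> A mA _; exact: (muE mg).
rewrite ge0_integral_mscale//= ge0_integral_pushforward//=.
by rewrite muleA -EFinM mulVf ?gt_eqF// mul1e.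
Qed.

Lemma ge0_integral_shift (b : R) (f : R -> \bar R) :
  measurable_fun setT f -> (forall x, 0 <= f x)%E ->
  (\int[mu]_x f (x + b)%R = \int[mu]_x f x)%E.
Proof.
move=> mf f0; have := ge0_integral_affine b ltr01 mf f0.
by rewrite invr1 mul1e => <-; apply: eq_integral => x _; rewrite mul1r.
Qed.

Lemma rV_consD n (x y : R) (v w : 'rV[R]_n) :
  rV_cons (x, v) + rV_cons (y, w) = rV_cons (x + y, v + w).
Proof. by apply/rowP => i; rewrite !mxE; case: unliftP => [j|] //=; rewrite mxE. Qed.

Lemma measurable_rV_consl n (v : 'rV[R]_n) :
  measurable_fun setT (fun x : R => rV_cons (x, v)).
Proof. by apply: measurableT_comp; [exact: measurable_rV_cons|exact: pair2_measurable]. Qed.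

Lemma measurable_addr_rV n (h : 'rV[R]_n) : measurable_fun setT (fun x : 'rV[R]_n => x + h).
Proof.
apply: measurable_fun_rVP => i.
rewrite (_ : (fun _ => _) = (fun x : 'rV[R]_n => x ord0 i + h ord0 i)).
  by apply: measurable_funD => //; exact: measurable_coord.
by apply/funext => x; rewrite mxE.
Qed.

Lemma ge0_integral_shift_rV n (h : 'rV[R]_n) (f : 'rV[R]_n -> \bar R) :
  measurable_fun setT f -> (forall x, 0 <= f x)%E ->
  (\int[lebesgue_rV n]_x f (x + h)%R = \int[lebesgue_rV n]_x f x)%E.
Proof.
elim: n h f => [|n IH] h f mf f0.
  by rewrite !ge0_integral_rV0 add0r; congr f; apply/rowP => -[].
rewrite ge0_integral_rVSr//; last first.
  by apply: (measurableT_comp mf); exact: measurable_addr_rV.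
rewrite [RHS](ge0_integral_rVSr mf f0).
rewrite -[h in LHS]rV_consK; set h0 := h ord0 ord0; set h' := \row_j _.
under eq_integral do under eq_integral do rewrite rV_consD.
under eq_integral => v _.
  rewrite (@ge0_integral_shift h0 (fun x => f (rV_cons (x, v + h'))))//.
    over.
  by apply: (measurableT_comp mf); exact: measurable_rV_consl.
apply: (IH h' (fun v => \int[mu]_x f (rV_cons (x, v)))%E).
  apply: (@measurable_fun_fubini_tonelli_G _ _ _ _ _ mu (fun z => f (rV_cons z))) => //.
  by apply: (measurableT_comp mf); exact: measurable_rV_cons.
by move=> v; exact: integral_ge0.
Qed.

Lemma lebesgue_rV_bounded n (A : set 'rV[R]_n) (r : R) :
  A `<=` @cube n r -> measurable A -> (lebesgue_rV n A < +oo)%E.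
Proof.
move=> Ar mA; apply: le_lt_trans (lebesgue_cube_lty n r).
by apply: le_measure => //; rewrite inE//; exact: measurable_cube.
Qed.

Lemma cube_ball n (x : 'rV[R]_n) (r : R) : 0 < r ->
  [set v : 'rV[R]_n | forall i, (`](x ord0 i - r), (x ord0 i + r)[%classic : set R) (v ord0 i)]
  = ball x r.
Proof.
move=> r0; apply/seteqP; split => v.
  move=> xv; split => // i j; rewrite (ord1 i).
  by have := xv j; rewrite /ball/= in_itv/= ltr_distlC.
by move=> [_ xv] i /=; have := xv ord0 i; rewrite /ball/= in_itv/= ltr_distlC.
Qed.

Lemma lebesgue_rV_open_gt0 n (A : set 'rV[R]_n) x :
  open A -> A x -> (0 < lebesgue_rV n A)%E.
Proof.
move=> oA Ax; have /nbhs_ballP[r /= r0 rA] : nbhs x A by exact: open_nbhs_nbhs.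
have mb : measurable (ball x r) by apply: open_measurable_rV; exact: ball_open.
apply: (@lt_le_trans _ _ (lebesgue_rV n (ball x r))); last first.
  by apply: le_measure => //; rewrite inE//; exact: open_measurable_rV.
rewrite -cube_ball// (@lebesgue_rV_box R n (fun i => `](x ord0 i - r), (x ord0 i + r)[%classic))//.
elim/big_ind : _ => // [|i _]; first exact: mule_gt0.
rewrite lebesgue_measure_itv/= lte_fin.
by rewrite ltrBlDr -addrA ltrDl addr_gt0// -EFinB lte_fin subr_gt0 ltrBlDr -addrA ltrDl addr_gt0.
Qed.

End Integration.

(** * Partial derivatives of C^1 functions *)

Section Calculus.
Context {R : realType}.

Lemma continuous_rV (T : topologicalType) n (f : T -> 'rV[R]_n) :
  (forall i, continuous (fun x => f x ord0 i)) -> continuous f.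
Proof.
move=> cf x; apply/cvg_ballP => e e0.
have : \forall y \near x, forall i, ball (f x ord0 i) e (f y ord0 i).
  by apply: filter_forall => i; have /cvg_ballP := cf i x; apply.
by apply: filterS => y xy; split => // i j; rewrite (ord1 i).
Qed.

Lemma continuous_rV_cons n : continuous (@rV_cons R n).
Proof.
apply: continuous_rV => i; rewrite /rV_cons.
under eq_fun do rewrite mxE.
case: unliftP => [j _|_] /=.
  by move=> z; apply: (@cvg_comp _ _ _ snd (fun v : 'rV[R]_n => v ord0 j)); [exact: cvg_snd|exact: coord_continuous].
by move=> z; exact: cvg_fst.
Qed.

Lemma continuous_rV_consr n (x : R) : continuous (fun v : 'rV[R]_n => rV_cons (x, v)).
Proof.
apply: continuous_rV => i; under eq_fun do rewrite mxE.
by case: unliftP => [j _|_] /=; [exact: coord_continuous|exact: cst_continuous].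
Qed.

Lemma continuous_rV_consl n (v : 'rV[R]_n) : continuous (fun x : R => rV_cons (x, v)).
Proof.
apply: continuous_rV => i; under eq_fun do rewrite mxE.
by case: unliftP => [j _|_] /=; [exact: cst_continuous|move=> x; exact: cvg_id].
Qed.

Lemma continuous_measurable_rV n (f : 'rV[R]_n -> R) : continuous f ->
  measurable_fun setT f.
Proof.
move=> cf; apply: (measurability _ (RGenOpens.measurableE R)) => _ [_ [x [y ->]] <-].
rewrite setTI; apply: open_measurable_rV; apply: open_comp; last exact: itv_open.
by move=> v _; exact: cf.
Qed.

(** Directional derivatives are ordinary derivatives along lines, which reduces
    the chain rules below to one variable. *)
Lemma is_derive_line n (u : 'rV[R]_n -> R) x v (l : R) :
  is_derive x v u l <-> is_derive (0 : R) (1 : R) (fun t : R => u (t *: v + x)) l.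
Proof.
have E : (fun h : R => h^-1 *: (u (h *: v + x) - u x)) =
  (fun h : R => h^-1 *: (u ((h *: 1 + 0) *: v + x) - u (0 *: v + x))).
  by apply/funext => h; rewrite [_ *: 1]mulr1 addr0 scale0r add0r.
split=> -[dd dv]; split.
- by rewrite /derivable /= -E.
- by rewrite -dv /derive /= -E.
- by move: dd; rewrite /derivable /= -E.
- by rewrite -dv /derive /= -E.
Qed.

Lemma is_derive_comp_rV n (u : 'rV[R]_n -> R) (g : R -> R) x v (l m : R) :
  is_derive x v u l -> is_derive (u x) (1 : R) g m ->
  is_derive x v (g \o u) (m * l).
Proof.
move=> /is_derive_line du dg; apply/is_derive_line.
have u0 : u (0 *: v + x) = u x by rewrite scale0r add0r.
rewrite -u0 in dg.
exact: (@is_derive1_comp _ g (fun t : R => u (t *: v + x)) 0 m l dg du).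
Qed.

Lemma derive_cons0 n (u : 'rV[R]_n.+1 -> R) (x : R) v l :
  is_derive (rV_cons (x, v)) (delta_mx ord0 ord0) u l <->
  is_derive x (1 : R) (fun t => u (rV_cons (t, v))) l.
Proof.
have E : (fun h : R => h^-1 *: (u (h *: delta_mx ord0 ord0 + rV_cons (x, v)) - u (rV_cons (x, v)))) =
  (fun h : R => h^-1 *: (u (rV_cons (h *: 1 + x, v)) - u (rV_cons (x, v)))).
  apply/funext => h; congr (_ *: (u _ - _)).
  apply/rowP => i; rewrite !mxE eqxx /=; case: unliftP => [j ->|->] /=.
    by rewrite mulr0 add0r.
  by rewrite [_ *: 1]mulr1 mulr1.
by split=> -[dd dv]; split; move: dd dv; rewrite /derivable /derive /= E.
Qed.

Lemma derive_consS n (u : 'rV[R]_n.+1 -> R) (x : R) v j l :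
  is_derive (rV_cons (x, v)) (delta_mx ord0 (lift ord0 j)) u l <->
  is_derive v (delta_mx ord0 j) (fun w => u (rV_cons (x, w))) l.
Proof.
have E : (fun h : R => h^-1 *: (u (h *: delta_mx ord0 (lift ord0 j) + rV_cons (x, v)) - u (rV_cons (x, v)))) =
  (fun h : R => h^-1 *: (u (rV_cons (x, h *: delta_mx ord0 j + v)) - u (rV_cons (x, v)))).
  apply/funext => h; congr (_ *: (u _ - _)).
  apply/rowP => i; rewrite !mxE eqxx /=; case: unliftP => [k ->|->] /=.
    by rewrite (inj_eq lift_inj) !mxE eqxx.
  by rewrite mulr0 add0r.
by split=> -[dd dv]; split; move: dd dv; rewrite /derivable /derive /= E.
Qed.

Lemma C1_is_derive n (u : 'rV[R]_n -> R) i x : C1 u ->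
  is_derive x (delta_mx ord0 i) u (partial i u x).
Proof. by move=> /(_ i)[+ _] => /(_ x); exact: derivableP. Qed.

Lemma is_derive_C1 n (u : 'rV[R]_n -> R) (g : 'I_n -> 'rV[R]_n -> R) :
  (forall i x, is_derive x (delta_mx ord0 i) u (g i x)) ->
  (forall i, continuous (g i)) -> C1 u.
Proof.
move=> du cg i; split=> [x|]; first by have [] := du i x.
have -> : partial i u = g i; last exact: cg.
by apply/funext => x; have [] := du i x.
Qed.

Lemma is_derive_partial n (u : 'rV[R]_n -> R) i x l :
  is_derive x (delta_mx ord0 i) u l -> partial i u x = l.
Proof. by case. Qed.

Lemma partial_cons0 n (u : 'rV[R]_n.+1 -> R) (x : R) v : C1 u ->
  is_derive x (1 : R) (fun t => u (rV_cons (t, v))) (partial ord0 u (rV_cons (x, v))).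
Proof. by move=> cu; apply/derive_cons0; exact: C1_is_derive. Qed.

Lemma is_derive_slice n (u : 'rV[R]_n.+1 -> R) (x : R) v j : C1 u ->
  is_derive v (delta_mx ord0 j) (fun w => u (rV_cons (x, w)))
    (partial (lift ord0 j) u (rV_cons (x, v))).
Proof. by move=> cu; apply/derive_consS; exact: C1_is_derive. Qed.

Lemma partial_slice n (u : 'rV[R]_n.+1 -> R) (x : R) v j : C1 u ->
  partial j (fun w => u (rV_cons (x, w))) v = partial (lift ord0 j) u (rV_cons (x, v)).
Proof. by move=> cu; apply: is_derive_partial; exact: is_derive_slice. Qed.

Lemma C1_slice n (u : 'rV[R]_n.+1 -> R) (x : R) : C1 u ->
  C1 (fun w => u (rV_cons (x, w))).
Proof.
move=> cu; apply: (@is_derive_C1 _ _ (fun j w => partial (lift ord0 j) u (rV_cons (x, w)))).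
  by move=> j v; exact: is_derive_slice.
move=> j v; apply: (@cvg_comp _ _ _ (fun v => rV_cons (x, v)) (partial (lift ord0 j) u) _ (nbhs (rV_cons (x, v)))).
  exact: continuous_rV_consr.
by have [_] := cu (lift ord0 j); exact.
Qed.

Lemma rV_cons_ball n (x y r : R) (v w : 'rV[R]_n) :
  ball (rV_cons (x, v)) r (rV_cons (y, w)) <-> ball x r y /\ ball v r w.
Proof.
split=> [[r0 b]|[b [r0 b']]].
  split; first by have := b ord0 ord0; rewrite !rV_cons0.
  by split => // i j; have := b i (lift ord0 j); rewrite (ord1 i) !rV_consS.
split => // i j; rewrite (ord1 i).
by case: (unliftP ord0 j) => [k ->|->]; rewrite ?rV_cons0 ?rV_consS.
Qed.

(** Joining y to z by segments parallel to the axes, the mean value theorem bounds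
    each increment. The segments stay in the ball because balls of the sup norm are
    boxes. *)
Lemma C1_lip n (u : 'rV[R]_n -> R) (M : R) x r : C1 u ->
  (forall i y, ball x r y -> `|partial i u y| <= M) ->
  forall y z, ball x r y -> ball x r z ->
  `|u z - u y| <= M * \sum_i `|z ord0 i - y ord0 i|.
Proof.
elim: n u x => [|n IH] u x cu Mu y z xy xz.
  rewrite big_ord0 mulr0 (_ : z = y) ?subrr ?normr0//.
  by apply/rowP => -[].
move: xy xz Mu; rewrite -(rV_consK x) -(rV_consK y) -(rV_consK z).
set x0 := x _ _; set x' := \row__ _; set y0 := y _ _; set y' := \row__ _.
set z0 := z _ _; set z' := \row__ _ => /rV_cons_ball[xy0 xy'] /rV_cons_ball[xz0 xz'] Mu.
rewrite big_ord_recl !rV_cons0 mulrDr.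
rewrite (_ : _ - _ = (u (rV_cons (z0, z')) - u (rV_cons (y0, z'))) +
  (u (rV_cons (y0, z')) - u (rV_cons (y0, y')))); last by rewrite addrA subrK.
apply: (le_trans (ler_normD _ _)); apply: lerD; last first.
  under [X in _ * X]eq_bigr do rewrite !rV_consS.
  apply: (IH (fun w => u (rV_cons (y0, w))) x') => //; first exact: C1_slice.
  by move=> i w xw; rewrite partial_slice//; apply: Mu; apply/rV_cons_ball.
wlog zy : y0 z0 xy0 xz0 / y0 <= z0 => [H|].
  have [|/ltW zy] := leP y0 z0; first exact: H.
  by rewrite distrC [X in _ * X]distrC; exact: H.
have [||c cyz ->] := @MVT_segment R (fun t => u (rV_cons (t, z')))
    (fun t => partial ord0 u (rV_cons (t, z'))) y0 z0 zy.
- by move=> t _; exact: partial_cons0.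
- apply: continuous_subspaceT => t.
  apply/differentiable_continuous/derivable1_diffP.
  by have [] := @partial_cons0 n u t z' cu.
- rewrite normrM ler_wpM2r//; apply: Mu; apply/rV_cons_ball; split => //.
  move: cyz xy0 xz0; rewrite in_itv/= /ball/= => /andP[yc cz].
  by rewrite !ltr_distlC => /andP[? ?] /andP[? ?]; apply/andP; split; lra.
Qed.

(** Continuous partial derivatives are locally bounded, which makes u locally
    Lipschitz. *)
Lemma C1_continuous n (u : 'rV[R]_n -> R) : C1 u -> continuous u.
Proof.
move=> cu; suff H (x : 'rV[R]_n) : u y @[y --> x] --> u x by exact: H.
have [M [r [M0 r0 Mr]]] : exists M r : R, [/\ 0 <= M, 0 < r &
    forall i y, ball x r y -> `|partial i u y| <= M].
  have : \forall y \near (x : 'rV[R]_n), forall i, `|partial i u y| <= `|partial i u x| + 1.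
    suff H i : \forall y \near (x : 'rV[R]_n), `|partial i u y| <= `|partial i u x| + 1.
      exact: (filter_forall _ H).
    have [_ /(_ x)] := cu i.
    move=> /cvgrPdist_lt /(_ 1 ltr01); apply: filterS => y /ltW xy.
    have := ler_normD (partial i u y - partial i u x) (partial i u x).
    rewrite subrK distrC => /le_trans; apply; lra.
  move=> /nbhs_ballP[r /= r0 rP].
  exists (\sum_i (`|partial i u x| + 1)), r; split => //.
    by apply: sumr_ge0 => k _; exact: addr_ge0.
  move=> i y xy.
  apply: (le_trans (rP y xy i)).
  by rewrite (bigD1 i)//= lerDl; apply: sumr_ge0 => k _; exact: addr_ge0.
have L := C1_lip cu Mr.
have Mn0 : 0 <= M * n%:R by exact: mulr_ge0.
apply/(@cvgrPdist_le _ _ _ _ (nbhs_filter (x : 'rV[R]_n))) => e e0.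
have d0 : 0 < e / (M * n%:R + 1) by apply: divr_gt0 => //; lra.
apply/nbhs_ballP; exists (Num.min r (e / (M * n%:R + 1))).
  by rewrite /= lt_min r0.
move=> y xye /=.
have xx : ball x r x by exact: ballxx.
have xy : ball x r y by apply: le_ball xye; rewrite ge_min lexx.
apply: (le_trans (L _ _ xy xx)).
have yd : forall i, `|x ord0 i - y ord0 i| <= e / (M * n%:R + 1).
  move=> i; have : ball x (e / (M * n%:R + 1)) y.
    by apply: le_ball xye; rewrite ge_min lexx orbT.
  by move=> [_ /(_ ord0 i)]; rewrite /ball/= => /ltW.
apply: (@le_trans _ _ (M * \sum_(i < n) (e / (M * n%:R + 1)))).
  by apply: ler_wpM2l => //; exact: ler_sum.
rewrite sumr_const card_ord -[X in M * X]mulr_natr.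
have : e / (M * n%:R + 1) * (M * n%:R + 1) = e by rewrite divfK//; lra.
move: d0; set c := e / _ => c0 ce; lra.
Qed.

End Calculus.

(** * Compactly supported functions *)

Section Compact_support.
Context {R : realType}.
Local Notation mu := (@lebesgue_measure R).

Definition vanish_off_cube n (r : R) (f : 'rV[R]_n -> R) :=
  forall x, ~ @cube R n r x -> f x = 0.

Lemma compact_cube n (r : R) : compact (@cube R n r).
Proof.
apply: (@rV_compact R n (fun=> `[- r, r]%classic)) => i.
exact: segment_compact.
Qed.

Lemma rV_hausdorff n : hausdorff_space 'rV[R]_n.
Proof. exact: norm_hausdorff. Qed.

Lemma closed_cube n (r : R) : closed (@cube R n r).
Proof. by apply: compact_closed; [exact: rV_hausdorff|exact: compact_cube]. Qed.

Lemma cube_normP n (r : R) (x : 'rV[R]_n) : 0 <= r -> @cube R n r x <-> `|x| <= r.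
Proof.
move=> r0; split=> [xr|xr i].
  rewrite [leLHS]/Num.Def.normr/= mx_normrE; apply/bigmax_leP; split => //= -[i j] _ /=.
  by rewrite (ord1 i) ler_norml; have := xr j; rewrite in_itv.
rewrite in_itv/= -ler_norml (le_trans _ xr)//.
by rewrite [leRHS]/Num.Def.normr/= mx_normrE; apply/bigmax_geP; right; exists (ord0, i).
Qed.

Lemma compact_sub_cube n (K : set 'rV[R]_n) : compact K ->
  exists2 r : R, 0 <= r & K `<=` @cube R n r.
Proof.
move=> /compact_bounded[M [_ KM]].
exists (`|M| + 1); first exact: addr_ge0.
move=> x Kx; apply/cube_normP; first exact: addr_ge0.
by apply: KM => //; rewrite (le_lt_trans (ler_norm _))// ltrDl.
Qed.

Lemma vanish_off_compact n (K : set 'rV[R]_n) (f : 'rV[R]_n -> R) :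
  compact K -> (forall x, ~ K x -> f x = 0) ->
  exists2 r : R, 0 <= r & vanish_off_cube r f.
Proof.
move=> /compact_sub_cube[r r0 Kr] fK; exists r => // x xr.
by apply: fK => Kx; exact/xr/Kr.
Qed.

Lemma supp_off n (f : 'rV[R]_n -> R) x : ~ supp f x -> f x = 0.
Proof.
move=> fx; apply/eqP; apply: contra_notT fx => fx; exact: subset_closure.
Qed.

Lemma C1cI n (W K : set 'rV[R]_n) u : C1 u -> compact K -> K `<=` W ->
  (forall x, ~ K x -> u x = 0) -> C1c W u.
Proof.
move=> cu cK KW uK.
have sK : supp u `<=` K.
  have cK' : closed K by apply: compact_closed => //; exact: rV_hausdorff.
  rewrite /supp (closure_id K).1//; apply: closure_subset => x /= ux.
  by apply: contrapT => /uK; exact/eqP.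
split => //; last exact: subset_trans KW.
by apply: subclosed_compact sK => //; exact: closed_closure.
Qed.

Lemma C1c_vanish n (W : set 'rV[R]_n) u : C1c W u ->
  exists2 r : R, 0 <= r & vanish_off_cube r u.
Proof.
by move=> [_ cs _]; apply: (vanish_off_compact cs); exact: supp_off.
Qed.

Lemma C1c_setT n u r : C1 u -> vanish_off_cube r u -> C1c [set: 'rV[R]_n] u.
Proof. by move=> cu ur; apply: (C1cI cu (@compact_cube n r)). Qed.

Lemma C1cT n (W : set 'rV[R]_n) u : C1c W u -> C1c setT u.
Proof. by case=> ? ? _; split. Qed.

Lemma partial_off_closed n (u : 'rV[R]_n -> R) (K : set 'rV[R]_n) i x :
  closed K -> (forall x, ~ K x -> u x = 0) -> ~ K x -> partial i u x = 0.
Proof.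
move=> cK uK Kx; rewrite /partial.
have -> : 'D_(delta_mx ord0 i) u x = 'D_(delta_mx ord0 i) (cst 0 : 'rV[R]_n -> R) x.
  apply: near_eq_derive.
  have : open_nbhs (x : 'rV[R]_n) (~` K) by split => //; exact: closed_openC.
  by move=> /open_nbhs_nbhs; apply: filterS => y /uK.
by rewrite derive_cst.
Qed.

Lemma partial_off_supp n (u : 'rV[R]_n -> R) i x : ~ supp u x -> partial i u x = 0.
Proof. by apply: partial_off_closed; [exact: closed_closure|exact: supp_off]. Qed.

Lemma partial_vanish n (u : 'rV[R]_n -> R) i r : vanish_off_cube r u ->
  vanish_off_cube r (partial i u).
Proof. by move=> ur x; apply: partial_off_closed => //; exact: closed_cube. Qed.

Lemma continuous_bounded n (f : 'rV[R]_n -> R) r : continuous f ->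
  vanish_off_cube r f -> exists2 M : R, 0 <= M & forall x, `|f x| <= M.
Proof.
move=> cf fr.
have /compact_bounded[M [_ KM]] : compact (f @` @cube R n r).
  by apply: continuous_compact; [exact: continuous_subspaceT|exact: compact_cube].
exists (`|M| + 1) => [|x]; first exact: addr_ge0.
have [xr|/fr ->] := pselect (@cube R n r x); last by rewrite normr0 addr_ge0.
by apply: KM; [rewrite (le_lt_trans (ler_norm _))// ltrDl|exists x].
Qed.

Lemma bounded_integrable n (f : 'rV[R]_n -> R) (r M : R) : measurable_fun setT f ->
  vanish_off_cube r f -> (forall x, `|f x| <= M) ->
  (lebesgue_rV n).-integrable setT (EFin \o f).
Proof.
move=> mf fr fM.
have -> : EFin \o f = (EFin \o f) \_ (@cube R n r).
  apply/funext => x; rewrite patchE; case: ifPn => // /negP.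
  by rewrite inE /= => /fr ->.
apply/(integrable_mkcond _ (@measurable_cube R n r)).
apply: measurable_bounded_integrable; first exact: measurable_cube.
- exact: lebesgue_cube_lty.
- exact: measurable_funTS.
- by exists M; split; [exact: num_real|move=> y My x _ /=; apply: (le_trans (fM x)); exact: ltW].
Qed.

Lemma continuous_integrable n (f : 'rV[R]_n -> R) r : continuous f ->
  vanish_off_cube r f -> (lebesgue_rV n).-integrable setT (EFin \o f).
Proof.
move=> cf fr; have [M _ fM] := continuous_bounded cf fr.
by apply: bounded_integrable fr fM; exact: continuous_measurable_rV.
Qed.

Lemma integral_derive_vanish (f g : R -> R) (a b : R) : a < b ->
  (forall x, is_derive x (1 : R) f (g x)) -> continuous g ->
  (forall x, x \notin `[a, b] -> g x = 0) ->
  (\int[mu]_x (g x)%:E = (f b)%:E - (f a)%:E)%E.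
Proof.
move=> ab fg cg g0.
have -> : (\int[mu]_x (g x)%:E = \int[mu]_(x in `[a, b]) (g x)%:E)%E.
  rewrite [RHS]integral_mkcond; apply: eq_integral => x _.
  rewrite patchE; case: ifPn => //; rewrite mem_setE => /g0 ->//.
have cf : continuous f.
  by move=> x; apply/differentiable_continuous/derivable1_diffP; have [] := fg x.
apply: continuous_FTC2 => //.
- exact: continuous_subspaceT.
- split.
  + by move=> x _; have [] := fg x.
  + exact/cvg_at_right_filter/cf.
  + exact/cvg_at_left_filter/cf.
- by move=> x _; rewrite derive1E; have [] := fg x.
Qed.

(** The fundamental theorem of calculus in the i-th variable, which Fubini allows
    to integrate first. *)
Lemma integral_partial0 n (u : 'rV[R]_n -> R) i r : C1 u -> vanish_off_cube r u ->
  (\int[lebesgue_rV n]_x (partial i u x)%:E = 0)%E.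
Proof.
elim: n u i => [|n IH] u i; first by case: i.
move=> cu ur.
have pint := continuous_integrable (cu i).2 (partial_vanish i ur).
have cubeS x v : @cube R n.+1 r (rV_cons (x, v)) -> x \in `[- r, r] /\ @cube R n r v.
  move=> c; split; first by have := c ord0; rewrite rV_cons0.
  by move=> j; have := c (lift ord0 j); rewrite rV_consS.
case: (unliftP ord0 i) pint => [j ->|->] pint.
  rewrite (integral_rVS pint).
  rewrite (eq_integral (cst 0%E)) ?integral0// => x _ /=.
  rewrite -[RHS](IH (fun w => u (rV_cons (x, w))) j).
  - by apply: eq_integral => v _; rewrite partial_slice.
  - exact: C1_slice.
  - by move=> v vr; apply: ur => /cubeS[].
rewrite (integral_rVSr pint).
rewrite (eq_integral (cst 0%E)) ?integral0// => v _ /=.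
have r0 : - (`|r| + 1) < `|r| + 1.
  by apply: (@lt_trans _ _ 0); rewrite ?oppr_lt0 ltr_wpDl.
have dd (x : R) := partial_cons0 x v cu.
rewrite (integral_derive_vanish r0 dd).
- rewrite !ur ?subee//.
  + move=> /cubeS[+ _]; rewrite in_itv/= lerN2 => /andP[+ _].
    by rewrite leNgt (le_lt_trans (ler_norm r))// ltrDl.
  + move=> /cubeS[+ _]; rewrite in_itv/= => /andP[_ +].
    by rewrite leNgt (le_lt_trans (ler_norm r))// ltrDl.
- move=> x; apply: (@cvg_comp _ _ _ (fun x => rV_cons (x, v)) (partial ord0 u) _ (nbhs (rV_cons (x, v)))).
    exact: continuous_rV_consl.
  by have [_] := cu ord0; exact.
- move=> x xr; apply: (partial_vanish ord0 ur) => /cubeS[xr' _].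
  move/negP: xr; apply; move: xr'; rewrite !in_itv/= => /andP[? ?].
  by have := ler_norm r; move=> ?; apply/andP; split; lra.
Qed.

End Compact_support.

(** * Auxiliary functions of one variable *)

Section Functions.
Context {R : realType}.

Lemma is_derive_continuous (f : R -> R) (x l : R) :
  is_derive x (1 : R) f l -> f y @[y --> x] --> f x.
Proof. by move=> [+ _]; move/derivable1_diffP/differentiable_continuous. Qed.

(** This covers the origin for truncated powers and for powers of the absolute
    value, which are both of the form h w(h) with w continuous. *)
Lemma is_derive_mul_id0 (w : R -> R) : w h @[h --> (0 : R)] --> w 0 ->
  is_derive (0 : R) (1 : R) (fun h => h * w h) (w 0).
Proof.
move=> cw.
have H : (fun h : R => h^-1 *: ((h *: (1 : R) + 0) * w (h *: (1 : R) + 0) - 0 * w 0)) @ 0^' --> w 0.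
  apply: cvg_trans (cvg_within_filter _ cw).
  apply: near_eq_cvg; near=> h.
  rewrite [_ *: 1]mulr1 addr0 mul0r subr0 /= [_ *: _]mulrA mulVf ?mul1r//.
  by near: h; exact: nbhs_dnbhs_neq.
split.
  by apply/cvg_ex; exists (w 0).
by apply/cvg_lim.
Unshelve. all: by end_near. Qed.

Definition posx (k : nat) (s : R) : R := (Num.max 0 s) ^+ k.

Lemma posx_ge0 k s : 0 <= posx k s.
Proof. by rewrite exprn_ge0// le_max lexx. Qed.

Lemma posx_neg k s : s <= 0 -> posx k.+1 s = 0.
Proof. by move=> s0; rewrite /posx max_l// expr0n. Qed.

Lemma posx_pos k s : 0 <= s -> posx k s = s ^+ k.
Proof. by move=> s0; rewrite /posx max_r. Qed.

Lemma continuous_posx k : continuous (posx k).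
Proof.
move=> s; apply: (@continuous_comp _ _ _ (fun s : R => Num.max 0 s) (fun t => t ^+ k)); last exact: exprn_continuous.
have -> : (fun t : R => Num.max 0 t) = (fun t => 2^-1 * (t + `|t|)).
  apply/funext => t; have [t0|t0] := leP 0 t.
    by rewrite ger0_norm//; lra.
  by rewrite ltr0_norm//; lra.
apply: cvgM; first exact: cvg_cst.
by apply: cvgD; [exact: cvg_id|apply: cvg_norm; exact: cvg_id].
Qed.

Lemma is_derive_posx k (s : R) :
  is_derive s (1 : R) (posx k.+2) (k.+2%:R * posx k.+1 s).
Proof.
have [s0|s0|->] := ltgtP s 0.
- rewrite posx_neg 1?ltW// mulr0.
  apply: (@near_eq_is_derive _ _ _ (cst 0)).
  by near=> t; rewrite posx_neg 1?ltW//; near: t; apply: lt_nbhsl.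
- rewrite posx_pos 1?ltW//.
  apply: (@near_eq_is_derive R R R (fun t : R => t ^+ k.+2)).
    by near=> t; rewrite posx_pos 1?ltW//; near: t; apply: lt_nbhsr.
  have -> : (fun t : R => t ^+ k.+2) = (@id R) ^+ k.+2.
    by apply/funext => t; rewrite exprfctE.
  have := @is_deriveX _ _ (@id R) k.+2 s (1 : R) 1 (is_derive_id _ _).
  by move/is_derive_eq; apply; rewrite /= [_ *: 1]mulr1 -mulr_natl.
- have -> : posx k.+2 = (fun h => h * posx k.+1 h).
    apply/funext => h; have [h0|h0] := leP h 0.
      by rewrite !posx_neg// mulr0.
    by rewrite !posx_pos 1?ltW// -exprS.
  rewrite [X in is_derive _ _ _ X](_ : _ = posx k.+1 0); last by rewrite posx_neg// mulr0.
  by apply: is_derive_mul_id0; exact: continuous_posx.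
Unshelve. all: by end_near. Qed.

(** The signed power; (b + 1) times it is the derivative of |s|^(b+1). *)
Definition spow (b s : R) : R := Num.sg s * `|s| `^ b.

Lemma spow_continuous (b : R) : 0 < b -> continuous (spow b).
Proof.
move=> b0 s.
have [s0|s0|->] := ltgtP s 0.
- apply: (@is_derive_continuous _ _ (- (b * (- s) `^ (b - 1) * -1))).
  apply: (@near_eq_is_derive _ _ _ (fun t => - ((- t) `^ b))).
    by near=> t; rewrite /spow ltr0_sg ?ltr0_norm ?mulN1r//; near: t; apply: lt_nbhsl.
  have s0' : 0 < - s by rewrite oppr_gt0.
  exact: (is_deriveN (@is_derive1_comp _ (fun t => t `^ b) -%R s _ _ (is_derive1_powR b s0') (is_deriveN (is_derive_id s 1)))).
- apply: (@is_derive_continuous _ _ (b * s `^ (b - 1))).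
  apply: (@near_eq_is_derive _ _ _ (fun t => t `^ b)).
    by near=> t; rewrite /spow gtr0_sg ?gtr0_norm ?mul1r//; near: t; apply: lt_nbhsr.
  exact: is_derive1_powR.
- rewrite /continuous_at /spow sgr0 mul0r.
  apply/cvgrPdist_le => e e0; near=> t.
  rewrite sub0r normrN normrM.
  apply: (@le_trans _ _ (`|t| `^ b)).
    rewrite [X in _ * X]ger0_norm ?powR_ge0// ler_piMl ?powR_ge0//.
    by rewrite normr_sg; case: (t != 0).
  rewrite -[leRHS](@powRr1 _ e (ltW e0)) -(mulVf (lt0r_neq0 b0)) powRrM.
  apply: ge0_ler_powR; rewrite ?nnegrE ?powR_ge0 ?(ltW b0)//; apply: ltW.
  near: t; apply/nbhs_ballP; exists (e `^ b^-1); first exact: powR_gt0.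
  by move=> z; rewrite /ball/= sub0r normrN.
Unshelve. all: by end_near. Qed.

Lemma is_derive_abs_powR (a s : R) : 1 < a ->
  is_derive s (1 : R) (fun t : R => `|t| `^ a) (a * spow (a - 1) s).
Proof.
move=> a1.
have b0 : 0 < a - 1 by rewrite subr_gt0.
have [s0|s0|->] := ltgtP s 0.
- apply: (@near_eq_is_derive _ _ _ ((fun t => t `^ a) \o -%R)).
    by near=> t; rewrite /= ltr0_norm//; near: t; apply: lt_nbhsl.
  have s0' : 0 < - s by rewrite oppr_gt0.
  have := @is_derive1_comp _ (fun t => t `^ a) -%R s _ _ (is_derive1_powR a s0') (is_deriveN (is_derive_id s 1)).
  by move/is_derive_eq; apply; rewrite /spow ltr0_sg// ltr0_norm// mulrN1 mulN1r mulrN.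
- apply: (@near_eq_is_derive _ _ _ (fun t => t `^ a)).
    by near=> t; rewrite /= gtr0_norm//; near: t; apply: lt_nbhsr.
  have := is_derive1_powR a s0.
  by move/is_derive_eq; apply; rewrite /spow gtr0_sg// gtr0_norm// mul1r.
- have -> : (fun t : R => `|t| `^ a) = (fun h => h * spow (a - 1) h).
    apply/funext => h; rewrite /spow mulrA (mulrC h) -normrEsg.
    by rewrite mulr_powRB1// (lt_trans ltr01).
  rewrite [X in is_derive _ _ _ X](_ : _ = spow (a - 1) 0); last by rewrite /spow sgr0 mul0r mulr0.
  by apply: is_derive_mul_id0; exact: spow_continuous.
Unshelve. all: by end_near. Qed.

(** A step from 0 to 1 on the interval [0, 1]. Its derivative is the tent of
    height 2, so that it is only of class C^1, which suffices for test functions. *)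
Definition sstep (s : R) : R :=
  2 * posx 2 s - 4 * posx 2 (s - 2^-1) + 2 * posx 2 (s - 1).

Definition dsstep (s : R) : R :=
  4 * posx 1 s - 8 * posx 1 (s - 2^-1) + 4 * posx 1 (s - 1).

Lemma sstep_le0 s : s <= 0 -> sstep s = 0.
Proof.
move=> s0; rewrite /sstep !posx_neg ?mulr0 ?addr0 ?subr0//; lra.
Qed.

Lemma sstep_ge1 s : 1 <= s -> sstep s = 1.
Proof. by move=> s1; rewrite /sstep !posx_pos; [field|lra|lra|lra]. Qed.

Lemma dsstep_ge0 s : 0 <= dsstep s.
Proof.
rewrite /dsstep; have [s0|s0] := leP s 0.
  by rewrite !posx_neg ?mulr0 ?addr0 ?subr0//; lra.
rewrite (posx_pos _ (ltW s0)); have [s1|s1] := leP s 2^-1.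
  by rewrite ![posx 1 (s - _)]posx_neg; lra.
rewrite (@posx_pos 1 (s - 2^-1)); last lra.
by have [s2|s2] := leP s 1; [rewrite posx_neg|rewrite posx_pos]; lra.
Qed.

Lemma dsstep_out s : s \notin `[0, 1] -> dsstep s = 0.
Proof.
rewrite in_itv/= negb_and -!ltNge => /orP[s0|s0].
  by rewrite /dsstep !posx_neg; lra.
by rewrite /dsstep !posx_pos; lra.
Qed.

Lemma is_derive_shift (f : R -> R) (c s l : R) : is_derive (s - c) (1 : R) f l ->
  is_derive s (1 : R) (fun t => f (t - c)) l.
Proof.
move=> df.
have dg : is_derive s (1 : R) (fun t : R => t - c) 1.
  have := is_deriveB (is_derive_id s (1 : R)) (is_derive_cst c s (1 : R)).
  by move/is_derive_eq; apply; rewrite subr0.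
by have := @is_derive1_comp _ f (fun t => t - c) s _ _ df dg; move/is_derive_eq; apply; rewrite mulr1.
Qed.

Lemma is_derive_sstep (s : R) : is_derive s (1 : R) sstep (dsstep s).
Proof.
have d0 := is_deriveZ 2 (is_derive_posx 0 s).
have d1 := is_deriveZ 4 (@is_derive_shift _ 2^-1 _ _ (is_derive_posx 0 (s - 2^-1))).
have d2 := is_deriveZ 2 (@is_derive_shift _ 1 _ _ (is_derive_posx 0 (s - 1))).
have := is_deriveD (is_deriveB d0 d1) d2.
by move/is_derive_eq; apply; rewrite /dsstep /GRing.scale/=; ring.
Qed.

Lemma continuous_dsstep : continuous dsstep.
Proof.
move=> s; rewrite /dsstep; apply: cvgD; [apply: cvgB|]; apply: cvgM; try exact: cvg_cst.
- exact: continuous_posx.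
- apply: (@cvg_comp _ _ _ (fun t => t - 2^-1) (posx 1) _ (nbhs (s - 2^-1))); last exact: continuous_posx.
  by apply: cvgB; [exact: cvg_id|exact: cvg_cst].
- apply: (@cvg_comp _ _ _ (fun t => t - 1) (posx 1) _ (nbhs (s - 1))); last exact: continuous_posx.
  by apply: cvgB; [exact: cvg_id|exact: cvg_cst].
Qed.

Lemma sstep_nondecreasing : {homo sstep : x y / x <= y}.
Proof.
move=> x y xy.
have [||] := @MVT_segment R sstep dsstep x y xy.
- by move=> t _; exact: is_derive_sstep.
- by apply: continuous_subspaceT => t; apply: is_derive_continuous (is_derive_sstep t).
move=> c _ E; rewrite -subr_ge0 E mulr_ge0 ?dsstep_ge0// subr_ge0//.
Qed.

Lemma sstep_ge0 s : 0 <= sstep s.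
Proof.
have [s0|s0] := leP s 0; first by rewrite sstep_le0.
by rewrite -(sstep_le0 (lexx 0)); apply: sstep_nondecreasing; exact: ltW.
Qed.

Lemma sstep_le1 s : sstep s <= 1.
Proof.
have [s0|s0] := leP 1 s; first by rewrite sstep_ge1.
by rewrite -(sstep_ge1 (lexx 1)); apply: sstep_nondecreasing; exact: ltW.
Qed.

End Functions.

(** * Gradients *)

Section C1_algebra.
Context {R : realType}.

(** A C^1 function with its partial derivatives, so that each rule of calculus
    yields the derivatives together with the regularity. *)
Definition has_grad n (u : 'rV[R]_n -> R) (g : 'I_n -> 'rV[R]_n -> R) :=
  (forall i x, is_derive x (delta_mx ord0 i) u (g i x)) /\
  (forall i, continuous (g i)).

Lemma C1_has_grad n (u : 'rV[R]_n -> R) : C1 u -> has_grad u (fun i => partial i u).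
Proof. by move=> cu; split=> [i x|i]; [exact: C1_is_derive|have [] := cu i]. Qed.

Lemma has_grad_C1 n (u : 'rV[R]_n -> R) g : has_grad u g -> C1 u.
Proof. by move=> [du cg]; exact: is_derive_C1 du cg. Qed.

Lemma has_grad_partial n (u : 'rV[R]_n -> R) g i x : has_grad u g -> partial i u x = g i x.
Proof. by move=> [du _]; exact: is_derive_partial (du i x). Qed.

Lemma has_grad_continuous n (u : 'rV[R]_n -> R) g : has_grad u g -> continuous u.
Proof. by move=> /has_grad_C1 /C1_continuous. Qed.

Lemma has_grad_ext n (u v : 'rV[R]_n -> R) g h : u =1 v -> (forall i, g i =1 h i) ->
  has_grad u g -> has_grad v h.
Proof.
move=> /funext <- gh; rewrite (_ : h = g)//.
by apply/funext => i; apply/funext => x; rewrite gh.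
Qed.

Lemma has_grad_comp n (u : 'rV[R]_n -> R) g (f df : R -> R) :
  (forall s, is_derive s (1 : R) f (df s)) -> continuous df ->
  has_grad u g -> has_grad (fun x => f (u x)) (fun i x => df (u x) * g i x).
Proof.
move=> dfE cdf ug; have cu := has_grad_continuous ug; case: ug => du cg.
split=> [i x|i x]; first exact: is_derive_comp_rV.
apply: (@cvgM R 'rV[R]_n (nbhs x)); last exact: cg.
by apply: (@cvg_comp _ _ _ u df _ (nbhs (u x))); [exact: cu|exact: cdf].
Qed.

Lemma has_gradM n (u v : 'rV[R]_n -> R) g h : has_grad u g -> has_grad v h ->
  has_grad (fun x => u x * v x) (fun i x => u x * h i x + v x * g i x).
Proof.
move=> ug vh; have cu := has_grad_continuous ug; have cv := has_grad_continuous vh.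
case: ug vh => du cg [dv ch].
split=> [i x|i x]; first exact: (is_deriveM (du i x) (dv i x)).
apply: (@cvgD R _ 'rV[R]_n (nbhs x)); apply: (@cvgM R 'rV[R]_n (nbhs x)).
- exact: cu.
- exact: ch.
- exact: cv.
- exact: cg.
Qed.

Lemma has_gradD n (u v : 'rV[R]_n -> R) g h : has_grad u g -> has_grad v h ->
  has_grad (fun x => u x + v x) (fun i x => g i x + h i x).
Proof.
move=> [du cg] [dv ch].
split=> [i x|i x]; first exact: (is_deriveD (du i x) (dv i x)).
by apply: (@cvgD R _ 'rV[R]_n (nbhs x)); [exact: cg|exact: ch].
Qed.

Lemma has_grad_cst n (c : R) : has_grad (fun _ : 'rV[R]_n => c) (fun _ _ => 0).
Proof. by split=> [i x|i x]; [exact: is_derive_cst|exact: cst_continuous]. Qed.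

Lemma has_gradZ n (c : R) (u : 'rV[R]_n -> R) g : has_grad u g ->
  has_grad (fun x => c * u x) (fun i x => c * g i x).
Proof.
move=> ug; apply: has_grad_ext (has_gradM (has_grad_cst n c) ug) => // i x.
by rewrite /= mulr0 addr0.
Qed.

Lemma has_grad_coord n (j : 'I_n) :
  has_grad (fun x : 'rV[R]_n => x ord0 j) (fun i _ => (i == j)%:R).
Proof.
split=> [i x|i x]; last exact: cst_continuous.
apply/is_derive_line.
have -> : (fun t : R => (t *: (delta_mx ord0 i : 'rV[R]_n) + x) ord0 j) =
  (fun t : R => t * (i == j)%:R + x ord0 j).
  by apply/funext => t; rewrite !mxE eqxx /= eq_sym.
have := is_deriveD (is_deriveM (is_derive_id 0 (1 : R)) (is_derive_cst ((i == j)%:R : R) 0 (1 : R))) (is_derive_cst (x ord0 j) 0 (1 : R)).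
by move/is_derive_eq; apply; rewrite /GRing.scale/=; ring.
Qed.

Lemma has_grad_sum n (I : Type) (s : seq I) (u : I -> 'rV[R]_n -> R) g :
  (forall k, has_grad (u k) (g k)) ->
  has_grad (fun x => \sum_(k <- s) u k x) (fun i x => \sum_(k <- s) g k i x).
Proof.
move=> ug; elim: s => [|k s IH].
  by apply: has_grad_ext (has_grad_cst n 0) => [x|i x]; rewrite big_nil.
by apply: has_grad_ext (has_gradD (ug k) IH) => [x|i x]; rewrite big_cons.
Qed.

Definition sqnorm n (x : 'rV[R]_n) : R := \sum_i x ord0 i ^+ 2.

Lemma has_grad_sqnorm n : has_grad (@sqnorm n) (fun i x => 2 * x ord0 i).
Proof.
have H := has_grad_sum (index_enum 'I_n) (fun k => has_gradM (has_grad_coord k) (has_grad_coord k)).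
apply: has_grad_ext H => // i x /=.
rewrite (bigD1 i)//= eqxx mulr1 big1 ?addr0; first by rewrite -mulr2n mulr_natl.
by move=> k ki; rewrite eq_sym (negbTE ki) mulr0 addr0.
Qed.

End C1_algebra.

(** * The Euclidean norm *)

Section Euclidean_norm.
Context {R : realType}.

Lemma sqnorm_ge0 n (v : 'rV[R]_n) : 0 <= sqnorm v.
Proof. by apply: sumr_ge0 => i _; exact: sqr_ge0. Qed.

Lemma enorm_ge0 n (v : 'rV[R]_n) : 0 <= enorm v.
Proof. exact: sqrtr_ge0. Qed.

Lemma sqr_enorm n (v : 'rV[R]_n) : enorm v ^+ 2 = sqnorm v.
Proof. by rewrite sqr_sqrtr// sqnorm_ge0. Qed.

Lemma enorm0 n : enorm (0 : 'rV[R]_n) = 0.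
Proof. by rewrite /enorm big1 ?sqrtr0// => i _; rewrite mxE expr0n. Qed.

Lemma enorm_eq0 n (v : 'rV[R]_n) : enorm v = 0 -> v = 0.
Proof.
move=> v0; have : sqnorm v = 0 by rewrite -sqr_enorm v0 expr0n.
move/eqP; rewrite psumr_eq0; last by move=> i _; exact: sqr_ge0.
move=> /allP vi; apply/rowP => i; rewrite mxE; apply/eqP.
by have := vi i (mem_index_enum i); rewrite sqrf_eq0.
Qed.

Lemma enormZ n (c : R) (v : 'rV[R]_n) : enorm (c *: v) = `|c| * enorm v.
Proof.
rewrite /enorm; under eq_bigr do rewrite mxE exprMn.
by rewrite -mulr_sumr sqrtrM ?sqr_ge0// sqrtr_sqr.
Qed.

Lemma ler_coord_enorm n (v : 'rV[R]_n) i : `|v ord0 i| <= enorm v.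
Proof.
rewrite -sqrtr_sqr ler_wsqrtr// (bigD1 i)//= lerDl.
by apply: sumr_ge0 => k _; exact: sqr_ge0.
Qed.

(** If C is the scalar product, the squares of |w|^2 v_i - C w_i add up to
    |w|^2 (|v|^2 |w|^2 - C^2). *)
Lemma cauchy_schwarz n (v w : 'rV[R]_n) :
  \sum_i v ord0 i * w ord0 i <= enorm v * enorm w.
Proof.
set C := \sum_i _.
have [C0|C0] := leP C 0; first by apply: (le_trans C0); rewrite mulr_ge0// enorm_ge0.
rewrite -ler_sqr ?nnegrE ?mulr_ge0 ?enorm_ge0 ?(ltW C0)// exprMn !sqr_enorm.
have H : 0 <= sqnorm w * (sqnorm v * sqnorm w - C ^+ 2).
  rewrite [leRHS](_ : _ = \sum_i (sqnorm w * v ord0 i - C * w ord0 i) ^+ 2).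
    by apply: sumr_ge0 => i _; exact: sqr_ge0.
  rewrite [RHS](eq_bigr (fun i => sqnorm w ^+ 2 * (v ord0 i ^+ 2) +
    ((- 2 * sqnorm w * C) * (v ord0 i * w ord0 i) + C ^+ 2 * (w ord0 i ^+ 2)))); last first.
    by move=> i _; ring.
  rewrite !big_split/= -!mulr_sumr -/C -/(sqnorm v) -/(sqnorm w); ring.
have [w0|w0] := leP (sqnorm w) 0.
  have {}w0 : enorm w = 0 by apply/eqP; rewrite -sqrf_eq0 sqr_enorm eq_le w0 sqnorm_ge0.
  have {}w0 : w = 0 by exact: enorm_eq0.
  by exfalso; move: C0; rewrite /C big1 ?ltxx// => i _; rewrite w0 mxE mulr0.
by rewrite -subr_ge0 -(pmulr_rge0 _ w0).
Qed.

Lemma continuous_sqnorm n : continuous (@sqnorm R n).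
Proof. exact: has_grad_continuous (has_grad_sqnorm _). Qed.

Lemma continuous_enorm n : continuous (@enorm R n).
Proof.
move=> x; apply: (@cvg_comp _ _ _ (@sqnorm R n) Num.sqrt _ (nbhs (sqnorm x))).
  exact: continuous_sqnorm.
exact: sqrt_continuous.
Qed.

Lemma continuous_comp_rV n m (f : 'rV[R]_n -> 'rV[R]_m) (g : 'rV[R]_m -> R) :
  continuous f -> continuous g -> continuous (fun x => g (f x)).
Proof.
by move=> cf cg x; apply: (@cvg_comp _ _ _ f g _ (nbhs (f x))); [exact: cf|exact: cg].
Qed.

Lemma continuous_compR n (f : 'rV[R]_n -> R) (g : R -> R) :
  continuous f -> continuous g -> continuous (fun x => g (f x)).
Proof.
by move=> cf cg x; apply: (@cvg_comp _ _ _ f g _ (nbhs (f x))); [exact: cf|exact: cg].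
Qed.

Lemma continuous_grad n (u : 'rV[R]_n -> R) : C1 u -> continuous (grad u).
Proof.
move=> cu; apply: continuous_rV => i.
have -> : (fun x => grad u x ord0 i) = partial i u by apply/funext => x; rewrite mxE.
by have [] := cu i.
Qed.

Lemma continuous_enorm_grad n (u : 'rV[R]_n -> R) : C1 u ->
  continuous (fun x => enorm (grad u x)).
Proof. by move=> cu; apply: continuous_comp_rV; [exact: continuous_grad|exact: continuous_enorm]. Qed.

Lemma abs_powR_continuous (p : R) : 0 < p -> continuous (fun t : R => `|t| `^ p).
Proof.
move=> p0.
have -> : (fun t : R => `|t| `^ p) = (fun t => spow p `|t|).
  apply/funext => t; rewrite /spow normr_id.
  have [->|t0] := eqVneq t 0; first by rewrite normr0 sgr0 mul0r powR0// gt_eqF.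
  by rewrite gtr0_sg ?normr_gt0// mul1r.
move=> t; apply: (@cvg_comp _ _ _ (fun t : R => `|t|) (spow p) _ (nbhs `|t|)).
  by apply: cvg_norm; exact: cvg_id.
exact: spow_continuous.
Qed.

End Euclidean_norm.

(** * Rayleigh quotients *)

Section Energies.
Context {R : realType}.

Lemma integral_gt0 n (f : 'rV[R]_n -> R) x : continuous f -> (forall y, 0 <= f y) ->
  0 < f x -> (0 < \int[lebesgue_rV n]_y (f y)%:E)%E.
Proof.
move=> cf f0 fx.
pose A : set 'rV[R]_n := [set y | f x / 2 < f y].
have oA : open A by apply: (@open_comp _ _ f [set z | f x / 2 < z]) => //; exact: open_gt.
have Ax : A x by rewrite /A/=; lra.
have mA : measurable A by exact: open_measurable_rV.
apply: (@lt_le_trans _ _ (\int[lebesgue_rV n]_(y in A) (f x / 2)%:E)%E).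
  rewrite integral_cst// mule_gt0//; first by rewrite lte_fin divr_gt0.
  exact: lebesgue_rV_open_gt0 Ax.
apply: (@le_trans _ _ (\int[lebesgue_rV n]_(y in A) (f y)%:E)%E).
  apply: ge0_le_integral => //.
  - by move=> y _; rewrite lee_fin divr_ge0// ltW.
  - by apply/measurable_EFinP; apply: measurable_funTS; exact: continuous_measurable_rV.
  - by move=> y Ay; rewrite lee_fin; exact: ltW.
apply: ge0_subset_integral => //.
- by apply/measurable_EFinP; exact: continuous_measurable_rV.
- by move=> y _; rewrite lee_fin.
Qed.

Definition mass n (p : R) (u : 'rV[R]_n -> R) : R :=
  fine (\int[lebesgue_rV n]_x (`|u x| `^ p)%:E)%E.

Definition dirichlet n (p : R) (u : 'rV[R]_n -> R) : R :=
  fine (\int[lebesgue_rV n]_x (enorm (grad u x) `^ p)%:E)%E.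

Lemma grad_off_supp n (u : 'rV[R]_n -> R) x : ~ supp u x -> grad u x = 0.
Proof. by move=> ux; apply/rowP => i; rewrite !mxE partial_off_supp. Qed.

Lemma grad_vanish n (u : 'rV[R]_n -> R) r x : vanish_off_cube r u ->
  ~ @cube R n r x -> grad u x = 0.
Proof. by move=> ur xr; apply/rowP => i; rewrite !mxE (partial_vanish i ur). Qed.

Lemma mass_integrable n (p : R) (u : 'rV[R]_n -> R) : 0 < p -> C1c setT u ->
  (lebesgue_rV n).-integrable setT (EFin \o (fun x => `|u x| `^ p)).
Proof.
move=> p0 uc; have [r _ ur] := C1c_vanish uc; have [cu _ _] := uc.
apply: (@continuous_integrable _ _ _ r).
  exact: (continuous_compR (C1_continuous cu) (abs_powR_continuous p0)).
by move=> x /ur ->; rewrite normr0 powR0// gt_eqF.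
Qed.

Lemma dirichlet_integrable n (p : R) (u : 'rV[R]_n -> R) : 0 < p -> C1c setT u ->
  (lebesgue_rV n).-integrable setT (EFin \o (fun x => enorm (grad u x) `^ p)).
Proof.
move=> p0 uc; have [r _ ur] := C1c_vanish uc; have [cu _ _] := uc.
apply: (@continuous_integrable _ _ _ r).
  have -> : (fun x => enorm (grad u x) `^ p) = (fun x => `|enorm (grad u x)| `^ p).
    by apply/funext => x; rewrite ger0_norm// enorm_ge0.
  exact: (continuous_compR (continuous_enorm_grad cu) (abs_powR_continuous p0)).
by move=> x xr; rewrite (grad_vanish ur xr) enorm0 powR0// gt_eqF.
Qed.

Lemma massE n (p : R) (u : 'rV[R]_n -> R) : 0 < p -> C1c setT u ->
  (\int[lebesgue_rV n]_x (`|u x| `^ p)%:E = (mass p u)%:E)%E.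
Proof. by move=> p0 uc; rewrite fineK//; apply: integrable_fin_num => //; exact: mass_integrable. Qed.

Lemma dirichletE n (p : R) (u : 'rV[R]_n -> R) : 0 < p -> C1c setT u ->
  (\int[lebesgue_rV n]_x (enorm (grad u x) `^ p)%:E = (dirichlet p u)%:E)%E.
Proof. by move=> p0 uc; rewrite fineK//; apply: integrable_fin_num => //; exact: dirichlet_integrable. Qed.

Lemma dirichlet_ge0 n (p : R) (u : 'rV[R]_n -> R) : 0 <= dirichlet p u.
Proof. by apply: fine_ge0; apply: integral_ge0 => x _; rewrite lee_fin powR_ge0. Qed.

Lemma mass_gt0 n (p : R) (u : 'rV[R]_n -> R) x : 0 < p -> C1c setT u -> u x != 0 ->
  0 < mass p u.
Proof.
move=> p0 uc ux; rewrite -lte_fin -massE//.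
apply: (@integral_gt0 n (fun x => `|u x| `^ p) x).
- have [cu _ _] := uc.
  exact: (continuous_compR (C1_continuous cu) (abs_powR_continuous p0)).
- by move=> y; exact: powR_ge0.
- by rewrite powR_gt0// normr_gt0.
Qed.

Lemma rayleighE n (p : R) (W : set 'rV[R]_n) u x : 0 < p -> C1c W u -> u x != 0 ->
  rayleigh p W u = (dirichlet p u / mass p u)%:E.
Proof.
move=> p0 uc ux; have uT := C1cT uc; have [_ _ sW] := uc.
have mp := mass_gt0 p0 uT ux.
have offW y : y \notin W -> ~ supp u y.
  by move=> /negP; rewrite inE => Wy /sW.
have -> : rayleigh p W u = ((dirichlet p u)%:E / (mass p u)%:E)%E.
  rewrite -dirichletE// -massE//; congr (_ / _)%E; rewrite integral_mkcond;
    apply: eq_integral => y _; rewrite patchE; case: ifPn => // /offW yu.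
    by rewrite grad_off_supp// enorm0 powR0// gt_eqF.
  by rewrite supp_off// normr0 powR0// gt_eqF.
by rewrite inver gt_eqF.
Qed.

Lemma lambda_ge n (p c : R) (W : set 'rV[R]_n) : 0 < p ->
  (forall u, C1c W u -> (exists x, u x != 0) -> c * mass p u <= dirichlet p u) ->
  (c%:E <= lambda p W)%E.
Proof.
move=> p0 H; apply: le_ereal_inf_tmp => _ [u [uc [x ux]] <-].
rewrite (rayleighE p0 uc ux) lee_fin ler_pdivlMr; last exact: mass_gt0 (C1cT uc) ux.
by apply: H => //; exists x.
Qed.

Lemma lambda_le n (p : R) (W : set 'rV[R]_n) u x : 0 < p -> C1c W u -> u x != 0 ->
  (lambda p W <= (dirichlet p u / mass p u)%:E)%E.
Proof.
move=> p0 uc ux; rewrite -(rayleighE p0 uc ux); apply: ereal_inf_lbound.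
by exists u => //; split => //; exists x.
Qed.

Lemma lambda_mass_le n (p c : R) (W : set 'rV[R]_n) u : 0 < p -> (c%:E <= lambda p W)%E ->
  C1c W u -> c * mass p u <= dirichlet p u.
Proof.
move=> p0 cl uc.
have [[x ux]|nu] := pselect (exists x, u x != 0).
  have mp := mass_gt0 p0 (C1cT uc) ux.
  by rewrite -ler_pdivlMr// -lee_fin (le_trans cl)//; exact: lambda_le ux.
rewrite /mass (eq_integral (cst 0%E)) ?integral0 ?mulr0 ?dirichlet_ge0// => x _.
have -> : u x = 0 by apply/eqP; apply: contra_notT nu => ux; exists x.
by rewrite normr0 powR0// gt_eqF.
Qed.

Lemma lambda_ge0 n (p : R) (W : set 'rV[R]_n) : 0 < p -> (0 <= lambda p W)%E.
Proof. by move=> p0; apply: lambda_ge => // u _ _; rewrite mul0r dirichlet_ge0. Qed.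

End Energies.

(** * Monotonicity of the roots in the exponent *)

Section Monotonicity.
Context {R : realType}.

Lemma hoelder_powR n (f g : 'rV[R]_n -> R) (t : R) : 0 < t < 1 ->
  measurable_fun setT f -> measurable_fun setT g ->
  (forall x, 0 <= f x) -> (forall x, 0 <= g x) ->
  (\int[lebesgue_rV n]_x (f x `^ (1 - t) * g x `^ t)%:E <=
   (\int[lebesgue_rV n]_x (f x)%:E) `^ (1 - t) * (\int[lebesgue_rV n]_x (g x)%:E) `^ t)%E.
Proof.
move=> /andP[t0 t1] mf mg f0 g0.
have s0 : 0 < 1 - t by rewrite subr_gt0.
pose f1 x := f x `^ (1 - t); pose g1 x := g x `^ t.
have mf1 : measurable_fun setT f1.
  exact: (measurableT_comp (measurable_powR (1 - t)) mf).
have mg1 : measurable_fun setT g1.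
  exact: (measurableT_comp (measurable_powR t) mg).
have st : (1 - t)^-1^-1 + t^-1^-1 = 1 by rewrite !invrK subrK.
have si0 : 0 < (1 - t)^-1 by rewrite invr_gt0.
have ti0 : 0 < t^-1 by rewrite invr_gt0.
have := hoelder (lebesgue_rV n) mf1 mg1 si0 ti0 st.
rewrite Lnorm1 unlock /= !invrK.
rewrite [leLHS](_ : _ = \int[lebesgue_rV n]_x (f x `^ (1 - t) * g x `^ t)%:E)%E; last first.
  by apply: eq_integral => x _; rewrite /= ger0_norm// mulr_ge0 ?powR_ge0.
rewrite [X in (_ <= X `^ _ * _ -> _)%E](_ : _ = \int[lebesgue_rV n]_x (f x)%:E)%E; last first.
  apply: eq_integral => x _; rewrite /= ger0_norm ?powR_ge0// -powRrM.
  by rewrite mulfV ?gt_eqF// powRr1.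
rewrite [X in (_ <= _ * X `^ _ -> _)%E](_ : _ = \int[lebesgue_rV n]_x (g x)%:E)%E//.
apply: eq_integral => x _; rewrite /= ger0_norm ?powR_ge0// -powRrM.
by rewrite mulfV ?gt_eqF// powRr1.
Qed.

Lemma C1c_has_grad_comp n (W : set 'rV[R]_n) u (f df : R -> R) :
  (forall s, is_derive s (1 : R) f (df s)) -> continuous df -> f 0 = 0 ->
  C1c W u -> C1c W (fun x => f (u x)).
Proof.
move=> dfE cdf f0 [cu ku sW].
apply: (@C1cI _ _ W (supp u)) => //.
- exact: has_grad_C1 (has_grad_comp dfE cdf (C1_has_grad cu)).
- by move=> x /supp_off ->.
Qed.

(** Solving the inequality given by Hoelder for B: after a division by
    A^(1 - q/p), take q-th roots and then p-th powers. *)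
Lemma hoelder_algebra (p q c A B : R) : 0 < q -> q < p -> 0 <= c -> 0 < A -> 0 <= B ->
  c * A <= (p / q) `^ q * (A `^ (1 - q / p) * B `^ (q / p)) ->
  (q / p * c `^ q^-1) `^ p * A <= B.
Proof.
move=> q0 qp c0 A0 B0; have p0 : 0 < p by exact: lt_trans qp.
have t0 : 0 < q / p by exact: divr_gt0.
have r0 : 0 < p / q by exact: divr_gt0.
have tq : q / p / q = p^-1 by field; rewrite !gt_eqF.
have tr : (q / p)^-1 = p / q by rewrite invf_div.
move: t0 r0 tq tr; move: (q / p) (p / q) => t r t0 r0 tq tr H.
have {}H : c * A `^ t <= r `^ q * B `^ t.
  have At : 0 < A `^ (1 - t) by exact: powR_gt0.
  rewrite -(ler_pM2l At) mulrCA -powRD; last by rewrite subrK oner_eq0.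
  rewrite subrK (powRr1 (ltW A0)).
  by apply: (le_trans H); rewrite mulrCA.
have : (c * A `^ t) `^ q^-1 <= (r `^ q * B `^ t) `^ q^-1.
  by apply: ge0_ler_powR; rewrite ?nnegrE ?mulr_ge0 ?powR_ge0 ?invr_ge0 ?(ltW q0).
rewrite (powRM _ c0 (powR_ge0 _ _)) (powRM _ (powR_ge0 _ _) (powR_ge0 _ _)).
rewrite -!powRrM mulfV ?gt_eqF// (powRr1 (ltW r0)).
rewrite tq => {}H.
have : (t * c `^ q^-1 * A `^ p^-1) `^ p <= (B `^ p^-1) `^ p.
  apply: ge0_ler_powR; rewrite ?nnegrE ?mulr_ge0 ?powR_ge0 ?(ltW p0) ?(ltW t0)//.
  by rewrite -mulrA -ler_pdivlMl// tr.
rewrite powRM ?mulr_ge0 ?powR_ge0 ?(ltW t0)//.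
by rewrite -!powRrM mulVf ?gt_eqF// (powRr1 (ltW A0)) (powRr1 B0).
Qed.

(** The test function for the exponent q is |u|^(p/q); it has the same mass as u,
    and Hoelder bounds its energy by a product of powers of the mass and the energy
    of u. *)
Lemma lambda_monotone n (p q c : R) (W : set 'rV[R]_n) : 1 <= q -> q < p -> 0 <= c ->
  (c%:E <= lambda q W)%E -> (((q / p * c `^ q^-1) `^ p)%:E <= lambda p W)%E.
Proof.
move=> q1 qp c0 cq.
have q0 : 0 < q by exact: lt_le_trans q1.
have p0 : 0 < p by exact: lt_trans qp.
apply: lambda_ge => // u uc [x ux].
have uT := C1cT uc; have [cu _ _] := uc.
set r := p / q.
have r1 : 1 < r by rewrite ltr_pdivlMr// mul1r.
have r0 : 0 < r by exact: lt_trans r1.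
set t := q / p.
have t01 : 0 < t < 1 by rewrite divr_gt0//= ltr_pdivrMr// mul1r.
pose v x := `|u x| `^ r.
have cw : continuous (fun s => r * spow (r - 1) s).
  by move=> s; apply: cvgM; [exact: cvg_cst|apply: spow_continuous; rewrite subr_gt0].
have vg := has_grad_comp (fun s => is_derive_abs_powR s r1) cw (C1_has_grad cu).
have vc : C1c W v.
  by apply: (C1c_has_grad_comp (fun s => is_derive_abs_powR s r1) cw _ uc); rewrite normr0 powR0// gt_eqF.
have vT := C1cT vc.
have mv : mass q v = mass p u.
  congr fine; apply: eq_integral => y _; rewrite ger0_norm ?powR_ge0// -powRrM.
  by rewrite divfK// gt_eqF.
have gv y : enorm (grad v y) = r * `|u y| `^ (r - 1) * enorm (grad u y).
  have -> : grad v y = (r * spow (r - 1) (u y)) *: grad u y.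
    by apply/rowP => i; rewrite !mxE (has_grad_partial _ _ vg).
  rewrite enormZ normrM (gtr0_norm r0) /spow normrM normr_sg.
  rewrite (ger0_norm (powR_ge0 _ _)).
  have [->|uy] := eqVneq (u y) 0; last by rewrite mul1r.
  by rewrite normr0 mul0r powR0// gt_eqF// subr_gt0.
have A0 := mass_gt0 p0 uT ux.
have B0 := dirichlet_ge0 p u.
set A := mass p u in A0 mv *; set B := dirichlet p u in B0 *.
have H := lambda_mass_le q0 cq vc; rewrite mv in H.
have D : dirichlet q v <= r `^ q * (A `^ (1 - t) * B `^ t).
  rewrite -lee_fin -dirichletE//.
  rewrite [leLHS](_ : _ = \int[lebesgue_rV n]_y ((r `^ q)%:E *
      ((`|u y| `^ p) `^ (1 - t) * (enorm (grad u y) `^ p) `^ t)%:E))%E; last first.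
    apply: eq_integral => y _; rewrite -EFinM gv; congr EFin.
    rewrite powRM ?enorm_ge0//; last by rewrite mulr_ge0 ?powR_ge0// ltW.
    rewrite powRM ?powR_ge0 ?(ltW r0)// -!powRrM -mulrA.
    congr (_ * (_ `^ _ * _ `^ _)); first by rewrite /r /t; field; rewrite !gt_eqF.
    by rewrite /t mulrC divfK// gt_eqF.
  have mu1 : measurable_fun setT (fun y => `|u y| `^ p).
    apply: continuous_measurable_rV.
    exact: (continuous_compR (C1_continuous cu) (abs_powR_continuous p0)).
  have mg1 : measurable_fun setT (fun y => enorm (grad u y) `^ p).
    have -> : (fun x => enorm (grad u x) `^ p) = (fun x => `|enorm (grad u x)| `^ p).
      by apply/funext => z; rewrite ger0_norm// enorm_ge0.
    apply: continuous_measurable_rV.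
    exact: (continuous_compR (continuous_enorm_grad cu) (abs_powR_continuous p0)).
  rewrite ge0_integralZl_EFin ?powR_ge0//; last 2 first.
    by move=> y _; rewrite lee_fin mulr_ge0 ?powR_ge0.
    apply/measurable_EFinP; apply: measurable_funM.
      exact: (measurableT_comp (measurable_powR (1 - t)) mu1).
    exact: (measurableT_comp (measurable_powR t) mg1).
  rewrite EFinM lee_pmul2l ?lte_fin ?powR_gt0//.
  apply: (le_trans (hoelder_powR t01 mu1 mg1 _ _)).
  - by move=> y; exact: powR_ge0.
  - by move=> y; exact: powR_ge0.
  - by rewrite massE// dirichletE// !poweR_EFin -EFinM.
by apply: (hoelder_algebra q0 qp) => //; exact: le_trans H D.
Qed.

End Monotonicity.

(** * The Cheeger constant is at most lambda_1 *)

Section Coarea.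
Context {R : realType}.
Local Notation mu := (@lebesgue_measure R).

Lemma le_limn_einf (u v : (\bar R)^nat) : (forall k, u k <= v k)%E ->
  (limn_einf u <= limn_einf v)%E.
Proof.
move=> uv; rewrite !limn_einf_lim; apply: lee_lim.
- exact: is_cvg_einfs.
- exact: is_cvg_einfs.
- apply: nearW => k; apply: le_ereal_inf_tmp => _ [m km <-].
  by apply: (@le_trans _ _ (u m)) => //; apply: ereal_inf_lbound; exists m.
Qed.

Lemma limn_einf_cst (l : \bar R) : limn_einf (fun=> l) = l.
Proof.
have c : (fun _ : nat => l) @ \oo --> l by exact: cvg_cst.
rewrite is_cvg_limn_einfE; first exact/cvg_lim.
by apply/cvg_ex; exists l.
Qed.

(** The product form of the definition; it also covers sets of measure zero. *)
Lemma cheeger_le_perimeter n (W E : set 'rV[R]_n) (c : R) :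
  measurable E -> compact (closure E) -> closure E `<=` W -> (c%:E <= cheeger W)%E ->
  (c%:E * lebesgue_rV n E <= perimeter E)%E.
Proof.
move=> mE cE EW cW.
have P0 : (0 <= perimeter E)%E.
  apply: ereal_sup_ubound; exists (fun=> 0).
    split=> [i|x]; last by rewrite enorm0.
    apply: (@C1c_setT _ _ _ 0); last by move=> x _; rewrite mxE.
    apply: has_grad_C1; apply: has_grad_ext (has_grad_cst n 0) => //.
    by move=> x; rewrite mxE.
  rewrite (eq_integral (cst 0%E)) ?integral0// => x _ /=.
  rewrite /divergence big1// => i _.
  rewrite (_ : (fun y : 'rV[R]_n => _) = cst 0); last by apply/funext => y; rewrite mxE.
  by rewrite /partial derive_cst.
have [E0|E0] := leP (lebesgue_rV n E) 0%E.
  have -> : lebesgue_rV n E = 0%E by apply/eqP; rewrite eq_le E0 measure_ge0.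
  by rewrite mule0.
have Eoo : (lebesgue_rV n E < +oo)%E.
  have [r _ rE] := compact_sub_cube cE.
  by apply: (@lebesgue_rV_bounded _ _ _ r) => //; apply: subset_trans rE; exact: subset_closure.
have : (c%:E <= perimeter E / lebesgue_rV n E)%E.
  by apply: (le_trans cW); apply: ereal_inf_lbound; exists E.
move: E0 Eoo; case: (lebesgue_rV n E) => [m| |]//; rewrite lte_fin => m0 _.
by rewrite inver gt_eqF// lee_pdivlMr.
Qed.

Lemma C1c_partial_integrable n (u : 'rV[R]_n -> R) i : C1c setT u ->
  (lebesgue_rV n).-integrable setT (EFin \o partial i u).
Proof.
move=> uc; have [r _ ur] := C1c_vanish uc; have [cu _ _] := uc.
exact: continuous_integrable (cu i).2 (partial_vanish i ur).
Qed.

Lemma divergence_integrable n (phi : 'rV[R]_n -> 'rV[R]_n) :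
  (forall i, C1c setT (fun x => phi x ord0 i)) ->
  (lebesgue_rV n).-integrable setT (EFin \o divergence phi).
Proof.
move=> pc.
have -> : EFin \o divergence phi =
    (fun x => \sum_(i <- index_enum 'I_n) (partial i (fun y => phi y ord0 i) x)%:E)%E.
  by apply/funext => x; rewrite /= /divergence sumEFin.
by apply: integrable_sum => // i _; exact: (C1c_partial_integrable i (pc i)).
Qed.

Lemma integral_divergence0 n (phi : 'rV[R]_n -> 'rV[R]_n) :
  (forall i, C1c setT (fun x => phi x ord0 i)) ->
  (\int[lebesgue_rV n]_x (divergence phi x)%:E = 0)%E.
Proof.
move=> pc.
rewrite (_ : (fun x => _) =
    (fun x => \sum_(i <- index_enum 'I_n) (partial i (fun y => phi y ord0 i) x)%:E)%E); last first.
  by apply/funext => x; rewrite /divergence sumEFin.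
rewrite integral_sum//; last by move=> i; exact: (C1c_partial_integrable i (pc i)).
rewrite big1// => i _; have [r _ ur] := C1c_vanish (pc i); have [cu _ _] := pc i.
exact: integral_partial0 ur.
Qed.

Lemma C1c_mul n (W : set 'rV[R]_n) (u v : 'rV[R]_n -> R) : C1 u -> C1c W v ->
  C1c W (fun x => u x * v x).
Proof.
move=> cu [cv kv sW].
apply: (@C1cI _ _ W (supp v)) => //.
  exact: has_grad_C1 (has_gradM (C1_has_grad cu) (C1_has_grad cv)).
by move=> x /supp_off ->; rewrite mulr0.
Qed.

Lemma divergence_mul n (w : 'rV[R]_n -> R) g (phi : 'rV[R]_n -> 'rV[R]_n) x :
  has_grad w g -> (forall i, C1 (fun x => phi x ord0 i)) ->
  divergence (fun y => w y *: phi y) x = w x * divergence phi x + \sum_i phi x ord0 i * g i x.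
Proof.
move=> wg pc; rewrite /divergence mulr_sumr -big_split/=; apply: eq_bigr => i _.
have H := has_gradM wg (C1_has_grad (pc i)).
rewrite -(has_grad_partial i x H); congr (partial i _ x).
by apply/funext => y; rewrite mxE.
Qed.

(** Rises from 0 to 1 between t and t + 1/(k+1), and thus approximates the
    indicator of s > t. *)
Definition stepk (k : nat) (t s : R) : R := sstep (k.+1%:R * (s - t)).
Definition dstepk (k : nat) (t s : R) : R := k.+1%:R * dsstep (k.+1%:R * (s - t)).

Lemma is_derive_stepk k t s : is_derive s (1 : R) (stepk k t) (dstepk k t s).
Proof.
have d0 := is_deriveZ (k.+1%:R : R) (is_deriveB (is_derive_id s (1 : R)) (is_derive_cst t s (1 : R))).
have := @is_derive1_comp _ sstep _ s _ _ (is_derive_sstep (k.+1%:R * (s - t))) d0.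
by move/is_derive_eq; apply; rewrite subr0 /dstepk /GRing.scale/= mulr1 mulrC.
Qed.

Lemma continuous_dsstep_affine (a b : R) : continuous (fun s => dsstep (a * s + b)).
Proof.
move=> s; apply: (@cvg_comp _ _ _ (fun s => a * s + b) dsstep _ (nbhs (a * s + b))); last exact: continuous_dsstep.
by apply: cvgD; [apply: cvgM; [exact: cvg_cst|exact: cvg_id]|exact: cvg_cst].
Qed.

Lemma continuous_dstepk k t : continuous (dstepk k t).
Proof.
have -> : dstepk k t = (fun s => k.+1%:R * dsstep (k.+1%:R * s + (- (k.+1%:R * t)))).
  by apply/funext => s; rewrite /dstepk mulrBr.
by move=> s; apply: cvgM; [exact: cvg_cst|exact: continuous_dsstep_affine].
Qed.

Lemma dstepk_ge0 k t s : 0 <= dstepk k t s.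
Proof. by rewrite mulr_ge0// dsstep_ge0. Qed.

Lemma continuous_dstepk_level k s : continuous (fun t => dstepk k t s).
Proof.
have -> : (fun t => dstepk k t s) = (fun t => k.+1%:R * dsstep (- k.+1%:R * t + k.+1%:R * s)).
  by apply/funext => t; rewrite /dstepk; congr (_ * dsstep _); ring.
by move=> t; apply: cvgM; [exact: cvg_cst|exact: continuous_dsstep_affine].
Qed.

Lemma integral_dstepk k s : (\int[mu]_t (dstepk k t s)%:E = 1)%E.
Proof.
pose F t := - stepk k t s.
have FE : F = (fun t => - sstep (- k.+1%:R * t + k.+1%:R * s)).
  by apply/funext => t; rewrite /F /stepk; congr (- sstep _); ring.
have dF t : is_derive t (1 : R) F (dstepk k t s).
  rewrite FE.
  have d0 := is_deriveD (is_deriveZ (- k.+1%:R : R) (is_derive_id t (1 : R))) (is_derive_cst (k.+1%:R * s) t (1 : R)).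
  have := is_deriveN (@is_derive1_comp _ sstep _ t _ _ (is_derive_sstep (- k.+1%:R * t + k.+1%:R * s)) d0).
  move/is_derive_eq; apply; rewrite /dstepk /GRing.scale/= addr0 mulr1 mulrN opprK mulrC.
  by congr (_ * dsstep _); ring.
have k0 : (0 : R) < k.+1%:R by [].
have ki : (k.+1%:R : R) * k.+1%:R^-1 = 1 by rewrite mulfV.
rewrite (@integral_derive_vanish _ F _ (s - k.+1%:R^-1) s _ dF).
- rewrite /F /stepk subrr mulr0 sstep_le0// sstep_ge1 ?opprK; last first.
    by rewrite subKr ki.
  by rewrite oppr0 -EFinB sub0r opprK.
- by rewrite ltrBlDr ltrDl invr_gt0.
- exact: continuous_dstepk_level.
- move=> t; rewrite in_itv/= negb_and -!ltNge => ts.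
  rewrite /dstepk dsstep_out ?mulr0// in_itv/= negb_and -!ltNge.
  case/orP: ts => ts; apply/orP; [right|left].
    by rewrite -ltr_pdivrMl// mulr1 ltrBrDr addrC -ltrBrDr.
  by rewrite pmulr_rlt0// subr_lt0.
Qed.

(** For an admissible field phi, the integral of div phi over the superlevel set is
    the limit of the integrals of stepk (u) div phi. Integrating by parts turns them
    into integrals of - dstepk (u) (grad u . phi), and |phi| <= 1. *)
Lemma perimeter_superlevel n (u : 'rV[R]_n -> R) (t : R) : C1c setT u -> 0 < t ->
  (perimeter [set x | (t < u x)%R] <=
   limn_einf (fun k => \int[lebesgue_rV n]_x (dstepk k t (u x) * enorm (grad u x))%:E))%E.
Proof.
move=> uc t0; have [cu _ _] := uc; have [r _ ur] := C1c_vanish uc.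
have cuc := C1_continuous cu.
apply: ge_ereal_sup => _ [phi [pc p1] <-].
have [E mE] : exists E : set 'rV[R]_n, E = [set x | (t < u x)%R] by eexists.
have oE : measurable E.
  rewrite mE; apply: open_measurable_rV.
  by apply: (@open_comp _ _ u [set z | t < z]) => //; exact: open_gt.
pose b k := (\int[lebesgue_rV n]_x (stepk k t (u x) * divergence phi x)%:E)%E.
have wg k := has_grad_comp (is_derive_stepk k t) (@continuous_dstepk k t) (C1_has_grad cu).
have step0 k x : u x <= t -> stepk k t (u x) = 0.
  by move=> ux; rewrite /stepk sstep_le0// pmulr_rle0// subr_le0.
have wc k i : C1c setT (fun x => (stepk k t (u x) *: phi x) ord0 i).
  have -> : (fun x => (stepk k t (u x) *: phi x) ord0 i) = (fun x => stepk k t (u x) * phi x ord0 i).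
    by apply/funext => x; rewrite mxE.
  exact: C1c_mul (has_grad_C1 (wg k)) (pc i).
have mdiv : measurable_fun setT (divergence phi).
  by apply/measurable_EFinP; exact: measurable_int (divergence_integrable pc).
have mstep k : measurable_fun setT (fun x => stepk k t (u x)).
  by apply: continuous_measurable_rV; exact: has_grad_continuous (wg k).
have ab k : (b k <= \int[lebesgue_rV n]_x (dstepk k t (u x) * enorm (grad u x))%:E)%E.
  pose q x := - \sum_i phi x ord0 i * (dstepk k t (u x) * partial i u x).
  have qle x : q x <= dstepk k t (u x) * enorm (grad u x).
    have -> : q x = dstepk k t (u x) * (\sum_i (- phi x) ord0 i * grad u x ord0 i).
      rewrite /q mulr_sumr -sumrN; apply: eq_bigr => i _; rewrite !mxE; ring.
    apply: ler_wpM2l; first exact: dstepk_ge0.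
    apply: (le_trans (cauchy_schwarz _ _)); rewrite -[leRHS]mul1r ler_wpM2r ?enorm_ge0//.
    by rewrite -scaleN1r enormZ normrN1 mul1r.
  have si : (lebesgue_rV n).-integrable setT (fun x => (stepk k t (u x) * divergence phi x)%:E).
    apply: le_integrable (divergence_integrable pc) => //.
      by apply/measurable_EFinP; exact: measurable_funM.
    move=> x _ /=; rewrite lee_fin normrM ler_piMl// ger0_norm ?sstep_ge0//; exact: sstep_le1.
  have di := divergence_integrable (wc k).
  have E1 x : divergence (fun y => stepk k t (u y) *: phi y) x = stepk k t (u x) * divergence phi x - q x.
    rewrite (divergence_mul x (wg k)); last by move=> i; case: (pc i).
    by rewrite /q opprK.
  have qi : (lebesgue_rV n).-integrable setT (EFin \o q).
    have -> : EFin \o q = (fun x => (stepk k t (u x) * divergence phi x)%:E - (divergence (fun y => stepk k t (u y) *: phi y) x)%:E)%E.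
      by apply/funext => x; rewrite /= E1 -EFinB; congr EFin; ring.
    exact: integrableB.
  have -> : b k = (\int[lebesgue_rV n]_x (q x)%:E)%E.
    have := integral_divergence0 (wc k).
    under eq_integral do rewrite E1 EFinB.
    rewrite integralB//; move/eqP; rewrite sube_eq.
    - by rewrite add0e => /eqP.
    - exact: integrable_fin_num.
    - by rewrite fin_num_adde_defl// integrable_fin_num.
  apply: le_integral => //.
  - apply: (@continuous_integrable _ _ _ r).
      move=> x; apply: (@cvgM R 'rV[R]_n (nbhs x)).
        apply: (continuous_compR cuc); exact: continuous_dstepk.
      exact: continuous_enorm_grad.
    by move=> x xr; rewrite (grad_vanish ur xr) enorm0 mulr0.
  - by move=> x _; rewrite lee_fin.
rewrite (_ : (\int[_]_(x in _) _)%E = limn_einf b); first exact: le_limn_einf.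
have bc : (b k @[k --> \oo] --> \int[lebesgue_rV n]_(x in E) (divergence phi x)%:E)%E.
  rewrite (_ : (\int[lebesgue_rV n]_(x in E) _ = \int[lebesgue_rV n]_x (((x \in E)%:R * divergence phi x)%:E))%E); last first.
    rewrite integral_mkcond; apply: eq_integral => x _; rewrite patchE.
    by case: ifPn => _; rewrite ?mul1r ?mul0r.
  apply: (@dominated_cvg _ _ _ (lebesgue_rV n) setT measurableT
    (fun k x => (stepk k t (u x) * divergence phi x)%:E) _ (fun x => `|divergence phi x|%:E)).
  - by move=> k; apply/measurable_EFinP; exact: measurable_funM.
  - move=> x _; apply: cvg_EFin; first exact: nearW.
    apply: cvgM; last exact: cvg_cst.
    have [ux|ux] := ltP t (u x); last first.
      have -> : x \in E = false.
        by apply/negbTE/negP; rewrite inE mE/= ltNge ux.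
      apply: cvg_near_cst; apply: nearW => k; exact: step0.
    have -> : x \in E = true by apply/mem_set; rewrite mE.
    apply: cvg_near_cst.
    have ut : 0 < u x - t by rewrite subr_gt0.
    have [k0 _ kP] := near_infty_natSinv_lt (PosNum ut).
    exists k0 => // k /kP /= /ltW kut.
    by rewrite /stepk sstep_ge1// -ler_pdivrMl// mulr1.
  - by [].
  - exact: (integrable_norm (divergence_integrable pc)).
  - move=> k x _ /=; rewrite lee_fin normrM ler_piMl// ger0_norm ?sstep_ge0//; exact: sstep_le1.
rewrite -mE is_cvg_limn_einfE; last by apply/cvg_ex; eexists; exact: bc.
exact/esym/cvg_lim.
Qed.

Lemma measurable_snd_rV n (u : 'rV[R]_n -> R) : measurable_fun setT u ->
  measurable_fun setT (fun z : R * 'rV[R]_n => u z.2).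
Proof. by move=> mu_; exact: (measurableT_comp mu_ measurable_snd). Qed.

Definition pos_ind (t : R) : R := \1_(`]0, +oo[%classic) t.

Lemma pos_indE t : pos_ind t = (0 < t)%R%:R.
Proof. by rewrite /pos_ind indicE mem_setE in_itv/= andbT. Qed.

Lemma pos_ind_gt0 t : 0 < t -> pos_ind t = 1.
Proof. by move=> t0; rewrite pos_indE t0. Qed.

Lemma pos_ind_le0 t : t <= 0 -> pos_ind t = 0.
Proof. by move=> t0; rewrite pos_indE ltNge t0. Qed.

Lemma pos_ind_ge0 t : 0 <= pos_ind t.
Proof. by rewrite pos_indE. Qed.

Lemma measurable_pos_ind : measurable_fun setT pos_ind.
Proof. exact: measurable_indic. Qed.

(** The indicator of the points (t, x) such that 0 < t < u(x), whose two iterated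
    integrals give the layer-cake formula. *)
Definition subgraph n (u : 'rV[R]_n -> R) (z : R * 'rV[R]_n) : \bar R :=
  (pos_ind z.1 * pos_ind (u z.2 - z.1))%:E.

Lemma subgraph_ge0 n (u : 'rV[R]_n -> R) z : (0 <= subgraph u z)%E.
Proof. by rewrite lee_fin mulr_ge0// pos_ind_ge0. Qed.

Lemma measurable_subgraph n (u : 'rV[R]_n -> R) : measurable_fun setT u ->
  measurable_fun setT (subgraph u).
Proof.
move=> mu_; apply/measurable_EFinP.
apply: measurable_funM; first exact: (measurableT_comp measurable_pos_ind measurable_fst).
apply: (measurableT_comp measurable_pos_ind); apply: measurable_funB => //.
exact: (measurable_snd_rV mu_).
Qed.

Lemma integral_subgraph n (u : 'rV[R]_n -> R) t : measurable_fun setT u ->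
  (\int[lebesgue_rV n]_x subgraph u (t, x) =
   (pos_ind t)%:E * lebesgue_rV n [set x | (t < u x)%R])%E.
Proof.
move=> mu_; rewrite /subgraph /=; have [t0|t0] := leP t 0.
  by rewrite (pos_ind_le0 t0) mul0e integral0_eq// => x _; rewrite mul0r.
rewrite (pos_ind_gt0 t0).
have mE : measurable [set x | (t < u x)%R].
  have := mu_ measurableT `]t, +oo[%classic (measurable_itv _).
  rewrite setTI (_ : u @^-1` _ = [set x | (t < u x)%R])//.
  by apply/seteqP; split => x /=; rewrite in_itv/= andbT.
rewrite mul1e -[RHS]mul1e -integral_cst// [RHS]integral_mkcond.
apply: eq_integral => x _; rewrite patchE /=.
rewrite mul1r; case: ifPn => [|/negP]; rewrite inE/= => H.
  by rewrite pos_ind_gt0// subr_gt0.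
by rewrite pos_ind_le0// subr_le0 leNgt; apply/negP.
Qed.

Lemma measurable_superlevel n (u : 'rV[R]_n -> R) : measurable_fun setT u ->
  measurable_fun setT (fun t => (pos_ind t)%:E * lebesgue_rV n [set x | (t < u x)%R])%E.
Proof.
move=> mu_; rewrite (_ : (fun t => _) = (fun t => \int[lebesgue_rV n]_x subgraph u (t, x))%E).
  exact: (@measurable_fun_fubini_tonelli_F _ _ _ _ _ (@leb R n) _ (measurable_subgraph mu_) (subgraph_ge0 u)).
by apply/funext => t; rewrite integral_subgraph.
Qed.

Lemma integral_superlevel n (u : 'rV[R]_n -> R) : measurable_fun setT u ->
  (\int[mu]_t ((pos_ind t)%:E * lebesgue_rV n [set x | (t < u x)%R]) =
   \int[lebesgue_rV n]_x (Num.max 0 (u x))%:E)%E.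
Proof.
move=> mu_.
under eq_integral do rewrite -(integral_subgraph _ mu_).
rewrite (@fubini_tonelli _ _ _ _ _ mu (@leb R n) _ (measurable_subgraph mu_) (subgraph_ge0 u)).
apply: eq_integral => x _; rewrite /subgraph /=.
have [u0|u0] := leP (u x) 0.
  rewrite integral0_eq// => t _; have [t0|t0] := leP t 0.
    by rewrite (pos_ind_le0 t0) mul0r.
  by rewrite (@pos_ind_le0 (u x - t)) ?mulr0// subr_le0 (le_trans u0)// ltW.
rewrite (_ : (fun t => _) = (fun t => ((cst 1%E) \_ `]0, (u x)[) t)); last first.
  apply/funext => t; rewrite patchE mem_setE in_itv/= !pos_indE subr_gt0.
  by case: (0 < t)%R => /=; rewrite ?mul0r// mul1r; case: (t < u x)%R.
transitivity (mu `]0, (u x)[%classic).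
  by rewrite -integral_mkcond integral_cst// mul1e.
by rewrite lebesgue_measure_itv/= lte_fin u0 oppr0 adde0.
Qed.

(** The useful half of the coarea formula. The superlevel set of level t is a
    competitor for the Cheeger constant, and [perimeter_superlevel] bounds its
    perimeter by a lower limit. Integrating over t, Fatou takes the lower limit out,
    and Tonelli leaves the integral of [dstepk] over the levels, which is 1. *)
Lemma coarea_ineq_pos n (W : set 'rV[R]_n) u (c : R) : C1c W u -> 0 <= c ->
  (c%:E <= cheeger W)%E ->
  (c%:E * \int[lebesgue_rV n]_x (Num.max 0 (u x))%:E <=
   \int[lebesgue_rV n]_x (pos_ind (u x) * enorm (grad u x))%:E)%E.
Proof.
move=> uc c0 cW; have uT := C1cT uc; have [cu ku sW] := uc.
have cuc := C1_continuous cu; have mu_ := continuous_measurable_rV cuc.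
have ceg := continuous_enorm_grad cu; have meg := continuous_measurable_rV ceg.
pose F k (z : R * 'rV[R]_n) : \bar R :=
  (pos_ind z.1 * (dstepk k z.1 (u z.2) * enorm (grad u z.2)))%:E.
have F0 k z : (0 <= F k z)%E.
  by rewrite lee_fin mulr_ge0 ?pos_ind_ge0// mulr_ge0 ?dstepk_ge0 ?enorm_ge0.
have mF k : measurable_fun setT (F k).
  apply/measurable_EFinP; apply: measurable_funM.
    exact: (measurableT_comp measurable_pos_ind measurable_fst).
  apply: measurable_funM; last exact: (measurable_snd_rV meg).
  apply: measurable_funM => //.
  have mds : measurable_fun setT (@dsstep R) by exact: continuous_measurable_fun (@continuous_dsstep R).
  apply: (measurableT_comp mds); apply: measurable_funM => //.
  by apply: measurable_funB => //; exact: (measurable_snd_rV mu_).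
pose a k t := (\int[lebesgue_rV n]_x F k (t, x))%E.
have ma k : measurable_fun setT (a k).
  exact: (@measurable_fun_fubini_tonelli_F _ _ _ _ _ (@leb R n) (F k) (mF k) (F0 k)).
have a0 k t : (0 <= a k t)%E by exact: integral_ge0.
set G := (\int[lebesgue_rV n]_x (pos_ind (u x) * enorm (grad u x))%:E)%E.
have aG k : (\int[mu]_t a k t <= G)%E.
  rewrite (@fubini_tonelli _ _ _ _ _ mu (@leb R n) (F k) (mF k) (F0 k)).
  apply: ge0_le_integral => //.
  - by move=> x _; apply: integral_ge0.
  - exact: (@measurable_fun_fubini_tonelli_G _ _ _ _ _ mu (F k) (mF k) (F0 k)).
  - apply/measurable_EFinP; apply: measurable_funM => //.
    exact: (measurableT_comp measurable_pos_ind mu_).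
  - move=> x _; rewrite /F /=.
    have [u0|u0] := leP (u x) 0.
      rewrite (pos_ind_le0 u0) mul0r integral0_eq// => t _; have [t0|t0] := leP t 0.
        by rewrite (pos_ind_le0 t0) mul0r.
      rewrite /dstepk dsstep_out ?mulr0 ?mul0r ?mulr0// in_itv/= negb_and -!ltNge.
      by rewrite pmulr_rlt0// subr_lt0 (le_lt_trans u0).
    apply: (@le_trans _ _ (\int[mu]_t ((enorm (grad u x))%:E * (dstepk k t (u x))%:E))%E).
      apply: ge0_le_integral => //.
      + by move=> t _; rewrite lee_fin mulr_ge0 ?pos_ind_ge0// mulr_ge0 ?dstepk_ge0 ?enorm_ge0.
      + exact: (measurableT_comp (mF k) (pair2_measurable x)).
      + apply: measurable_funeM; apply/measurable_EFinP.
        exact: continuous_measurable_fun (@continuous_dstepk_level k (u x)).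
      + move=> t _; rewrite -EFinM lee_fin (mulrC (enorm _)) ler_piMl//.
          exact: (mulr_ge0 (dstepk_ge0 _ _ _) (enorm_ge0 _)).
        by rewrite pos_indE; case: (_ < _).
    rewrite ge0_integralZl_EFin ?enorm_ge0//.
    + by rewrite integral_dstepk mule1 (pos_ind_gt0 u0) mul1r.
    + by move=> t _; rewrite lee_fin dstepk_ge0.
    + apply/measurable_EFinP.
      exact: continuous_measurable_fun (@continuous_dstepk_level k (u x)).
rewrite -integral_superlevel//.
pose L t := limn_einf (fun k => a k t).
have mL : measurable_fun setT L.
  apply: (emeasurable_fun_cvg (fun k t => einfs (a ^~ t) k)) => [k|t _].
    exact: measurable_fun_einfs.
  rewrite /L limn_einf_lim; exact: is_cvg_einfs.
apply: (@le_trans _ _ (\int[mu]_t L t)%E); last first.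
  apply: (le_trans (fatou _ _ _ _)) => //.
  rewrite -(limn_einf_cst G); exact: le_limn_einf.
rewrite -ge0_integralZl_EFin//; last 2 first.
- by move=> t _; rewrite mule_ge0// lee_fin pos_ind_ge0.
- exact: measurable_superlevel.
apply: ge0_le_integral => //.
- by move=> t _; rewrite mule_ge0 ?lee_fin// mule_ge0// lee_fin pos_ind_ge0.
- by apply: measurable_funeM; exact: measurable_superlevel.
- move=> t _; rewrite muleCA; have [t0|t0] := leP t 0.
    rewrite (pos_ind_le0 t0) mul0e; apply: (@le_trans _ _ (limn_einf (fun=> 0%E : \bar R))); first by rewrite limn_einf_cst.
    by apply: le_limn_einf => k.
  rewrite (pos_ind_gt0 t0) mul1e.
  have Esub : closure [set x | (t < u x)%R] `<=` supp u.
    by apply: closure_subset => x /= tx; rewrite gt_eqF// (lt_trans t0).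
  apply: (@le_trans _ _ (perimeter [set x | (t < u x)%R])).
    apply: (cheeger_le_perimeter _ _ _ cW).
    + apply: open_measurable_rV.
      by apply: (@open_comp _ _ u [set z | t < z]) => //; exact: open_gt.
    + by apply: subclosed_compact Esub => //; exact: closed_closure.
    + exact: subset_trans sW.
  apply: (le_trans (perimeter_superlevel uT t0)); apply: le_limn_einf => k.
  rewrite le_eqVlt; apply/orP; left; apply/eqP; apply: eq_integral => x _.
  by rewrite /F/= (pos_ind_gt0 t0) mul1r.
Qed.

(** The positive and negative parts of u are never both nonzero, so that the coarea
    inequalities for u and - u add up. *)
Lemma cheeger_le_lambda1 n (W : set 'rV[R]_n) : (cheeger W <= lambda 1 W)%E.
Proof.
have H (c : R) : 0 <= c -> (c%:E <= cheeger W)%E -> (c%:E <= lambda 1 W)%E.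
  move=> c0 cW; apply: lambda_ge => // u uc _.
  have uT := C1cT uc; have [cu _ _] := uc.
  have cuc := C1_continuous cu; have mu_ := continuous_measurable_rV cuc.
  have nuc : C1c W (fun x => - u x).
    have := @C1c_has_grad_comp R n W u (fun s => - s) (fun _ => -1) _ _ _ uc; apply.
    - exact: cst_continuous.
    - by rewrite oppr0.
  have gN x : enorm (grad (fun x => - u x) x) = enorm (grad u x).
    have g := has_gradZ (-1) (C1_has_grad cu).
    have -> : grad (fun x => - u x) x = -1 *: grad u x.
      apply/rowP => i; rewrite !mxE -(has_grad_partial i x g).
      by congr (partial i _ x); apply/funext => y; rewrite mulN1r.
    by rewrite enormZ normrN1 mul1r.
  have mg : measurable_fun setT (fun x => enorm (grad u x)).
    exact: continuous_measurable_rV (continuous_enorm_grad cu).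
  have Hp := coarea_ineq_pos uc c0 cW.
  have Hn := coarea_ineq_pos nuc c0 cW.
  have mmax : measurable_fun setT (fun s : R => Num.max 0 s).
    exact: measurable_maxr.
  have mN : measurable_fun setT (fun x => - u x) by exact: measurableT_comp.
  have max0 (s : R) : 0 <= Num.max 0 s by rewrite le_max lexx.
  rewrite -lee_fin EFinM -massE// -dirichletE//.
  rewrite [X in (_ * X <= _)%E](_ : _ = \int[lebesgue_rV n]_x (Num.max 0 (u x))%:E +
     \int[lebesgue_rV n]_x (Num.max 0 (- u x))%:E)%E; last first.
    rewrite -ge0_integralD//.
    - apply: eq_integral => x _; rewrite powRr1// -EFinD; congr EFin.
      have [u0|u0] := leP 0 (u x); first by rewrite ger0_norm// max_l ?addr0// oppr_le0.
      by rewrite ltr0_norm// max_r ?add0r// oppr_ge0 ltW.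
    - by move=> x _; rewrite lee_fin.
    - by apply/measurable_EFinP; exact: (measurableT_comp mmax mu_).
    - by move=> x _; rewrite lee_fin.
    - by apply/measurable_EFinP; exact: (measurableT_comp mmax mN).
  rewrite ge0_muleDr ?integral_ge0//; last 2 first.
  - by move=> x _; rewrite lee_fin.
  - by move=> x _; rewrite lee_fin.
  apply: (le_trans (leeD Hp Hn)).
  have mP : measurable_fun setT (fun x => (pos_ind (u x) * enorm (grad u x))%:E).
    apply/measurable_EFinP; apply: measurable_funM => //.
    exact: (measurableT_comp measurable_pos_ind mu_).
  have mNn : measurable_fun setT (fun x => (pos_ind (- u x) * enorm (grad (fun x => - u x) x))%:E).
    apply/measurable_EFinP; apply: measurable_funM => //.
      exact: (measurableT_comp measurable_pos_ind mN).
    by under eq_fun do rewrite gN.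
  rewrite -ge0_integralD//; last 2 first.
  - by move=> x _; rewrite lee_fin mulr_ge0 ?pos_ind_ge0 ?enorm_ge0.
  - by move=> x _; rewrite lee_fin mulr_ge0 ?pos_ind_ge0 ?enorm_ge0.
  apply: ge0_le_integral => //.
  - by move=> x _; rewrite adde_ge0// lee_fin mulr_ge0 ?pos_ind_ge0 ?enorm_ge0.
  - exact: emeasurable_funD.
  - by apply/measurable_EFinP; under eq_fun do rewrite powRr1 ?enorm_ge0//.
  - move=> x _; rewrite gN -EFinD lee_fin -mulrDl powRr1 ?enorm_ge0// ler_piMl ?enorm_ge0//.
    rewrite !pos_indE oppr_gt0; case: (ltP (u x) 0) => u0; last by rewrite addr0; case: (_ < _).
    by rewrite ltNge (ltW u0) add0r.
have l0 : (0 <= lambda 1 W)%E by exact: lambda_ge0.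
have [h0|h0] := leP (cheeger W) 0%E; first exact: le_trans l0.
move: H h0; case: (cheeger W) => [c| |]// H; last first.
  move=> _; rewrite leye_eq; apply/eqP/eq_infty => c.
  apply: (@le_trans _ _ (Num.max 0 c)%:E); first by rewrite lee_fin le_max lexx orbT.
  by apply: H; rewrite ?le_max ?lexx// leey.
by rewrite lte_fin => /ltW c0; exact: H.
Qed.

End Coarea.

(** * Convolution *)

Section Mollification.
Context {R : realType}.

(** A radial function of class C^(k-1) supported in the ball of radius rho. Its
    partial derivatives are again bumps times coordinates, which keeps both
    regularity and integrals explicit. *)
Definition bump n (k : nat) (rho : R) (x : 'rV[R]_n) : R :=
  posx k (rho ^+ 2 - sqnorm x).

Lemma bump_ge0 n k rho (x : 'rV[R]_n) : 0 <= bump k rho x.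
Proof. exact: posx_ge0. Qed.

Lemma bump_off n k rho (x : 'rV[R]_n) : rho ^+ 2 <= sqnorm x -> bump k.+1 rho x = 0.
Proof. by move=> xr; rewrite /bump posx_neg// subr_le0. Qed.

Lemma has_grad_bump n k (rho : R) : has_grad (@bump n k.+2 rho)
  (fun i x => - (2 * k.+2%:R * x ord0 i * bump k.+1 rho x)).
Proof.
have df (s : R) : is_derive s (1 : R) (fun s => posx k.+2 (rho ^+ 2 - s))
    (- (k.+2%:R * posx k.+1 (rho ^+ 2 - s))).
  have d0 := is_deriveB (is_derive_cst (rho ^+ 2) s (1 : R)) (is_derive_id s (1 : R)).
  have := @is_derive1_comp _ (posx k.+2) _ s _ _ (is_derive_posx k (rho ^+ 2 - s)) d0.
  by move/is_derive_eq; apply; rewrite sub0r mulrN1.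
have cf : continuous (fun s : R => - (k.+2%:R * posx k.+1 (rho ^+ 2 - s))).
  move=> s; apply: cvgN; apply: cvgM; first exact: cvg_cst.
  apply: (@cvg_comp _ _ _ (fun s => rho ^+ 2 - s) (posx k.+1) _ (nbhs (rho ^+ 2 - s))).
    by apply: cvgB; [exact: cvg_cst|exact: cvg_id].
  exact: continuous_posx.
apply: has_grad_ext (has_grad_comp df cf (has_grad_sqnorm n)) => // i x.
by rewrite /= /bump; ring.
Qed.

Lemma bump_vanish n k (rho : R) : 0 <= rho -> vanish_off_cube rho (@bump n k.+1 rho).
Proof.
move=> r0 x xr; apply: bump_off.
have [i xi] : exists i, rho < `|x ord0 i|.
  apply: contrapT => H; apply: xr => i; rewrite in_itv/= -ler_norml leNgt.
  by apply/negP => xi; apply: H; exists i.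
rewrite -sqr_enorm ler_sqr ?nnegrE ?enorm_ge0//.
by apply: (le_trans (ltW xi)); exact: ler_coord_enorm.
Qed.

Lemma bump_gt0 n k rho (x : 'rV[R]_n) : sqnorm x < rho ^+ 2 -> 0 < bump k rho x.
Proof. by move=> xr; rewrite /bump posx_pos ?exprn_gt0 ?subr_gt0// subr_ge0 ltW. Qed.

Lemma sqnormN n (x : 'rV[R]_n) : sqnorm (- x) = sqnorm x.
Proof. by apply: eq_bigr => i _; rewrite mxE sqrrN. Qed.

Lemma bumpN n k rho (x : 'rV[R]_n) : bump k rho (- x) = bump k rho x.
Proof. by rewrite /bump sqnormN. Qed.

Lemma sqnorm0 n : sqnorm (0 : 'rV[R]_n) = 0.
Proof. by rewrite /sqnorm big1// => i _; rewrite mxE expr0n. Qed.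

Definition conv n (K f : 'rV[R]_n -> R) (x : 'rV[R]_n) : R :=
  (\int[lebesgue_rV n]_y (K (x - y) * f y))%R.

Lemma measurable_sub_prod n :
  measurable_fun setT (fun z : 'rV[R]_n * 'rV[R]_n => z.1 - z.2).
Proof.
apply: measurable_fun_rVP => i.
rewrite (_ : (fun z => _) = (fun z : 'rV[R]_n * 'rV[R]_n => z.1 ord0 i - z.2 ord0 i)).
  by apply: measurable_funB; [exact: (measurableT_comp (measurable_coord i) measurable_fst)|exact: (measurableT_comp (measurable_coord i) measurable_snd)].
by apply/funext => z; rewrite !mxE.
Qed.

Lemma measurable_subr n (x : 'rV[R]_n) : measurable_fun setT (fun y : 'rV[R]_n => x - y).
Proof. exact: (measurableT_comp (@measurable_sub_prod n) (pair1_measurable x)). Qed.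

Lemma conv_integrable n (K f : 'rV[R]_n -> R) (M N r : R) x :
  measurable_fun setT K -> (forall z, `|K z| <= N) ->
  measurable_fun setT f -> (forall y, `|f y| <= M) -> vanish_off_cube r f ->
  (lebesgue_rV n).-integrable setT (EFin \o (fun y => K (x - y) * f y)).
Proof.
move=> mK KN mf fM fr; apply: (@bounded_integrable _ _ _ r (N * M)).
- apply: measurable_funM => //; exact: (measurableT_comp mK (@measurable_subr _ x)).
- by move=> y /fr ->; rewrite mulr0.
- by move=> y; rewrite normrM ler_pM.
Qed.

Lemma convE n (K f : 'rV[R]_n -> R) (M N r : R) x :
  measurable_fun setT K -> (forall z, `|K z| <= N) ->
  measurable_fun setT f -> (forall y, `|f y| <= M) -> vanish_off_cube r f ->
  ((conv K f x)%:E = \int[lebesgue_rV n]_y (K (x - y) * f y)%:E)%E.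
Proof.
move=> mK KN mf fM fr; rewrite /conv /Rintegral fineK//.
by apply: integrable_fin_num => //; exact: (conv_integrable x mK KN mf fM fr).
Qed.

(** A C^1 kernel of compact support is Lipschitz, hence so is the convolution. *)
Lemma continuous_conv n (K f : 'rV[R]_n -> R) (M r rho : R) :
  C1 K -> vanish_off_cube rho K ->
  measurable_fun setT f -> (forall y, `|f y| <= M) -> vanish_off_cube r f ->
  continuous (conv K f).
Proof.
move=> cK Krho mf fM fr.
have cKc := C1_continuous cK; have mK := continuous_measurable_rV cKc.
have [N N0 KN] := continuous_bounded cKc Krho.
have [D D0 DP] : exists2 D : R, 0 <= D & forall i x, `|partial i K x| <= D.
  have Di i : exists D : R, 0 <= D /\ forall x, `|partial i K x| <= D.
    have [D D0 DP] := continuous_bounded (cK i).2 (partial_vanish i Krho).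
    by exists D.
  have [Ds DsP] := choice Di.
  exists (\sum_i Ds i); first by apply: sumr_ge0 => i _; have [] := DsP i.
  move=> i x; have [_ /(_ x)/le_trans] := DsP i; apply.
  by rewrite (bigD1 i)//= lerDl; apply: sumr_ge0 => j _; have [] := DsP j.
have lip x y : `|K x - K y| <= D * (n%:R * `|x - y|).
  have xb : ball x (`|x - y| + 1) x by apply: ballxx; rewrite ltr_wpDl.
  have yb : ball x (`|x - y| + 1) y by rewrite -ball_normE /ball_/= ltrDl.
  apply: (le_trans (C1_lip cK (fun i z _ => DP i z) yb xb)).
  apply: ler_wpM2l => //; apply: (@le_trans _ _ (\sum_(i < n) `|x - y|)); last first.
    by rewrite sumr_const card_ord mulr_natl.
  apply: ler_sum => i _; rewrite [leRHS]/Num.Def.normr/= mx_normrE.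
  by apply/bigmax_geP; right; exists (ord0, i) => //=; rewrite !mxE.
pose A := fine (\int[lebesgue_rV n]_y `|f y|%:E)%E.
have fi : (lebesgue_rV n).-integrable setT (EFin \o f) by exact: bounded_integrable mf fr fM.
have A0 : 0 <= A by apply: fine_ge0; apply: integral_ge0 => y _; rewrite lee_fin.
have AE : (A%:E = \int[lebesgue_rV n]_y `|f y|%:E)%E.
  by rewrite /A fineK//; apply: integrable_fin_num => //; exact: integrable_norm fi.
have key x y : `|conv K f x - conv K f y| <= D * (n%:R * `|x - y|) * A.
  rewrite /conv -RintegralB//; last 2 first.
  - exact: (conv_integrable x mK KN mf fM fr).
  - exact: (conv_integrable y mK KN mf fM fr).
  have di : (lebesgue_rV n).-integrable setT (EFin \o (fun z => K (x - z) * f z - K (y - z) * f z)).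
    have := integrableB measurableT (conv_integrable x mK KN mf fM fr) (conv_integrable y mK KN mf fM fr).
    by apply: eq_integrable => // z _; rewrite /= EFinB.
  apply: (le_trans (le_normr_Rintegral measurableT di)).
  rewrite -lee_fin /Rintegral fineK; last first.
    by apply: integrable_fin_num => //; exact: integrable_norm di.
  rewrite EFinM AE -ge0_integralZl_EFin//; last first.
  - by rewrite mulr_ge0// mulr_ge0.
  - by apply/measurable_EFinP; exact: measurableT_comp.
  apply: ge0_le_integral => //.
  - by case/integrableP: (integrable_norm di).
  - by apply: measurable_funeM; apply/measurable_EFinP; exact: measurableT_comp.
  - move=> z _; rewrite -EFinM lee_fin -mulrBl normrM ler_wpM2r//.
    by apply: (le_trans (lip _ _)); rewrite opprB addrA subrK.
suff H (x : 'rV[R]_n) : conv K f y @[y --> x] --> conv K f x by exact: H.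
apply/(@cvgrPdist_le _ _ _ _ (nbhs_filter (x : 'rV[R]_n))) => e e0.
have C0 : 0 < D * n%:R * A + 1 by rewrite ltr_wpDl// !mulr_ge0.
have d0 : 0 < e / (D * n%:R * A + 1) by exact: divr_gt0.
apply/nbhs_ballP; exists (e / (D * n%:R * A + 1)) => //= y.
rewrite -ball_normE /ball_/= => /ltW xy; apply: (le_trans (key x y)).
rewrite (_ : _ * A = (D * n%:R * A) * `|x - y|); last by ring.
apply: (@le_trans _ _ ((D * n%:R * A + 1) * `|x - y|)).
  by rewrite ler_wpM2r// lerDl.
by rewrite mulrC -ler_pdivlMr.
Qed.

(** Differentiation under the integral sign, dominated by the bound of the
    derivative of the kernel times |f|. *)
Lemma is_derive_conv n (K f : 'rV[R]_n -> R) (M r rho : R) i x :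
  C1 K -> vanish_off_cube rho K ->
  measurable_fun setT f -> (forall y, `|f y| <= M) -> vanish_off_cube r f ->
  is_derive x (delta_mx ord0 i) (conv K f) (conv (partial i K) f x).
Proof.
move=> cK Krho mf fM fr.
have cKc := C1_continuous cK; have mK := continuous_measurable_rV cKc.
have [N N0 KN] := continuous_bounded cKc Krho.
have [D D0 DP] := continuous_bounded (cK i).2 (partial_vanish i Krho).
apply/is_derive_line.
pose g (t : R) (y : 'rV[R]_n) : R := K (t *: delta_mx ord0 i + x - y) * f y.
have dg t y : is_derive t (1 : R) (g^~ y) (partial i K (t *: delta_mx ord0 i + x - y) * f y).
  have := C1_is_derive i (t *: delta_mx ord0 i + x - y) cK.
  move=> /is_derive_line H.
  have H2 : is_derive t (1 : R) (fun s => K (s *: delta_mx ord0 i + x - y)) (partial i K (t *: delta_mx ord0 i + x - y)).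
    have -> : (fun s => K (s *: delta_mx ord0 i + x - y)) =
        (fun s => (fun t0 : R => K (t0 *: delta_mx ord0 i + (t *: delta_mx ord0 i + x - y))) (s - t)).
      apply/funext => s; congr K; rewrite scalerBl !addrA; congr (_ + _ - _).
      by rewrite subrK.
    rewrite -(subrr t) in H.
    exact: (is_derive_shift H).
  have := is_deriveM H2 (is_derive_cst (f y) t (1 : R)).
  by move/is_derive_eq; apply; rewrite scaler0 add0r /GRing.scale/= mulrC.
have d1 t y : partial1of2 g t y = partial i K (t *: delta_mx ord0 i + x - y) * f y.
  by rewrite partial1of2E; have [_ ->] := dg t y.
have I0 : (`](-1)%R, 1%R[%classic : set R) 0 by rewrite /= in_itv/= ltrN10 ltr01.
have intg t : (`](-1)%R, 1%R[%classic : set R) t -> (lebesgue_rV n).-integrable setT (EFin \o g t).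
  by move=> _; exact: (conv_integrable (t *: delta_mx ord0 i + x) mK KN mf fM fr).
have derg t y : (`](-1)%R, 1%R[%classic : set R) t -> [set: 'rV[R]_n] y -> derivable (g^~ y) t 1.
  by move=> _ _; have [] := dg t y.
have G0 y : 0 <= D * `|f y| by exact: mulr_ge0.
have iG : (lebesgue_rV n).-integrable setT (EFin \o (fun y => D * `|f y|)).
  apply: (@bounded_integrable _ _ _ r (D * M)).
  - by apply: measurable_funM => //; exact: measurableT_comp.
  - by move=> y /fr ->; rewrite normr0 mulr0.
  - by move=> y; rewrite ger0_norm// ler_wpM2l.
have Gub t y : (`](-1)%R, 1%R[%classic : set R) t -> [set: 'rV[R]_n] y -> `|partial1of2 g t y| <= D * `|f y|.
  by move=> _ _; rewrite d1 normrM ler_wpM2r.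
have der := @derivable_under_integral _ _ _ (lebesgue_rV n) _ _ measurableT _ _ _ I0 intg derg _ G0 iG Gub.
have val := @differentiation_under_integral _ _ _ (lebesgue_rV n) _ _ measurableT _ _ _ I0 intg derg _ G0 iG Gub.
split; first exact: der.
rewrite -derive1E; apply: (eq_trans val).
by rewrite /conv; apply: eq_Rintegral => y _; rewrite d1 scale0r add0r.
Qed.

Lemma partial_bumpN n k rho i (x : 'rV[R]_n) :
  partial i (bump k.+2 rho) (- x) = - partial i (bump k.+2 rho) x.
Proof.
rewrite !(has_grad_partial _ _ (has_grad_bump n k rho)) bumpN mxE; ring.
Qed.

(** Fubini. The sign e stands for the parity of the kernel: the mollifier is even
    and its partial derivatives are odd. *)
Lemma conv_adjoint n (K f h : 'rV[R]_n -> R) (N M L r s e : R) :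
  measurable_fun setT K -> (forall z, `|K z| <= N) -> (forall z, K (- z) = e * K z) ->
  measurable_fun setT f -> (forall y, `|f y| <= M) -> vanish_off_cube r f ->
  measurable_fun setT h -> (forall y, `|h y| <= L) -> vanish_off_cube s h ->
  (\int[lebesgue_rV n]_x (conv K f x * h x)%:E =
   \int[lebesgue_rV n]_y (e * conv K h y * f y)%:E)%E.
Proof.
move=> mK KN Ke mf fM fr mh hL hs.
pose F (z : 'rV[R]_n * 'rV[R]_n) : \bar R := (K (z.1 - z.2) * f z.2 * h z.1)%:E.
have mF : measurable_fun setT F.
  apply/measurable_EFinP; apply: measurable_funM; last exact: (measurableT_comp mh measurable_fst).
  apply: measurable_funM; last exact: (measurableT_comp mf measurable_snd).
  exact: (measurableT_comp mK (@measurable_sub_prod n)).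
have fi : (lebesgue_rV n).-integrable setT (EFin \o f) by exact: bounded_integrable mf fr fM.
have hi : (lebesgue_rV n).-integrable setT (EFin \o h) by exact: bounded_integrable mh hs hL.
have N0 : 0 <= N by exact: le_trans (KN 0).
have iF : (@leb R n \x @leb R n)%E.-integrable setT F.
  apply/integrable12ltyP => //.
  pose A := fine (\int[lebesgue_rV n]_y `|f y|%:E)%E.
  have A0 : 0 <= A by apply: fine_ge0; apply: integral_ge0 => y _; rewrite lee_fin.
  have AE : (A%:E = \int[lebesgue_rV n]_y `|f y|%:E)%E.
    by rewrite /A fineK//; apply: integrable_fin_num => //; exact: integrable_norm fi.
  apply: (@le_lt_trans _ _ (\int[lebesgue_rV n]_x ((N * A)%:E * `|h x|%:E))%E); last first.
    rewrite ge0_integralZl_EFin ?mulr_ge0//; last by apply/measurable_EFinP; exact: measurableT_comp.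
    apply: lte_mul_pinfty; rewrite ?lee_fin ?mulr_ge0//.
    by case/integrableP: hi.
  apply: ge0_le_integral => //.
  - by move=> x _; exact: integral_ge0.
  - apply: (@measurable_fun_fubini_tonelli_F _ _ _ _ _ (@leb R n) (fun z => `|F z|)%E) => //.
    exact: measurableT_comp.
  - by apply: measurable_funeM; apply/measurable_EFinP; exact: measurableT_comp.
  - move=> x _.
    have -> : ((N * A)%:E * `|h x|%:E = (N * `|h x|)%:E * A%:E)%E.
      by rewrite -!EFinM; congr EFin; ring.
    rewrite AE -ge0_integralZl_EFin ?mulr_ge0//; last first.
      by apply/measurable_EFinP; exact: measurableT_comp.
    apply: ge0_le_integral => //.
    + by apply: measurableT_comp => //; exact: (measurableT_comp mF (pair1_measurable x)).
    + by apply: measurable_funeM; apply/measurable_EFinP; exact: measurableT_comp.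
    + by move=> y _; rewrite /F/= -EFinM lee_fin !normrM mulrAC ler_wpM2r// ler_wpM2r.
transitivity (\int[@leb R n]_x \int[@leb R n]_y F (x, y))%E.
  apply: eq_integral => x _; rewrite EFinM (convE x mK KN mf fM fr) -integralZr//.
  exact: (conv_integrable x mK KN mf fM fr).
rewrite (Fubini iF); apply: eq_integral => y _.
have -> : e * conv K h y * f y = conv K h y * (e * f y) by ring.
rewrite EFinM (convE y mK KN mh hL hs) -integralZr//; last exact: (conv_integrable y mK KN mh hL hs).
apply: eq_integral => x _; rewrite /F/= -EFinM; congr EFin.
rewrite -opprB Ke; ring.
Qed.

End Mollification.

(** * The Cheeger constant is at least lambda_1 *)

Section Cheeger_equality.
Context {R : realType}.

Lemma compact_ball_sub n (K W : set 'rV[R]_n) : compact K -> open W -> K `<=` W ->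
  exists2 rho : R, 0 < rho & forall x, K x -> ball x rho `<=` W.
Proof.
move=> /compact_near_coveringP cK oW KW.
have : \forall r \near (0 : R)^'+, K `<=` (fun x => ball x r `<=` W).
  apply: cK => x Kx; have /nbhs_ballP[d /= d0 dW] : nbhs x W by apply: open_nbhs_nbhs; split => //; exact: KW.
  exists (ball x (d / 2), [set r : R | r < d / 2]) => /=.
    split; first by apply: nbhsx_ballx; rewrite divr_gt0.
    by apply: nbhs_right_lt; rewrite divr_gt0.
  move=> [y r] /= [xy rd] z yz; apply: dW.
  apply: (@le_ball _ _ _ (d / 2 + r)); first by rewrite [leRHS](splitr d) lerD2l ltW.
  exact: ball_triangle xy yz.
move=> H; have : \forall r \near (0 : R)^'+, 0 < r /\ (K `<=` (fun x => ball x r `<=` W)).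
  near=> r; split; [near: r; exact: nbhs_right_gt|near: r; exact: H].
move=> /filter_ex[r [r0 rW]]; exists r => // x Kx; exact: rW.
Unshelve. all: by end_near. Qed.

Definition set_add n (A B : set 'rV[R]_n) : set 'rV[R]_n := [set z | exists2 x, A x & exists2 y, B y & z = x + y].

Lemma compact_set_add n (A B : set 'rV[R]_n) : compact A -> compact B -> compact (set_add A B).
Proof.
move=> cA cB.
have -> : set_add A B = (fun z : 'rV[R]_n * 'rV[R]_n => z.1 + z.2) @` (A `*` B).
  apply/seteqP; split => [z [x Ax [y By ->]]|z [[x y] /= [Ax By] <-]].
    by exists (x, y).
  by exists x => //; exists y.
apply: continuous_compact; last exact: compact_setX.
apply: continuous_subspaceT => z; exact: add_continuous.
Qed.

Lemma integral_kernel n (K : 'rV[R]_n -> R) y : measurable_fun setT K -> (forall z, 0 <= K z) ->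
  (\int[lebesgue_rV n]_x (K (x - y))%:E = \int[lebesgue_rV n]_x (K x)%:E)%E.
Proof.
move=> mK K0; apply: (@ge0_integral_shift_rV R n (- y) (fun x => (K x)%:E)).
- exact/measurable_EFinP.
- by move=> x; rewrite lee_fin.
Qed.

Definition mollifier n (rho : R) (x : 'rV[R]_n) : R :=
  (fine (\int[lebesgue_rV n]_y (bump 3 rho y)%:E)%E)^-1 * bump 3 rho x.

Section mollifier.
Variables (n : nat) (rho : R).
Hypothesis rho0 : 0 < rho.

Let I : R := fine (\int[lebesgue_rV n]_y (bump 3 rho y)%:E)%E.

Let bint : (lebesgue_rV n).-integrable setT (EFin \o @bump R n 3 rho).
Proof.
apply: (@continuous_integrable _ _ _ rho).
  exact: has_grad_continuous (has_grad_bump n 1 rho).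
by apply: bump_vanish; exact: ltW.
Qed.

Let IE : (I%:E = \int[lebesgue_rV n]_y (bump 3 rho y)%:E)%E.
Proof. by rewrite /I fineK//; exact: (integrable_fin_num measurableT bint). Qed.

Let I0 : 0 < I.
Proof.
rewrite -lte_fin IE; apply: (@integral_gt0 _ _ _ 0).
- exact: has_grad_continuous (has_grad_bump n 1 rho).
- exact: bump_ge0.
- by apply: bump_gt0; rewrite sqnorm0 exprn_gt0.
Qed.

Lemma mollifier_ge0 x : 0 <= @mollifier n rho x.
Proof. by rewrite mulr_ge0 ?bump_ge0// invr_ge0 ltW. Qed.

Lemma has_grad_mollifier : has_grad (@mollifier n rho)
  (fun i x => I^-1 * partial i (@bump R n 3 rho) x).
Proof.
by have := has_gradZ I^-1 (C1_has_grad (has_grad_C1 (has_grad_bump n 1 rho))).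
Qed.

Lemma mollifier_vanish : vanish_off_cube rho (@mollifier n rho).
Proof. by move=> x xr; rewrite /mollifier bump_vanish ?mulr0// ltW. Qed.

Lemma mollifierN x : @mollifier n rho (- x) = mollifier rho x.
Proof. by rewrite /mollifier bumpN. Qed.

Lemma C1_partial_bump i : C1 (partial i (@bump R n 3 rho)).
Proof.
have -> : partial i (@bump R n 3 rho) = fun x => (-6) * (x ord0 i * bump 2 rho x).
  apply/funext => x; rewrite (has_grad_partial _ _ (has_grad_bump n 1 rho)); ring.
exact: has_grad_C1 (has_gradZ (-6) (has_gradM (has_grad_coord i) (has_grad_bump n 0 rho))).
Qed.

Lemma C1_partial_mollifier i : C1 (partial i (@mollifier n rho)).
Proof.
have -> : partial i (@mollifier n rho) = fun x => I^-1 * partial i (@bump R n 3 rho) x.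
  by apply/funext => x; rewrite (has_grad_partial _ _ has_grad_mollifier).
exact: has_grad_C1 (has_gradZ _ (C1_has_grad (C1_partial_bump i))).
Qed.

Lemma partial_mollifierN i x : partial i (@mollifier n rho) (- x) = -1 * partial i (mollifier rho) x.
Proof.
rewrite !(has_grad_partial _ _ has_grad_mollifier) partial_bumpN; ring.
Qed.

Lemma integral_mollifier y : (\int[lebesgue_rV n]_x (@mollifier n rho (x - y))%:E = 1)%E.
Proof.
have cm := continuous_measurable_rV (has_grad_continuous has_grad_mollifier).
rewrite (integral_kernel y cm mollifier_ge0) /mollifier.
under eq_integral do rewrite EFinM.
rewrite ge0_integralZl_EFin//.
- by rewrite -IE -EFinM mulVf// gt_eqF.
- by move=> x _; rewrite lee_fin bump_ge0.
- by case/integrableP: bint.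
- by rewrite invr_ge0 ltW.
Qed.

Lemma has_grad_conv_mollifier (f : 'rV[R]_n -> R) (M r : R) :
  measurable_fun setT f -> (forall y, `|f y| <= M) -> vanish_off_cube r f ->
  has_grad (conv (mollifier rho) f) (fun i => conv (partial i (mollifier rho)) f).
Proof.
move=> mf fM fr; split=> [i x|i].
  exact: is_derive_conv (has_grad_C1 has_grad_mollifier) mollifier_vanish mf fM fr.
exact: continuous_conv (C1_partial_mollifier i) (partial_vanish i mollifier_vanish) mf fM fr.
Qed.

Lemma conv_mollifier_off (f : 'rV[R]_n -> R) (A : set 'rV[R]_n) x :
  (forall y, ~ A y -> f y = 0) -> ~ set_add A (@cube R n rho) x ->
  conv (mollifier rho) f x = 0.
Proof.
move=> fA xA; rewrite /conv /Rintegral integral0_eq// => y _.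
have [Ay|/fA ->] := pselect (A y); last by rewrite mulr0.
rewrite mollifier_vanish ?mul0r// => xy; apply: xA.
by exists y => //; exists (x - y) => //; rewrite addrC subrK.
Qed.

End mollifier.

(** An average of vectors of norm at most 1. Writing v for it, |v|^2 is the average
    of their scalar products with v, hence at most |v|. *)
Lemma enorm_conv_le1 n (rho r : R) (phi : 'I_n -> 'rV[R]_n -> R) x : 0 < rho ->
  (forall i, measurable_fun setT (phi i)) -> (forall i y, `|phi i y| <= 1) ->
  (forall i, vanish_off_cube r (phi i)) -> (forall y, enorm (\row_i phi i y) <= 1) ->
  enorm (\row_i (- conv (mollifier rho) (phi i) x)) <= 1.
Proof.
move=> r0 mphi phiM phir phi1; set v := \row_i _.
pose eta := @mollifier n rho.
have cm := has_grad_C1 (@has_grad_mollifier n rho).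
have mk := continuous_measurable_rV (C1_continuous cm).
have [N N0 KN] := continuous_bounded (C1_continuous cm) (mollifier_vanish r0).
have mex : measurable_fun setT (fun y : 'rV[R]_n => eta (x - y)) by exact: (measurableT_comp mk (@measurable_subr _ _ x)).
have e0 := enorm_ge0 v.
have eint : (\int[lebesgue_rV n]_y (enorm v * eta (x - y))%:E = (enorm v)%:E)%E.
  under eq_integral do rewrite EFinM.
  rewrite ge0_integralZl_EFin//.
  - under eq_integral => y _ do rewrite /eta -mollifierN opprB.
    by rewrite integral_mollifier ?mule1.
  - by move=> y _; rewrite lee_fin mollifier_ge0.
  - exact/measurable_EFinP.
have H : enorm v ^+ 2 <= enorm v.
  rewrite -lee_fin -eint sqr_enorm /sqnorm -sumEFin.
  rewrite (eq_bigr (fun i => \int[lebesgue_rV n]_y (- v ord0 i * (eta (x - y) * phi i y))%:E)%E); last first.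
    move=> i _; have ci := conv_integrable x mk KN (mphi i) (phiM i) (phir i).
    under eq_integral do rewrite EFinM.
    rewrite integralZl// -(convE x mk KN (mphi i) (phiM i) (phir i)) -EFinM.
    by congr EFin; rewrite {1}mxE; rewrite expr2 {1}/v mxE; ring.
  have ii i : (lebesgue_rV n).-integrable setT (fun y => (- v ord0 i * (eta (x - y) * phi i y))%:E).
    have ci := conv_integrable x mk KN (mphi i) (phiM i) (phir i).
    by have := integrableZl measurableT (- v ord0 i) ci; apply: eq_integrable => // y _; rewrite /= EFinM.
  rewrite -(@integral_sum _ _ _ (lebesgue_rV n) setT measurableT _ (fun i y => (- v ord0 i * (eta (x - y) * phi i y))%:E))//.
  apply: le_integral => //.
  - by apply: integrable_sum => // i _; exact: ii.
  - apply/integrableP; split; first by apply/measurable_EFinP; exact: measurable_funM.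
    rewrite (_ : (\int[_]_(y in _) _)%E = (enorm v)%:E) ?ltry//.
    rewrite -[RHS]eint; apply: eq_integral => y _; rewrite /= ger0_norm//.
    by rewrite mulr_ge0// mollifier_ge0.
  - move=> y _; rewrite sumEFin lee_fin.
    rewrite (eq_bigr (fun i => eta (x - y) * ((- v) ord0 i * (\row_i phi i y) ord0 i))); last first.
      by move=> i _; rewrite !mxE; ring.
    rewrite -mulr_sumr mulrC; apply: ler_wpM2r; first exact: mollifier_ge0.
    apply: (le_trans (cauchy_schwarz _ _)).
    by rewrite -scaleN1r enormZ normrN1 mul1r ler_piMr.
have [->|e1] := eqVneq (enorm v) 0; first exact: ler01.
have ep : 0 < enorm v by rewrite lt_def e1.
by move: H; rewrite expr2 -[leRHS]mulr1 ler_pM2l.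
Qed.

(** Let u be the mollification of the indicator of E, whose integral is |E|. With
    phi = grad u / |grad u|, the energy of u is the integral of grad u . phi. Moving
    the kernel to the other factor and integrating by parts makes it the integral
    over E of the divergence of psi, the opposite of the mollification of phi. As
    |psi| <= 1, it is at most the perimeter of E. *)
Lemma lambda1_le_cheeger n (W : set 'rV[R]_n) : open W -> (lambda 1 W <= cheeger W)%E.
Proof.
move=> oW; apply: le_ereal_inf_tmp => _ [E [mE cE EW E0] <-].
have [rho' r'0 rW'] := compact_ball_sub cE oW EW.
pose rho := rho' / 2; have r0 : 0 < rho by rewrite divr_gt0.
have [s s0 Es] := compact_sub_cube cE.
pose f : 'rV[R]_n -> R := \1_E.
have mf : measurable_fun setT f by exact: measurable_indic.
have fM y : `|f y| <= 1 by rewrite /f indicE; case: (_ \in _); rewrite ?normr1 ?normr0.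
have fE y : ~ E y -> f y = 0.
  by move=> Ey; rewrite /f indicE memNset.
have fr : vanish_off_cube s f.
  by move=> y ys; apply: fE => Ey; apply/ys/Es; exact: subset_closure.
pose eta := @mollifier n rho; pose u := conv eta f.
have cm := has_grad_C1 (@has_grad_mollifier n rho).
have mk := continuous_measurable_rV (C1_continuous cm).
have [N N0 KN] := continuous_bounded (C1_continuous cm) (mollifier_vanish r0).
have ug : has_grad u (fun i => conv (partial i eta) f) by exact: has_grad_conv_mollifier r0 _ _ _ mf fM fr.
pose Kc := set_add (closure E) (@cube R n rho).
have cKc : compact Kc by apply: compact_set_add => //; exact: compact_cube.
have uK x : ~ Kc x -> u x = 0.
  move=> xK; apply: (@conv_mollifier_off n rho r0 f (closure E)) => // y yE.
  by apply: fE => Ey; apply: yE; exact: subset_closure.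
have KW : Kc `<=` W.
  move=> _ [x Ex [y yr ->]]; apply: (rW' _ Ex).
  rewrite -ball_normE /ball_/= opprD addNKr normrN.
  apply: (@le_lt_trans _ _ rho); last by rewrite /rho; lra.
  by apply/cube_normP => //; exact: ltW.
have uc : C1c W u by exact: C1cI (has_grad_C1 ug) cKc KW uK.
have uT := C1cT uc; have [r rr0 ur] := C1c_vanish uT.
have u0 x : 0 <= u x.
  by apply: Rintegral_ge0 => y _; rewrite mulr_ge0 ?mollifier_ge0//.
have Eoo : (lebesgue_rV n E < +oo)%E.
  by apply: (@lebesgue_rV_bounded _ _ _ s) => //; apply: subset_trans Es; exact: subset_closure.
have mu_ : ((mass 1 u)%:E = lebesgue_rV n E)%E.
  rewrite -massE//.
  pose F (z : 'rV[R]_n * 'rV[R]_n) : \bar R := (eta (z.1 - z.2) * f z.2)%:E.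
  have mF : measurable_fun setT F.
    apply/measurable_EFinP; apply: measurable_funM; last exact: (measurableT_comp mf measurable_snd).
    exact: (measurableT_comp mk (@measurable_sub_prod _ n)).
  have F0 z : (0 <= F z)%E.
    by rewrite lee_fin mulr_ge0 ?mollifier_ge0// /f indicE.
  transitivity (\int[@leb R n]_x \int[@leb R n]_y F (x, y))%E.
    apply: eq_integral => x _; rewrite powRr1// ger0_norm//.
    by rewrite (convE x mk KN mf fM fr).
  rewrite (fubini_tonelli F mF F0).
  transitivity (\int[lebesgue_rV n]_y (f y)%:E)%E; last by rewrite integral_indic// setIT.
  apply: eq_integral => y _; rewrite /F/=.
  under eq_integral do rewrite mulrC EFinM.
  rewrite ge0_integralZl_EFin//.
  - by rewrite integral_mollifier ?mule1.
  - by move=> x _; rewrite lee_fin mollifier_ge0.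
  - apply/measurable_EFinP.
    exact: (measurableT_comp (measurableT_comp mk (@measurable_sub_prod _ n)) (pair2_measurable y)).
have [x ux] : exists x, u x != 0.
  apply: contrapT => nu; move: E0; rewrite -mu_ -massE//.
  rewrite integral0_eq ?ltxx// => x _.
  have -> : u x = 0 by apply/eqP; apply: contra_notT nu => ux; exists x.
  by rewrite normr0 powRr1.
apply: (le_trans (lambda_le ltr01 uc ux)).
have m0 := mass_gt0 ltr01 uT ux.
rewrite -mu_ inver gt_eqF// EFinM lee_pmul2r ?lte_fin ?invr_gt0//.
rewrite -dirichletE//; move=> {x ux m0}.
have cu := has_grad_C1 ug.
have meg := continuous_measurable_rV (continuous_enorm_grad cu).
(* The power -1 of 0 is 0, so that phi vanishes where the gradient does. *)
pose phi i x := (enorm (grad u x)) `^ (-1) * partial i u x.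
have mphi i : measurable_fun setT (phi i).
  apply: measurable_funM; first exact: (measurableT_comp (measurable_powR (-1)) meg).
  exact: continuous_measurable_rV (cu i).2.
have phi_grad x i : phi i x = ((enorm (grad u x))^-1 *: grad u x) ord0 i.
  rewrite !mxE /phi; have [e0|e0] := eqVneq (enorm (grad u x)) 0.
    by rewrite e0 powR0 ?invr0// oppr_eq0 oner_eq0.
  by rewrite powR_inv1// enorm_ge0.
have phi1 x : enorm (\row_i phi i x) <= 1.
  have -> : \row_i phi i x = (enorm (grad u x))^-1 *: grad u x.
    by apply/rowP => i; rewrite -phi_grad mxE.
  rewrite enormZ ger0_norm ?invr_ge0 ?enorm_ge0//.
  have [e0|e0] := eqVneq (enorm (grad u x)) 0; first by rewrite e0 mulr0.
  by rewrite mulVf.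
have phiM i x : `|phi i x| <= 1.
  apply: le_trans (phi1 x); have := ler_coord_enorm (\row_i phi i x) i.
  by rewrite mxE.
have phir i : vanish_off_cube r (phi i).
  by move=> y yr; rewrite /phi (partial_vanish i ur)// mulr0.
pose psi (x : 'rV[R]_n) : 'rV[R]_n := \row_i (- conv eta (phi i) x).
have psig i := has_grad_conv_mollifier r0 (mphi i) (phiM i) (phir i).
have psi_coord i : (fun x => psi x ord0 i) = (fun x => -1 * conv eta (phi i) x).
  by apply/funext => x; rewrite mxE mulN1r.
have psig' i : has_grad (fun x => psi x ord0 i) (fun j x => -1 * conv (partial j eta) (phi i) x).
  by rewrite psi_coord; exact: has_gradZ.
have psic i : C1c setT (fun x => psi x ord0 i).
  apply: (@C1cI _ _ _ (set_add (@cube R n r) (@cube R n rho))) => //.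
  - exact: has_grad_C1 (psig' i).
  - by apply: compact_set_add; exact: compact_cube.
  - by move=> x xc; rewrite mxE (conv_mollifier_off r0 _ xc) ?oppr0//; exact: phir.
have psi1 x : enorm (psi x) <= 1 by exact: (enorm_conv_le1 x r0 mphi phiM phir phi1).
have divpsi x : divergence psi x = \sum_i (-1 * conv (partial i eta) (phi i) x).
  by apply: eq_bigr => i _; rewrite (has_grad_partial i x (psig' i)).
apply: (@le_trans _ _ (\int[lebesgue_rV n]_(x in E) (divergence psi x)%:E)%E); last first.
  by apply: ereal_sup_ubound; exists psi.
rewrite le_eqVlt; apply/orP; left; apply/eqP.
transitivity (\sum_(i < n) \int[lebesgue_rV n]_x (conv (partial i eta) f x * phi i x)%:E)%E.
  rewrite -(@integral_sum _ _ _ (lebesgue_rV n) setT measurableT _ (fun i x => (conv (partial i eta) f x * phi i x)%:E)); last first.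
    move=> i.
    have [Q _ uQ] := continuous_bounded (cu i).2 (partial_vanish i ur).
    apply: (@bounded_integrable _ _ _ r (Q * 1)).
    - apply: measurable_funM => //.
      by apply: continuous_measurable_rV; have [_] := ug; exact.
    - by move=> y /phir ->; rewrite mulr0.
    - move=> y; rewrite normrM ler_pM// -(has_grad_partial i y ug)//.
  apply: eq_integral => y _; rewrite sumEFin; congr EFin; rewrite powRr1 ?enorm_ge0//.
  under eq_bigr => i _ do rewrite -(has_grad_partial i y ug) phi_grad mxE mulrCA mxE -expr2.
  rewrite -mulr_sumr.
  have -> : \sum_i partial i u y ^+ 2 = enorm (grad u y) ^+ 2.
    by rewrite sqr_enorm; apply: eq_bigr => i _; rewrite mxE.
  have [e0|e0] := eqVneq (enorm (grad u y)) 0; first by rewrite e0 expr0n mulr0.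
  by rewrite expr2 mulrA mulVf// mul1r.
transitivity (\sum_(i < n) \int[lebesgue_rV n]_y (-1 * conv (partial i eta) (phi i) y * f y)%:E)%E.
  apply: eq_bigr => i _.
  have ci := C1_continuous (C1_partial_mollifier rho i).
  have [Ni _ KNi] := continuous_bounded ci (partial_vanish i (mollifier_vanish r0)).
  have mki := continuous_measurable_rV ci.
  have H := conv_adjoint mki KNi (partial_mollifierN rho i) mf fM fr (mphi i) (phiM i) (phir i).
  exact: H.
rewrite -(@integral_sum _ _ _ (lebesgue_rV n) setT measurableT _ (fun i y => (-1 * conv (partial i eta) (phi i) y * f y)%:E)); last first.
  move=> i; have pint := C1c_partial_integrable i (psic i).
  have pE : partial i (fun x => psi x ord0 i) = (fun y => -1 * conv (partial i eta) (phi i) y).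
    by apply/funext => y; rewrite (has_grad_partial i y (psig' i)).
  rewrite pE in pint.
  apply: le_integrable pint => //.
    apply/measurable_EFinP; apply: measurable_funM => //.
    by apply: continuous_measurable_rV; have [_] := psig' i; exact.
  by move=> y _ /=; rewrite lee_fin normrM ler_piMr.
rewrite [RHS]integral_mkcond; apply: eq_integral => y _.
rewrite sumEFin patchE -mulr_suml -divpsi /f indicE.
by case: ifP => _; rewrite ?mulr1 ?mulr0.
Qed.

Lemma cheeger_lambda1 n (W : set 'rV[R]_n) : open W -> cheeger W = lambda 1 W.
Proof.
by move=> oW; apply/eqP; rewrite eq_le cheeger_le_lambda1 lambda1_le_cheeger.
Qed.

End Cheeger_equality.

(** * The Poincare inequality *)

Section Poincare.
Context {R : realType}.
Local Notation mu := (@lebesgue_measure R).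

Lemma has_grad_affine n (a : R) (c : 'rV[R]_n) (u : 'rV[R]_n -> R) g : has_grad u g ->
  has_grad (fun x => u (a *: x + c)) (fun i x => a * g i (a *: x + c)).
Proof.
move=> [du cg]; split=> [i x|i].
  apply/is_derive_line.
  have /is_derive_line H := du i (a *: x + c).
  have d0 := is_deriveM (is_derive_cst a (0 : R) (1 : R)) (is_derive_id (0 : R) (1 : R)).
  have H0 : is_derive ((cst a * id) (0 : R)) (1 : R) (fun t : R => u (t *: delta_mx ord0 i + (a *: x + c))) (g i (a *: x + c)).
    by rewrite /= (_ : (cst a * id) 0 = 0)//; rewrite /GRing.mul/= mulr0.
  have := @is_derive1_comp _ _ (cst a * id) 0 _ _ H0 d0.
  rewrite (_ : _ \o _ = (fun t : R => u (a *: (t *: delta_mx ord0 i + x) + c))); last first.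
    by apply/funext => t; rewrite /= scalerDr scalerA addrA.
  by move/is_derive_eq; apply; rewrite /GRing.scale/= mulr0 addr0 mulr1 mulrC.
have ca : continuous (fun x : 'rV[R]_n => a *: x + c).
  apply: continuous_rV => j; under eq_fun do rewrite !mxE.
  move=> x; apply: (@cvgD R _ 'rV[R]_n (nbhs x)); last exact: cvg_cst.
  by apply: (@cvgM R 'rV[R]_n (nbhs x)); [exact: cvg_cst|exact: coord_continuous].
move=> x; apply: (@cvgM R 'rV[R]_n (nbhs x)); first exact: cvg_cst.
exact: (continuous_comp_rV ca (cg i)).
Qed.

(** A bump centred at x, of radius smaller than the distance to the complement. *)
Lemma exists_test n (W : set 'rV[R]_n) x : open W -> W x ->
  exists2 u, C1c W u & u x != 0.
Proof.
move=> oW Wx.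
have [rho r0 rW] := @compact_ball_sub R n [set x] W (@compact_set1 _ x) oW (fun y yx => eq_ind_r W Wx yx).
pose u (y : 'rV[R]_n) : R := bump 2 (rho / 2) (1 *: y - x).
have ug := has_grad_affine 1 (- x) (has_grad_bump n 0 (rho / 2)).
have r2 : 0 < rho / 2 by rewrite divr_gt0.
exists u; last first.
  by rewrite /u scale1r subrr gt_eqF// bump_gt0// sqnorm0 exprn_gt0.
apply: (@C1cI _ _ _ (set_add [set x] (@cube R n (rho / 2)))).
- exact: has_grad_C1 ug.
- by apply: compact_set_add; [exact: compact_set1|exact: compact_cube].
- move=> _ [y -> [z zr ->]]; apply: (rW _ erefl).
  rewrite -ball_normE /ball_/= opprD addNKr normrN.
  apply: (@le_lt_trans _ _ (rho / 2)); last lra.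
  by apply/cube_normP => //; exact: ltW.
- move=> y yK; rewrite /u bump_vanish ?(ltW r2)// => yc; apply: yK.
  by exists x => //; exists (1 *: y - x) => //; rewrite scale1r addrC subrK.
Qed.

Lemma lambda_lty n (W : set 'rV[R]_n) p x : open W -> W x -> 0 < p ->
  (lambda p W < +oo)%E.
Proof.
move=> oW Wx p0; have [u uc ux] := exists_test oW Wx.
by apply: (le_lt_trans (lambda_le p0 uc ux)); rewrite ltry.
Qed.

(** The increment is at most the integral of |f'| over [x, x + s]; exchange the
    integrals over x and over the offset. *)
Lemma translate_diff_R (f df : R -> R) (s L : R) : 0 <= s <= L ->
  (forall x, is_derive x (1 : R) f (df x)) -> continuous df ->
  (\int[mu]_x `|f (x + s)%R - f x|%:E <= L%:E * \int[mu]_x `|df x|%:E)%E.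
Proof.
move=> /andP[s0 sL] dfE cdf.
have mdf : measurable_fun setT df by exact: continuous_measurable_fun.
have cf : continuous f by move=> x; exact: is_derive_continuous (dfE x).
have mf : measurable_fun setT f by exact: continuous_measurable_fun.
have madf : measurable_fun setT (fun x => `|df x|%:E).
  by apply/measurable_EFinP; exact: measurableT_comp.
have I0 : (0 <= \int[mu]_x `|df x|%:E)%E by apply: integral_ge0 => x _; rewrite lee_fin.
have L0 : 0 <= L by exact: le_trans sL.
move: s0; rewrite le_eqVlt => /predU1P[<-|s0].
  rewrite integral0_eq; last by move=> x _; rewrite addr0 subrr normr0.
  by rewrite mule_ge0// lee_fin.
pose F (z : R * R) : \bar R := ((\1_(`[0%R, s]%classic) z.2)%:E * `|df (z.1 + z.2)%R|%:E)%E.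
have mF : measurable_fun setT F.
  apply: emeasurable_funM; last first.
    by apply: (measurableT_comp madf); exact: measurable_funD.
  by apply/measurable_EFinP; apply: (measurableT_comp _ measurable_snd); exact: measurable_indic.
have F0 z : (0 <= F z)%E by rewrite mule_ge0// lee_fin// indicE.
apply: (@le_trans _ _ (\int[mu]_x \int[mu]_t F (x, t))%E).
  apply: ge0_le_integral => //.
  - apply/measurable_EFinP; apply: measurableT_comp => //; apply: measurable_funB => //.
    by apply: (measurableT_comp mf); exact: measurable_funD.
  - exact: (@measurable_fun_fubini_tonelli_F _ _ _ _ _ mu F mF F0).
  - move=> x _; rewrite /F/=.
    have -> : (\int[mu]_t ((\1_(`[0%R, s]%classic) t)%:E * `|df (x + t)%R|%:E) =
               \int[mu]_(t in `[0%R, s]) `|df (x + t)%R|%:E)%E.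
      rewrite [RHS]integral_mkcond; apply: eq_integral => t _; rewrite patchE indicE.
      by case: (_ \in _); rewrite ?mul1e ?mul0e.
    have dfx t : is_derive t (1 : R) (fun t => f (x + t)) (df (x + t)).
      have -> : (fun t => f (x + t)) = (fun t => f (t - (- x))).
        by apply/funext => y; rewrite opprK addrC.
      by apply: is_derive_shift; rewrite opprK addrC.
    have cdfx : continuous (fun t => df (x + t)).
      move=> t; apply: (@cvg_comp _ _ _ (fun t => x + t) df _ (nbhs (x + t))); last exact: cdf.
      by apply: cvgD; [exact: cvg_cst|exact: cvg_id].
    have cfx : continuous (fun t => f (x + t)) by move=> t; exact: is_derive_continuous (dfx t).
    have H : (\int[mu]_(t in `[0%R, s]) (df (x + t)%R)%:E = (f (x + s)%R)%:E - (f (x + 0)%R)%:E)%E.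
      apply: (@continuous_FTC2 _ _ (fun t => f (x + t))) => //.
      - exact: continuous_subspaceT.
      - split.
        + by move=> t _; have [] := dfx t.
        + exact/cvg_at_right_filter/cfx.
        + exact/cvg_at_left_filter/cfx.
      - by move=> t _; rewrite derive1E; have [] := dfx t.
    rewrite addr0 in H.
    rewrite -abse_EFin EFinB -H.
    apply: le_abse_integral => //.
    apply/measurable_EFinP; apply: measurable_funTS.
    exact: continuous_measurable_fun.
rewrite (@fubini_tonelli _ _ _ _ _ mu mu F mF F0).
rewrite [leLHS](_ : _ = \int[mu]_t ((\1_(`[0%R, s]%classic) t)%:E * \int[mu]_x `|df x|%:E))%E; last first.
  apply: eq_integral.
  move=> t _; rewrite /F/= ge0_integralZl_EFin//; last first.
  - by apply: (measurableT_comp madf); exact: measurable_funD.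
  by rewrite (ge0_integral_shift t madf).
rewrite ge0_integralZr//; last first.
  by apply/measurable_EFinP; exact: measurable_indic.
rewrite integral_indic//= setIT lebesgue_measure_itv/= lte_fin s0 sube0.
by rewrite lee_wpmul2r// lee_fin.
Qed.

Lemma measurable_C1_partial n (u : 'rV[R]_n -> R) i : C1 u -> measurable_fun setT (partial i u).
Proof. by move=> cu; apply: continuous_measurable_rV; have [] := cu i. Qed.

(** The translation is performed one coordinate at a time. *)
Lemma translate_diff n (u : 'rV[R]_n -> R) (z : 'rV[R]_n) (L : R) : C1 u ->
  (forall i, 0 <= z ord0 i <= L) ->
  (\int[lebesgue_rV n]_x `|u (x + z)%R - u x|%:E <=
   \sum_(i < n) (L%:E * \int[lebesgue_rV n]_x `|partial i u x|%:E))%E.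
Proof.
elim: n u z => [|n IH] u z cu zL.
  rewrite big_ord0 integral0_eq// => x _.
  have -> : x + z = x by apply/rowP => -[].
  by rewrite subrr normr0.
have mu_ := continuous_measurable_rV (C1_continuous cu).
rewrite -(rV_consK z); set s := z _ _; set z' := \row__ _.
have muc : measurable_fun setT (fun p : R * 'rV[R]_n => u (rV_cons p)).
  by apply: (measurableT_comp mu_); exact: measurable_rV_cons.
have mshift : measurable_fun setT (fun x : 'rV[R]_n.+1 => u (x + rV_cons (s, z'))).
  by apply: (measurableT_comp mu_); exact: measurable_addr_rV.
pose f1 (p : R * 'rV[R]_n) : \bar R := `|u (rV_cons (p.1 + s, p.2 + z')) - u (rV_cons (p.1 + s, p.2))|%:E.
pose f2 (p : R * 'rV[R]_n) : \bar R := `|u (rV_cons (p.1 + s, p.2)) - u (rV_cons p)|%:E.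
have ms1 : measurable_fun setT (fun p : R * 'rV[R]_n => (p.1 + s, p.2)).
  by apply: measurable_fun_pair => //; exact: measurable_funD.
have ms2 : measurable_fun setT (fun p : R * 'rV[R]_n => (p.1 + s, p.2 + z')).
  apply: measurable_fun_pair; first exact: measurable_funD.
  exact: (measurableT_comp (@measurable_addr_rV _ _ z') measurable_snd).
have mf1 : measurable_fun setT f1.
  apply/measurable_EFinP; apply: measurableT_comp => //; apply: measurable_funB.
    exact: (measurableT_comp muc ms2).
  exact: (measurableT_comp muc ms1).
have mf2 : measurable_fun setT f2.
  apply/measurable_EFinP; apply: measurableT_comp => //; apply: measurable_funB => //.
  exact: (measurableT_comp muc ms1).
rewrite ge0_integral_rVS_prod//; last first.
  by apply/measurable_EFinP; apply: measurableT_comp => //; exact: measurable_funB.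
apply: (@le_trans _ _ (\int[mu \x @leb R n]_p (f1 p + f2 p))%E).
  apply: ge0_le_integral => //.
  - apply/measurable_EFinP; apply: measurableT_comp => //; apply: measurable_funB => //.
    by apply: (measurableT_comp mshift); exact: measurable_rV_cons.
  - exact: emeasurable_funD.
  - move=> [x v] _; rewrite /f1 /f2/= -EFinD lee_fin rV_consD.
    have := ler_normD (u (rV_cons (x + s, v + z')) - u (rV_cons (x + s, v))) (u (rV_cons (x + s, v)) - u (rV_cons (x, v))).
    by rewrite addrA subrK.
have f10 p : (0 <= f1 p)%E by rewrite lee_fin.
have f20 p : (0 <= f2 p)%E by rewrite lee_fin.
have split12 : (\int[mu \x @leb R n]_p (f1 p + f2 p) = \int[mu \x @leb R n]_p f1 p + \int[mu \x @leb R n]_p f2 p)%E.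
  by apply: ge0_integralD.
rewrite split12.
rewrite big_ord_recl addeC; apply: leeD.
- rewrite fubini_tonelli2//= /fubini_G/=.
  rewrite ge0_integral_rVSr//; last first.
    by apply/measurable_EFinP; apply: measurableT_comp => //; exact: measurable_C1_partial.
  rewrite -ge0_integralZl_EFin//; last 3 first.
  - by move=> v _; apply: integral_ge0 => x _; rewrite lee_fin.
  - apply: (@measurable_fun_fubini_tonelli_G _ _ _ _ _ mu (fun p => `|partial ord0 u (rV_cons p)|%:E)) => //.
    apply/measurable_EFinP; apply: measurableT_comp => //.
    by apply: (measurableT_comp (measurable_C1_partial ord0 cu)); exact: measurable_rV_cons.
  - by have /andP[a b] := zL ord0; exact: le_trans b.
  apply: ge0_le_integral => //.
  - by move=> v _; apply: integral_ge0 => x _; rewrite lee_fin.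
  - exact: (@measurable_fun_fubini_tonelli_G _ _ _ _ _ mu f2).
  - apply: measurable_funeM.
    apply: (@measurable_fun_fubini_tonelli_G _ _ _ _ _ mu (fun p => `|partial ord0 u (rV_cons p)|%:E)) => //.
    apply/measurable_EFinP; apply: measurableT_comp => //.
    by apply: (measurableT_comp (measurable_C1_partial ord0 cu)); exact: measurable_rV_cons.
  - move=> v _; apply: (@translate_diff_R (fun t => u (rV_cons (t, v))) (fun t => partial ord0 u (rV_cons (t, v))) s L).
    + exact: zL.
    + by move=> x; exact: partial_cons0.
    + move=> x; apply: (@cvg_comp _ _ _ (fun x => rV_cons (x, v)) (partial ord0 u) _ (nbhs (rV_cons (x, v)))).
        exact: continuous_rV_consl.
      by have [_] := cu ord0; exact.
- rewrite fubini_tonelli1//= /fubini_F/=.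
  pose G (x : R) := (\int[lebesgue_rV n]_v `|u (rV_cons (x, v + z')) - u (rV_cons (x, v))|%:E)%E.
  have mG : measurable_fun setT G.
    apply: (@measurable_fun_fubini_tonelli_F _ _ _ _ _ (@leb R n) (fun p => `|u (rV_cons (p.1, p.2 + z')) - u (rV_cons p)|%:E)) => //.
    apply/measurable_EFinP; apply: measurableT_comp => //; apply: measurable_funB => //.
    apply: (measurableT_comp muc); apply: measurable_fun_pair => //.
    exact: (measurableT_comp (@measurable_addr_rV _ _ z') measurable_snd).
  have G0 x : (0 <= G x)%E by apply: integral_ge0 => v _; rewrite lee_fin.
  rewrite (ge0_integral_shift s mG G0).
  have mp j : measurable_fun setT (fun p : R * 'rV[R]_n => `|partial (lift ord0 j) u (rV_cons p)|%:E).
    apply/measurable_EFinP; apply: measurableT_comp => //.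
    by apply: (measurableT_comp (measurable_C1_partial _ cu)); exact: measurable_rV_cons.
  have L0 : 0 <= L by have /andP[a b] := zL ord0; exact: le_trans b.
  rewrite (eq_bigr (fun j => \int[mu]_x (L%:E * \int[lebesgue_rV n]_v `|partial (lift ord0 j) u (rV_cons (x, v))|%:E))%E); last first.
    move=> j _; rewrite ge0_integral_rVS//; last first.
      by apply/measurable_EFinP; apply: measurableT_comp => //; exact: measurable_C1_partial.
    rewrite ge0_integralZl_EFin//.
    - by move=> x _; apply: integral_ge0 => v _; rewrite lee_fin.
    - exact: (@measurable_fun_fubini_tonelli_F _ _ _ _ _ (@leb R n) _ (mp j)).
  have mpj j : measurable_fun setT (fun x => L%:E * \int[lebesgue_rV n]_v `|partial (lift ord0 j) u (rV_cons (x, v))|%:E)%E.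
    apply: measurable_funeM.
    exact: (@measurable_fun_fubini_tonelli_F _ _ _ _ _ (@leb R n) _ (mp j)).
  have pj0 j x : (0 <= L%:E * \int[lebesgue_rV n]_v `|partial (lift ord0 j) u (rV_cons (x, v))|%:E)%E.
    by rewrite mule_ge0 ?lee_fin//; apply: integral_ge0 => v _; rewrite lee_fin.
  have sl (x : R) (j : 'I_n) : (fun v => `|partial j (fun w => u (rV_cons (x, w))) v|%:E) =
      (fun v => `|partial (lift ord0 j) u (rV_cons (x, v))|%:E).
    by apply/funext => v; rewrite partial_slice.
  rewrite [leRHS](_ : _ = \int[mu]_x (\sum_(j < n) (L%:E * \int[lebesgue_rV n]_v `|partial (lift ord0 j) u (rV_cons (x, v))|%:E)))%E; last first.
    by rewrite ge0_integral_sum.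
  apply: ge0_le_integral => //.
  - exact: emeasurable_sum.
  - move=> x _; apply: (le_trans (IH (fun v => u (rV_cons (x, v))) z' (C1_slice x cu) _)).
      by move=> i; rewrite mxE.
    by apply: lee_sum => j _; rewrite sl.
Qed.

Definition corner n (L : R) : set 'rV[R]_n := [set v | forall i, v ord0 i \in `[0, L]%R].

Lemma measurable_corner n L : measurable (@corner n L).
Proof. by apply: (@measurable_box R n (fun=> `[0, L]%classic)) => i. Qed.

Lemma lebesgue_corner n (L : R) : 0 < L -> lebesgue_rV n (@corner n L) = (L ^+ n)%:E.
Proof.
move=> L0; rewrite (@lebesgue_rV_box R n (fun=> `[0, L]%classic))//.
rewrite (eq_bigr (fun=> L%:E)); last first.
  by move=> i _; rewrite lebesgue_measure_itv/= lte_fin L0 sube0.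
by rewrite prodEFin prodr_const card_ord.
Qed.

(** Let Q be the cube [0, L]^n, with L^n > m >= |W|. If x + z is not in W, then
    |u(x)| = |u(x + z) - u(x)|. For fixed x, the translations z for which x + z stays
    in W form a set of measure at most m, so that integrating over x and over z in Q
    gives at least (L^n - m) times the mass on one side, and [translate_diff] bounds the
    other. *)
Lemma poincare n (W : set 'rV[R]_n) (m L : R) : (0 < n)%N -> measurable W ->
  (lebesgue_rV n W <= m%:E)%E -> 0 < L -> m < L ^+ n ->
  (((L ^+ n - m) / (L ^+ n * L * n%:R))%:E <= lambda 1 W)%E.
Proof.
move=> n0 mW Wm L0 mL; apply: lambda_ge => // u uc _.
have uT := C1cT uc; have [cu ku sW] := uc.
have cuc := C1_continuous cu; have mu_ := continuous_measurable_rV cuc.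
have m0 : 0 <= m by rewrite -lee_fin (le_trans _ Wm).
have maux : measurable_fun setT (fun x => `|u x|%:E).
  by apply/measurable_EFinP; exact: measurableT_comp.
pose A := mass 1 u; pose B := dirichlet 1 u.
have AE : (\int[lebesgue_rV n]_x `|u x|%:E = A%:E)%E.
  by rewrite -massE//; apply: eq_integral => x _; rewrite powRr1.
have BE : (\int[lebesgue_rV n]_x (enorm (grad u x))%:E = B%:E)%E.
  by rewrite -dirichletE//; apply: eq_integral => x _; rewrite powRr1// enorm_ge0.
have S_le : (\sum_(i < n) (L%:E * \int[lebesgue_rV n]_x `|partial i u x|%:E) <= (L * n%:R * B)%:E)%E.
  apply: (@le_trans _ _ (\sum_(i < n) (L * B)%:E)%E).
    apply: lee_sum => i _; rewrite EFinM lee_pmul2l// -BE.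
    apply: ge0_le_integral => //.
    - by apply/measurable_EFinP; apply: measurableT_comp => //; exact: measurable_C1_partial.
    - by apply/measurable_EFinP; apply: continuous_measurable_rV; exact: continuous_enorm_grad.
    - by move=> x _; rewrite lee_fin; have := ler_coord_enorm (grad u x) i; rewrite mxE.
  by rewrite sumEFin lee_fin sumr_const card_ord -[leLHS]mulr_natr mulrAC.
pose Q := @corner n L.
pose iQ (z : 'rV[R]_n) : R := \1_Q z.
pose iW (z : 'rV[R]_n) : R := \1_W z.
have miQ : measurable_fun setT iQ by apply: measurable_indic; exact: measurable_corner.
have miW : measurable_fun setT iW by exact: measurable_indic.
have iQ0 z : 0 <= iQ z by rewrite /iQ indicE.
have iW0 z : 0 <= iW z by rewrite /iW indicE.
have QE : (\int[lebesgue_rV n]_z (iQ z)%:E = (L ^+ n)%:E)%E.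
  by rewrite integral_indic ?setIT ?lebesgue_corner//; exact: measurable_corner.
have uW x : ~ W x -> u x = 0 by move=> Wx; apply: supp_off => /sW.
have madd : measurable_fun setT (fun p : 'rV[R]_n * 'rV[R]_n => p.1 + p.2).
  apply: measurable_fun_rVP => i.
  rewrite (_ : (fun z => _) = (fun z : 'rV[R]_n * 'rV[R]_n => z.1 ord0 i + z.2 ord0 i)).
    by apply: measurable_funD; [exact: (measurableT_comp (measurable_coord i) measurable_fst)|exact: (measurableT_comp (measurable_coord i) measurable_snd)].
  by apply/funext => z; rewrite !mxE.
pose F1 (p : 'rV[R]_n * 'rV[R]_n) : \bar R := (iQ p.2 * `|u (p.1 + p.2) - u p.1|)%:E.
pose F2 (p : 'rV[R]_n * 'rV[R]_n) : \bar R := (`|u p.1| * iW (p.1 + p.2))%:E.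
pose F0 (p : 'rV[R]_n * 'rV[R]_n) : \bar R := (`|u p.1| * iQ p.2)%:E.
have mQ2 : measurable_fun setT (fun p : 'rV[R]_n * 'rV[R]_n => iQ p.2).
  exact: (measurableT_comp miQ measurable_snd).
have mu1 : measurable_fun setT (fun p : 'rV[R]_n * 'rV[R]_n => u p.1).
  exact: (measurableT_comp mu_ measurable_fst).
have mF1 : measurable_fun setT F1.
  apply/measurable_EFinP; apply: measurable_funM => //; apply: measurableT_comp => //.
  by apply: measurable_funB => //; exact: (measurableT_comp mu_ madd).
have mF2 : measurable_fun setT F2.
  apply/measurable_EFinP; apply: measurable_funM; first exact: measurableT_comp.
  exact: (measurableT_comp miW madd).
have mF0 : measurable_fun setT F0.
  by apply/measurable_EFinP; apply: measurable_funM => //; exact: measurableT_comp.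
have F10 p : (0 <= F1 p)%E by rewrite lee_fin mulr_ge0.
have F20 p : (0 <= F2 p)%E by rewrite lee_fin mulr_ge0.
have F00 p : (0 <= F0 p)%E by rewrite lee_fin mulr_ge0.
have E0 : (\int[@leb R n]_x \int[@leb R n]_z F0 (x, z) = (A * L ^+ n)%:E)%E.
  rewrite EFinM -AE -ge0_integralZr ?lee_fin ?exprn_ge0 ?(ltW L0)//.
  apply: eq_integral => x _; rewrite /F0/=.
  under eq_integral do rewrite EFinM.
  rewrite ge0_integralZl_EFin//.
  - by rewrite QE.
  - by move=> z _; rewrite lee_fin.
  - exact/measurable_EFinP.
have E2 : (\int[@leb R n]_x \int[@leb R n]_z F2 (x, z) <= (A * m)%:E)%E.
  rewrite EFinM -AE -ge0_integralZr ?lee_fin//.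
  apply: ge0_le_integral => //.
  - by move=> x _; exact: integral_ge0.
  - exact: (@measurable_fun_fubini_tonelli_F _ _ _ _ _ (@leb R n) F2 mF2 F20).
  - by apply: emeasurable_funM.
  - move=> x _; rewrite /F2/=.
    under eq_integral do rewrite EFinM.
    rewrite ge0_integralZl_EFin//; last 2 first.
    - by move=> z _; rewrite lee_fin.
    - apply/measurable_EFinP; apply: (measurableT_comp miW).
      exact: (measurableT_comp madd (pair1_measurable x)).
    rewrite lee_wpmul2l ?lee_fin//.
    under eq_integral do rewrite addrC.
    have miWE : measurable_fun setT (fun z => (iW z)%:E) by apply/measurable_EFinP.
    have iWE0 z : (0 <= (iW z)%:E)%E by rewrite lee_fin.
    rewrite (ge0_integral_shift_rV x miWE iWE0).
    by rewrite integral_indic// setIT.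
have E1 : (\int[@leb R n]_x \int[@leb R n]_z F1 (x, z) <= (L ^+ n * (L * n%:R * B))%:E)%E.
  rewrite (@fubini_tonelli _ _ _ _ _ (@leb R n) (@leb R n) F1 mF1 F10).
  rewrite EFinM -QE -ge0_integralZr ?lee_fin//; last 3 first.
  - exact/measurable_EFinP.
  - by move=> z _; rewrite lee_fin.
  - by rewrite !mulr_ge0 ?(ltW L0) ?dirichlet_ge0.
  apply: ge0_le_integral => //.
  - by move=> x _; exact: integral_ge0.
  - exact: (@measurable_fun_fubini_tonelli_G _ _ _ _ _ (@leb R n) F1 mF1 F10).
  - by apply: emeasurable_funM => //; apply/measurable_EFinP.
  - move=> z _; rewrite /F1/=; have [Qz|Qz] := pselect (Q z); last first.
      rewrite integral0_eq; last by move=> x _; rewrite /iQ indicE memNset// mul0r.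
      by rewrite mule_ge0 ?lee_fin// !mulr_ge0 ?(ltW L0) ?dirichlet_ge0.
    have -> : iQ z = 1 by rewrite /iQ indicE mem_set.
    rewrite mul1e; under eq_integral do rewrite mul1r.
    apply: (le_trans (translate_diff cu _) S_le) => i.
    by have := Qz i; rewrite in_itv.
have key : (\int[@leb R n]_x \int[@leb R n]_z F0 (x, z) <=
    \int[@leb R n]_x \int[@leb R n]_z F1 (x, z) + \int[@leb R n]_x \int[@leb R n]_z F2 (x, z))%E.
  have mG1 := @measurable_fun_fubini_tonelli_F _ _ _ _ _ (@leb R n) F1 mF1 F10.
  have mG2 := @measurable_fun_fubini_tonelli_F _ _ _ _ _ (@leb R n) F2 mF2 F20.
  rewrite -ge0_integralD//; last 2 first.
  - by move=> x _; exact: integral_ge0.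
  - by move=> x _; exact: integral_ge0.
  apply: ge0_le_integral => //.
  - by move=> x _; exact: integral_ge0.
  - exact: (@measurable_fun_fubini_tonelli_F _ _ _ _ _ (@leb R n) F0 mF0 F00).
  - exact: emeasurable_funD.
  - move=> x _.
    have mF1x : measurable_fun setT (fun z => F1 (x, z)) by exact: (measurableT_comp mF1 (pair1_measurable x)).
    have mF2x : measurable_fun setT (fun z => F2 (x, z)) by exact: (measurableT_comp mF2 (pair1_measurable x)).
    rewrite -ge0_integralD//.
    apply: ge0_le_integral => //.
    + exact: (measurableT_comp mF0 (pair1_measurable x)).
    + exact: emeasurable_funD.
    + move=> z _; rewrite /F0 /F1 /F2/= -EFinD lee_fin.
      have [Wxz|Wxz] := pselect (W (x + z)).
        have -> : iW (x + z) = 1 by rewrite /iW indicE mem_set.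
        rewrite mulr1 -[leLHS]add0r lerD ?mulr_ge0//.
        by rewrite ler_piMr// /iQ indicE; case: (_ \in _).
      have -> : iW (x + z) = 0 by rewrite /iW indicE memNset.
      by rewrite (uW _ Wxz) sub0r normrN mulr0 addr0 mulrC.
move: key; rewrite E0 => key.
have {}key : A * L ^+ n <= L ^+ n * (L * n%:R * B) + A * m.
  by rewrite -lee_fin EFinD; apply: (le_trans key); exact: leeD.
rewrite -/A -/B mulrAC ler_pdivrMr; last by rewrite !mulr_gt0 ?exprn_gt0// ltr0n.
move: key; rewrite mulrBl => key; lra.
Qed.

(** The Poincare inequality gives the exponent 1, and monotonicity all the others. *)
Lemma lambda_gt0 n (W : set 'rV[R]_n) (p : R) : (0 < n)%N -> measurable W ->
  (lebesgue_rV n W < +oo)%E -> 1 <= p -> (0 < lambda p W)%E.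
Proof.
move=> n0 mW Woo p1.
pose m := fine (lebesgue_rV n W).
have Wm : (lebesgue_rV n W <= m%:E)%E by rewrite /m fineK// ge0_fin_numE.
have m0 : 0 <= m by rewrite fine_ge0.
pose L := m + 1.
have L1 : 1 <= L by rewrite /L lerDr.
have L0 : 0 < L by exact: lt_le_trans L1.
have mL : m < L ^+ n.
  apply: (@lt_le_trans _ _ L); first by rewrite /L ltrDl.
  by rewrite -[leLHS]expr1 ler_weXn2l.
have := poincare n0 mW Wm L0 mL; set c := (_ / _) => cl.
have c0 : 0 < c.
  by rewrite /c divr_gt0 ?subr_gt0// !mulr_gt0 ?exprn_gt0// ltr0n.
move: p1; rewrite le_eqVlt => /predU1P[<-|p1]; first exact: lt_le_trans cl.
have := lambda_monotone (lexx 1) p1 (ltW c0) cl; apply: lt_le_trans.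
rewrite lte_fin powR_gt0// mulr_gt0 ?powR_gt0//.
by rewrite div1r invr_gt0 (lt_trans ltr01).
Qed.

End Poincare.

(** * Balls *)

Section Ball.
Context {R : realType}.

Definition sball n (r : R) : set 'rV[R]_n := [set x | sqnorm x < r ^+ 2].

Lemma open_sball n r : open (@sball n r).
Proof.
rewrite (_ : sball r = sqnorm (n:=n) @^-1` [set t | t < r ^+ 2])//.
by apply: open_comp; [move=> x _; exact: continuous_sqnorm|exact: open_lt].
Qed.

Lemma sball_cube n r : 0 <= r -> @sball n r `<=` @cube R n r.
Proof.
move=> r0 x xr; apply: contrapT => /(bump_vanish 0 r0) b0.
by have := bump_gt0 1 xr; rewrite b0 ltxx.
Qed.

Lemma sball_A_all n r : 0 < r -> A_all (@sball n r).
Proof.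
move=> r0; split; first exact: open_sball.
rewrite (@lebesgue_rV_open_gt0 R n _ 0) ?(lebesgue_rV_bounded (sball_cube (ltW r0)))//.
- exact: open_measurable_rV (@open_sball _ _).
- exact: open_sball.
- by rewrite /sball/= sqnorm0 exprn_gt0.
Qed.

Lemma sqnormZ n (c : R) (x : 'rV[R]_n) : sqnorm (c *: x) = c ^+ 2 * sqnorm x.
Proof. by rewrite /sqnorm mulr_sumr; apply: eq_bigr => i _; rewrite mxE exprMn. Qed.

(** Dilating a point of K slightly keeps it in the ball. *)
Lemma compact_sub_sball n (K : set 'rV[R]_n) r : 0 < r -> compact K -> K `<=` @sball n r ->
  exists2 s, 0 < s < r ^+ 2 & forall x, K x -> sqnorm x <= s.
Proof.
move=> r0 cK Kr; have [rho rho0 rW] := compact_ball_sub cK (@open_sball n r) Kr.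
pose e := rho / (2 * r).
have e0 : 0 < e by rewrite divr_gt0// mulr_gt0.
have e1 : 1 < (1 + e) ^+ 2 by rewrite expr_gt1 ?ltrDl ?addr_ge0 ?(ltW e0)// ltW.
have e10 := lt_trans ltr01 e1.
exists (r ^+ 2 / (1 + e) ^+ 2).
  have r20 : 0 < r ^+ 2 by exact: exprn_gt0.
  by apply/andP; split; [exact: divr_gt0|rewrite ltr_pdivrMr// ltr_pMr].
move=> x Kx; rewrite ler_pdivlMr// mulrC -sqnormZ ltW//.
apply: (rW x Kx); rewrite -ball_normE /ball_/= scalerDl scale1r opprD addNKr normrN normrZ.
rewrite gtr0_norm//; apply: (@le_lt_trans _ _ (e * r)).
  rewrite ler_wpM2l ?(ltW e0)//; apply/cube_normP; first exact: ltW.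
  exact: (sball_cube (ltW r0) (Kr _ Kx)).
by rewrite /e invfM mulrA mulfVK ?gt_eqF// ltr_pdivrMr// ltr_pMr// ltr1n.
Qed.

(** The field x/r has divergence n/r and norm at most 1 on the ball. It is cut off
    between the closure of E and the sphere in order to have compact support, which
    leaves its divergence on E unchanged. *)
Lemma cheeger_sball n r : 0 < r -> ((n%:R / r)%:E <= cheeger (@sball n r))%E.
Proof.
move=> r0; apply: le_ereal_inf_tmp => _ [E [mE cE EW E0] <-].
have [s /andP[s0 sr] sE] := compact_sub_sball r0 cE EW.
have Efin : lebesgue_rV n E \is a fin_num.
  rewrite ge0_fin_numE//.
  apply: (lebesgue_rV_bounded (r := r)) => //.
  by apply: subset_trans (sball_cube (ltW r0)); apply: subset_trans EW; exact: subset_closure.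
have F0 : 0 < fine (lebesgue_rV n E) by rewrite fine_gt0// E0 -ge0_fin_numE.
rewrite -(fineK Efin) inver gt_eqF// lee_pdivlMr// fineK//.
have rs : 0 < r ^+ 2 - s by rewrite subr_gt0.
pose a : R := (r ^+ 2 - s)^-1.
have a0 : 0 < a by rewrite invr_gt0.
(* It is 1 for t <= s and 0 for t >= r ^+ 2. *)
pose h (t : R) := sstep (- a * t + a * r ^+ 2).
pose dh (t : R) : R := - a * dsstep (- a * t + a * r ^+ 2).
have hdh t : is_derive t (1 : R) h (dh t).
  have d0 := is_deriveD (is_deriveZ (- a) (is_derive_id t (1 : R))) (is_derive_cst (a * r ^+ 2) t (1 : R)).
  have := @is_derive1_comp _ sstep _ t _ _ (is_derive_sstep (- a * t + a * r ^+ 2)) d0.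
  by move/is_derive_eq; apply; rewrite /dh /GRing.scale/=; ring.
have cdh : continuous dh.
  move=> t; exact: (cvgM (cvg_cst _) (@continuous_dsstep_affine R (- a) (a * r ^+ 2) t)).
pose w (x : 'rV[R]_n) := r^-1 * h (sqnorm x).
have wg := has_gradZ r^-1 (has_grad_comp hdh cdh (@has_grad_sqnorm R n)).
have w0 x : r ^+ 2 <= sqnorm x -> w x = 0.
  move=> xr; rewrite /w /h sstep_le0 ?mulr0// mulNr addrC -mulrBr.
  by rewrite pmulr_rle0// subr_le0.
pose phi (x : 'rV[R]_n) := w x *: x.
have phiC i : C1c setT (fun x => phi x ord0 i).
  apply: (@C1c_setT _ _ _ r).
    have -> : (fun x => phi x ord0 i) = (fun x => w x * x ord0 i).
      by apply/funext => x; rewrite mxE.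
    exact: has_grad_C1 (has_gradM wg (has_grad_coord i)).
  move=> x xr; rewrite mxE w0 ?mul0r//; rewrite leNgt; apply/negP => xr'.
  exact/xr/sball_cube/xr'/ltW.
have phi1 x : enorm (phi x) <= 1.
  rewrite enormZ; have [xr|xr] := leP (r ^+ 2) (sqnorm x); first by rewrite w0 ?normr0 ?mul0r.
  rewrite ger0_norm; last by rewrite mulr_ge0 ?invr_ge0 ?sstep_ge0// ltW.
  rewrite /w -mulrA mulrC ler_pdivrMr// ler_pM ?enorm_ge0 ?sstep_ge0 ?sstep_le1//.
  by rewrite -ler_sqr ?nnegrE ?enorm_ge0 ?(ltW r0)// sqr_enorm ltW.
have divE x : E x -> divergence phi x = n%:R / r.
  move=> Ex; have xs : sqnorm x <= s by apply: sE; exact: subset_closure.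
  have h1 : 1 <= - a * sqnorm x + a * r ^+ 2.
    by rewrite mulNr addrC -mulrBr /a mulrC ler_pdivlMr// mul1r lerD2l lerN2.
  have idC i : C1 (fun y : 'rV[R]_n => y ord0 i) := has_grad_C1 (has_grad_coord i).
  rewrite (divergence_mul x wg idC) /= big1 ?addr0; last first.
    move=> i _; rewrite /dh; move: h1; rewrite le_eqVlt => /predU1P[<-|h1].
      by rewrite (_ : dsstep 1 = 0) ?mulr0 ?mul0r ?mulr0// /dsstep !posx_pos; lra.
    by rewrite dsstep_out ?mulr0 ?mul0r ?mulr0// in_itv/= negb_and -!ltNge h1 orbT.
  rewrite /h sstep_ge1// mulr1 mulrC; congr (_ / _).
  rewrite /divergence (eq_bigr (fun=> 1)).
    by rewrite sumr_const card_ord.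
  by move=> i _; rewrite (has_grad_partial _ _ (has_grad_coord i)) eqxx.
apply: (@le_trans _ _ (\int[lebesgue_rV n]_(x in E) (divergence phi x)%:E)%E).
  rewrite (eq_integral (fun=> (n%:R / r)%:E)); last by move=> x; rewrite inE => /divE ->.
  by rewrite integral_cst.
by apply: ereal_sup_ubound; exists phi.
Qed.

Lemma bump_integrable n k : (lebesgue_rV n).-integrable setT (EFin \o @bump R n k.+1 1).
Proof.
apply: (@continuous_integrable _ _ _ 1); last exact: bump_vanish.
apply: (continuous_compR (g := fun t => posx k.+1 (1 ^+ 2 - t))).
  exact: continuous_sqnorm.
move=> t; apply: (@cvg_comp _ _ _ (fun t : R => 1 ^+ 2 - t) (posx k.+1) _ (nbhs (1 ^+ 2 - t))).
  by apply: cvgB; [exact: cvg_cst|exact: cvg_id].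
exact: continuous_posx.
Qed.

Definition bump_int n k : R := fine (\int[lebesgue_rV n]_x (@bump R n k 1 x)%:E)%E.

Lemma bump_intE n k : (\int[lebesgue_rV n]_x (@bump R n k.+1 1 x)%:E = (bump_int n k.+1)%:E)%E.
Proof. by rewrite fineK//; apply: integrable_fin_num => //; exact: bump_integrable. Qed.

Lemma bump_int_ge0 n k : 0 <= bump_int n k.
Proof. by apply: fine_ge0; apply: integral_ge0 => x _; rewrite lee_fin bump_ge0. Qed.

Lemma posxS k (s : R) : posx k.+2 s = s * posx k.+1 s.
Proof.
rewrite /posx exprS; have [s0|s0] := leP s 0; last by [].
by rewrite mul0r expr0n/= mulr0.
Qed.

(** The divergence of bump x is n bump - 2 (k+2) |x|^2 (1 - |x|^2)^(k+1), and
    |x|^2 = 1 - (1 - |x|^2); its integral vanishes. *)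
Lemma bump_int_step n k :
  2 * k.+2%:R * bump_int n k.+1 = (n%:R + 2 * k.+2%:R) * bump_int n k.+2.
Proof.
pose phi (x : 'rV[R]_n) := bump k.+2 1 x *: x.
have bg := has_grad_bump n k (1 : R).
have phiC i : C1c setT (fun x => phi x ord0 i).
  have -> : (fun x => phi x ord0 i) = (fun x => x ord0 i * bump k.+2 1 x).
    by apply/funext => x; rewrite mxE mulrC.
  apply: C1c_mul; first exact: has_grad_C1 (has_grad_coord i).
  by apply: (@C1c_setT _ _ _ 1); [exact: has_grad_C1 bg|exact: bump_vanish].
have idC i : C1 (fun y : 'rV[R]_n => y ord0 i) := has_grad_C1 (has_grad_coord i).
have divE x : divergence phi x = (n%:R + 2 * k.+2%:R) * bump k.+2 1 x - 2 * k.+2%:R * bump k.+1 1 x.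
  rewrite (divergence_mul x bg idC) /=.
  have -> : divergence (fun x : 'rV[R]_n => x) x = n%:R.
    rewrite /divergence (eq_bigr (fun=> 1)); first by rewrite sumr_const card_ord.
    by move=> i _; rewrite (has_grad_partial _ _ (has_grad_coord i)) eqxx.
  rewrite (eq_bigr (fun i => (- (2 * k.+2%:R * bump k.+1 1 x)) * x ord0 i ^+ 2)); last first.
    by move=> i _; ring.
  have bE : bump k.+2 1 x = (1 - sqnorm x) * bump k.+1 1 x by rewrite /bump posxS expr1n.
  rewrite -mulr_sumr -/(sqnorm x) bE; ring.
have := integral_divergence0 phiC.
rewrite (_ : (fun x => _) = (fun x => (n%:R + 2 * k.+2%:R)%:E * (bump k.+2 1 x)%:E -
    (2 * k.+2%:R)%:E * (bump k.+1 1 x)%:E)%E); last by apply/funext => x; rewrite divE.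
rewrite integralB//; last 2 first.
- by apply: integrableZl => //; exact: bump_integrable.
- by apply: integrableZl => //; exact: bump_integrable.
rewrite !integralZl//; try exact: bump_integrable.
by rewrite !bump_intE -!EFinM -EFinB => -[] /eqP; rewrite subr_eq0 => /eqP ->.
Qed.

Lemma bump_int_le n k K i : (k.+1 + i <= K)%N ->
  bump_int n k.+1 <= ((n%:R + 2 * K%:R) / (2 * k.+1%:R)) ^+ i * bump_int n (k.+1 + i).
Proof.
elim: i => [|i IH] kK; first by rewrite expr0 mul1r addn0.
apply: (le_trans (IH (ltnW _))); first by rewrite -addnS.
rewrite exprSr -mulrA; apply: ler_wpM2l.
  by rewrite exprn_ge0// divr_ge0// addr_ge0// mulr_ge0.
rewrite addnS addSn mulrAC ler_pdivlMr; last by rewrite mulr_gt0.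
apply: (@le_trans _ _ (2 * (k + i).+2%:R * bump_int n (k + i).+1)).
  rewrite mulrC ler_wpM2r ?bump_int_ge0// ler_wpM2l// ler_nat.
  by rewrite ltnS leqW// leq_addr.
rewrite bump_int_step ler_wpM2r ?bump_int_ge0// lerD2l ler_wpM2l// ler_nat.
by move: kK; rewrite addnS addSn.
Qed.

(** The test function (1 - |x|^2)^(j+2), supported in the closed unit ball, whence
    r > 1. For an integer exponent N, its powers are bumps again: the mass is the
    integral of the bump of order N (j+2) and, as |x| <= 1, the energy is at most
    (2 (j+2))^N times that of order N (j+1). N applications of the recursion compare
    the two. *)
Lemma lambda_sball_le n r (N j : nat) : 1 < r -> (0 < N)%N ->
  (lambda N%:R (@sball n r) <=
   ((j.+2%:R / j.+1%:R * ((n%:R + 2 * (N * j.+2)%:R) / N%:R)) ^+ N)%:E)%E.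
Proof.
move=> r1 N0; have NR : 0 < N%:R :> R by rewrite ltr0n.
have bg := has_grad_bump n j (1 : R).
have uc : C1c (@sball n r) (@bump R n j.+2 1).
  apply: (@C1cI _ _ _ [set x | sqnorm x <= 1]).
  - exact: has_grad_C1 bg.
  - apply: (subclosed_compact _ (@compact_cube R n r)).
      rewrite (_ : [set x | _] = sqnorm (n:=n) @^-1` [set t | t <= 1])//.
      by apply: closed_comp; [move=> x _; exact: continuous_sqnorm|exact: closed_le].
    move=> x /= x1; apply: sball_cube; first by rewrite ltW// (lt_trans ltr01).
    by rewrite /sball/= (le_lt_trans x1)// expr_gt1 ?ltW// (lt_trans ltr01).
  - by move=> x /= x1; rewrite /sball/= (le_lt_trans x1)// expr_gt1 ?ltW// (lt_trans ltr01).
  - by move=> x /negP; rewrite -ltNge => x1; rewrite bump_off// expr1n ltW.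
have u0 : @bump R n j.+2 1 0 != 0 by rewrite gt_eqF// bump_gt0// sqnorm0 exprn_gt0.
have M0 := mass_gt0 NR (C1cT uc) u0.
apply: (le_trans (lambda_le NR uc u0)); rewrite lee_fin ler_pdivrMr//.
have ME : mass N%:R (@bump R n j.+2 1) = bump_int n (N * j.+2).
  rewrite /mass /bump_int; congr fine; apply: eq_integral => x _; congr EFin.
  by rewrite powR_mulrn// ger0_norm ?bump_ge0// /bump /posx -exprM mulnC.
have N1 : (0 < N * j.+1)%N by rewrite muln_gt0 N0.
rewrite ME.
apply: (@le_trans _ _ ((2 * j.+2%:R) ^+ N * bump_int n (N * j.+1))).
  rewrite -lee_fin -(dirichletE NR (C1cT uc)) EFinM -(prednK N1) -bump_intE.
  rewrite -ge0_integralZl_EFin; last 4 first.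
  - exact: measurableT.
  - by move=> x _; rewrite lee_fin bump_ge0.
  - by have /integrableP[] := bump_integrable n (N * j.+1).-1.
  - by rewrite exprn_ge0// mulr_ge0.
  apply: ge0_le_integral => //.
  - by move=> x _; rewrite lee_fin powR_ge0.
  - by have /integrableP[] := dirichlet_integrable NR (C1cT uc).
  - by apply: measurable_funeM; have /integrableP[] := bump_integrable n (N * j.+1).-1.
  - move=> x _; rewrite -EFinM lee_fin powR_mulrn ?enorm_ge0// prednK//.
    have -> : bump (N * j.+1) 1 x = bump j.+1 1 x ^+ N by rewrite /bump /posx -exprM mulnC.
    rewrite -exprMn lerXn2r ?nnegrE ?enorm_ge0 ?mulr_ge0 ?bump_ge0//.
    have -> : grad (bump j.+2 1) x = (- (2 * j.+2%:R * bump j.+1 1 x)) *: x.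
      by apply/rowP => i; rewrite !mxE (has_grad_partial _ _ bg); ring.
    rewrite enormZ normrN ger0_norm ?mulr_ge0 ?bump_ge0//.
    have [x1|x1] := leP 1 (sqnorm x); first by rewrite bump_off ?expr1n// mulr0 mul0r.
    rewrite ler_piMr ?mulr_ge0 ?bump_ge0//.
    by rewrite -ler_sqr ?nnegrE ?enorm_ge0// sqr_enorm expr1n ltW.
have := @bump_int_le n (N * j.+1).-1 (N * j.+2) N; rewrite prednK// -mulnSr => /(_ (leqnn _)) H.
apply: (@le_trans _ _ ((2 * j.+2%:R) ^+ N * (((n%:R + 2 * (N * j.+2)%:R) / (2 * (N * j.+1)%:R)) ^+ N * bump_int n (N * j.+2)))).
  by rewrite ler_wpM2l// exprn_ge0// mulr_ge0.
rewrite mulrA -exprMn ler_wpM2r ?bump_int_ge0// le_eqVlt; apply/orP; left; apply/eqP; congr (_ ^+ _).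
rewrite !natrM; field; rewrite !gt_eqF//=; lra.
Qed.

End Ball.

(** * The roots lambda_p^(1/p) *)

HB.lock Definition proot (R : realType) (n : nat) (p : R) (W : set 'rV[R]_n) : R :=
  fine (lambda p W) `^ p^-1.

Section Roots.
Context {R : realType}.

Lemma proot_ge0 n (p : R) (W : set 'rV[R]_n) : 0 <= proot p W.
Proof. by rewrite proot.unlock powR_ge0. Qed.

Lemma A_all_ex n (W : set 'rV[R]_n) : A_all W -> exists x, W x.
Proof.
move=> [_ /andP[W0 _]]; apply/set0P/negP => /eqP W00.
by move: W0; rewrite W00 measure0 ltxx.
Qed.

Lemma lambda_fineK n (p : R) (W : set 'rV[R]_n) : 0 < p -> A_all W ->
  (fine (lambda p W))%:E = lambda p W.
Proof.
move=> p0 AW; have [x Wx] := A_all_ex AW; rewrite fineK// ge0_fin_numE ?lambda_ge0//.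
by apply: lambda_lty Wx p0; case: AW.
Qed.

Lemma fine_lambda_gt0 n (p : R) (W : set 'rV[R]_n) : (0 < n)%N -> 1 <= p -> A_all W ->
  0 < fine (lambda p W).
Proof.
move=> n0 p1 AW; rewrite -lte_fin lambda_fineK ?(lt_le_trans ltr01)//.
case: AW => oW /andP[_ Woo]; apply: lambda_gt0 => //; exact: open_measurable_rV.
Qed.

Lemma proot_gt0 n (p : R) (W : set 'rV[R]_n) : (0 < n)%N -> 1 <= p -> A_all W ->
  0 < proot p W.
Proof. by move=> n0 p1 AW; rewrite proot.unlock powR_gt0 ?fine_lambda_gt0. Qed.

Lemma lambda_rootE n (p : R) (W : set 'rV[R]_n) : (0 < n)%N -> 1 <= p -> A_all W ->
  lambda_root p%:E W = (proot p W)%:E.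
Proof.
move=> n0 p1 AW; rewrite proot.unlock -poweR_EFin lambda_fineK ?(lt_le_trans ltr01)//=.
by case: eqP => // ->; rewrite invr1 poweRe1 ?lambda_ge0// cheeger_lambda1//; case: AW.
Qed.

Lemma proot_le n (p z : R) (W : set 'rV[R]_n) : 1 <= p -> A_all W -> 0 <= z ->
  (lambda p W <= (z `^ p)%:E)%E -> proot p W <= z.
Proof.
move=> p1 AW z0; have p0 := lt_le_trans ltr01 p1.
rewrite -lambda_fineK// lee_fin => lz.
rewrite proot.unlock -[leRHS](powRr1 z0) -(mulfV (lt0r_neq0 p0)) powRrM.
by rewrite ge0_ler_powR ?nnegrE ?invr_ge0 ?(ltW p0) ?fine_ge0 ?lambda_ge0 ?powR_ge0.
Qed.

Lemma proot_ge n (p z : R) (W : set 'rV[R]_n) : 1 <= p -> A_all W -> 0 <= z ->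
  ((z `^ p)%:E <= lambda p W)%E -> z <= proot p W.
Proof.
move=> p1 AW z0; have p0 := lt_le_trans ltr01 p1.
rewrite -lambda_fineK// lee_fin => lz.
rewrite proot.unlock -[leLHS](powRr1 z0) -(mulfV (lt0r_neq0 p0)) powRrM.
by rewrite ge0_ler_powR ?nnegrE ?invr_ge0 ?(ltW p0) ?fine_ge0 ?lambda_ge0 ?powR_ge0.
Qed.

Lemma proot_powR n (p : R) (W : set 'rV[R]_n) : 1 <= p -> A_all W ->
  ((proot p W `^ p)%:E = lambda p W)%E.
Proof.
move=> p1 AW; have p0 := lt_le_trans ltr01 p1.
by rewrite proot.unlock -powRrM mulVf ?gt_eqF// powRr1 ?fine_ge0 ?lambda_ge0// lambda_fineK.
Qed.

Lemma proot_monotone n (p q : R) (W : set 'rV[R]_n) : 1 <= q -> q <= p -> A_all W ->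
  q * proot q W <= p * proot p W.
Proof.
move=> q1; rewrite le_eqVlt => /predU1P[->//|qp] AW.
have q0 := lt_le_trans ltr01 q1; have p0 := lt_trans q0 qp.
have p1 := le_trans q1 (ltW qp).
rewrite [leRHS]mulrC -ler_pdivrMr// mulrAC; apply: proot_ge => //.
  by rewrite mulr_ge0 ?proot_ge0// divr_ge0// ltW.
by rewrite proot.unlock; apply: lambda_monotone; rewrite ?fine_ge0 ?lambda_ge0// lambda_fineK.
Qed.

Lemma F_ratioE n (p q : R) (W : set 'rV[R]_n) : (0 < n)%N -> 1 <= p -> 1 <= q -> A_all W ->
  F_ratio p%:E q%:E W = (proot p W / proot q W)%:E.
Proof.
move=> n0 p1 q1 AW; rewrite /F_ratio !lambda_rootE//.
by rewrite inver gt_eqF ?proot_gt0.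
Qed.

Lemma F_ratio_ge n (p q : R) (W : set 'rV[R]_n) : (0 < n)%N -> 1 <= q -> q <= p -> A_all W ->
  ((q / p)%:E <= F_ratio p%:E q%:E W)%E.
Proof.
move=> n0 q1 qp AW; have q0 := lt_le_trans ltr01 q1; have p0 := lt_le_trans q0 qp.
have p1 := le_trans q1 qp.
rewrite F_ratioE// lee_fin ler_pdivlMr ?proot_gt0// mulrAC ler_pdivrMr//.
by rewrite [leRHS]mulrC proot_monotone.
Qed.

Lemma F_ratio_inftyE n (q rho : R) (W : set 'rV[R]_n) : (0 < n)%N -> 1 <= q -> A_all W ->
  0 < rho -> inradius W = rho%:E -> F_ratio +oo q%:E W = (rho^-1 / proot q W)%:E.
Proof.
move=> n0 q1 AW r0 irW; rewrite /F_ratio lambda_rootE// [lambda_root +oo W]/= irW.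
by rewrite !inver !gt_eqF ?proot_gt0.
Qed.

End Roots.

(** * Cylinders *)

Section Cylinder.
Context {R : realType}.
Local Notation mu := (@lebesgue_measure R).

Definition rV_tail n (w : 'rV[R]_n.+1) : 'rV[R]_n := \row_j w ord0 (lift ord0 j).

(** The margin 2 leaves room for a cut-off in the axial variable that equals 1 on
    [-N, N] and vanishes off [-N-1, N+1]. *)
Definition cylinder n (N : R) (W : set 'rV[R]_n) : set 'rV[R]_n.+1 :=
  [set w : 'rV[R]_n.+1 | `|w ord0 ord0| < N + 2 /\ W (rV_tail w)].

Lemma rV_tailK n (w : 'rV[R]_n.+1) : rV_cons (w ord0 ord0, rV_tail w) = w.
Proof. exact: rV_consK. Qed.

Lemma rV_tail_cons n (t : R) (v : 'rV[R]_n) : rV_tail (rV_cons (t, v)) = v.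
Proof. by apply/rowP => j; rewrite mxE rV_consS. Qed.

Lemma continuous_rV_tail n : continuous (@rV_tail n).
Proof.
apply: continuous_rV => j; under eq_fun do rewrite mxE.
exact: coord_continuous.
Qed.

Lemma cylinder_cons n N (W : set 'rV[R]_n) t v :
  cylinder N W (rV_cons (t, v)) <-> `|t| < N + 2 /\ W v.
Proof. by rewrite /cylinder/= rV_tail_cons rV_cons0. Qed.

Lemma open_cylinder n N (W : set 'rV[R]_n) : open W -> open (cylinder N W).
Proof.
move=> oW; apply: openI.
  apply: (@open_comp _ _ (fun w : 'rV[R]_n.+1 => `|w ord0 ord0|) [set t | t < N + 2]); last exact: open_lt.
  move=> w _; apply: (@cvg_comp _ _ _ (fun w : 'rV[R]_n.+1 => w ord0 ord0) Num.norm _ (nbhs (w ord0 ord0))).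
    exact: coord_continuous.
  exact: norm_continuous.
by apply: (@open_comp _ _ (@rV_tail n) W) => // w _; exact: continuous_rV_tail.
Qed.

Lemma cylinder_A_all n N (W : set 'rV[R]_n) : 0 < N -> A_all W -> A_all (cylinder N W).
Proof.
move=> N0 AW; have [x Wx] := A_all_ex AW; case: AW => oW /andP[_ Woo].
split; first exact: open_cylinder.
apply/andP; split.
  apply: (@lebesgue_rV_open_gt0 R n.+1 _ (rV_cons (0, x))); first exact: open_cylinder.
  by apply/cylinder_cons; rewrite normr0; split => //; rewrite addr_gt0.
have mW : measurable W by exact: open_measurable_rV.
pose S := [set t : R | `|t| < N + 2].
rewrite [X in (X < _)%E](_ : _ = ((mu \x^ lebesgue_rV n) (S `*` W))%E); last first.
  rewrite /= /lebesgue_rV_rec /pushforward; congr ((_ \x^ _)%E _).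
  by apply/seteqP; split => [[t v]|[t v]] /cylinder_cons.
have E : S = `](- (N + 2))%R, (N + 2)%R[%classic.
  by apply/seteqP; split => t; rewrite /S/= in_itv/= ltr_norml.
rewrite E (product_measure2E mu (lebesgue_rV n) _ mW)//= lebesgue_measure_itv/=.
case: ifP => _; last by rewrite mul0e.
by rewrite -EFinD lte_mul_pinfty// lee_fin; lra.
Qed.

Lemma C1c_slice n N (W : set 'rV[R]_n) U t : C1c (cylinder N W) U ->
  C1c W (fun v => U (rV_cons (t, v))).
Proof.
move=> [cU kU sU]; apply: (@C1cI _ _ _ (@rV_tail n @` supp U)).
- exact: C1_slice.
- apply: continuous_compact => //; apply: continuous_subspaceT; exact: continuous_rV_tail.
- by move=> _ [w /sU[_ Ww] <-].
- move=> v vK; apply: supp_off => sv; apply: vK; exists (rV_cons (t, v)) => //.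
  by rewrite rV_tail_cons.
Qed.

Lemma enorm_rV_tail n (w : 'rV[R]_n.+1) : enorm (rV_tail w) <= enorm w.
Proof.
rewrite /enorm ler_wsqrtr// big_ord_recl/=.
rewrite (eq_bigr (fun i : 'I_n => w ord0 (lift ord0 i) ^+ 2)); last by move=> i _; rewrite mxE.
by rewrite lerDr sqr_ge0.
Qed.

Lemma enorm_le_cons n (w : 'rV[R]_n.+1) : enorm w <= `|w ord0 ord0| + enorm (rV_tail w).
Proof.
rewrite -ler_sqr ?nnegrE ?addr_ge0 ?enorm_ge0// sqrrD !sqr_enorm.
rewrite /sqnorm big_ord_recl real_normK ?num_real//.
rewrite (eq_bigr (fun i : 'I_n => rV_tail w ord0 i ^+ 2)); last by move=> i _; rewrite mxE.
by rewrite -addrA lerD2l lerDr mulrn_wge0// mulr_ge0 ?enorm_ge0.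
Qed.

(** Each slice of a test function on the cylinder is a test function on W, with a
    gradient that is part of the full gradient. *)
Lemma lambda_cylinder_ge n N (W : set 'rV[R]_n) (q : R) : 1 <= q -> A_all W ->
  (lambda q W <= lambda q (cylinder N W))%E.
Proof.
move=> q1 AW; have q0 := lt_le_trans ltr01 q1.
rewrite -lambda_fineK//; set c := fine _.
have cW : (c%:E <= lambda q W)%E by rewrite lambda_fineK.
have c0 : 0 <= c by rewrite fine_ge0 ?lambda_ge0.
apply: lambda_ge => // U Uc _; have UT := C1cT Uc; have [cU _ _] := UT.
rewrite -lee_fin EFinM -massE// -dirichletE//.
have mm : measurable_fun setT (fun w => (`|U w| `^ q)%:E) by have /integrableP[] := mass_integrable q0 UT.
have md : measurable_fun setT (fun w => (enorm (grad U w) `^ q)%:E) by have /integrableP[] := dirichlet_integrable q0 UT.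
have mm0' w : (0 <= (`|U w| `^ q)%:E)%E by rewrite lee_fin powR_ge0.
have md0' w : (0 <= (enorm (grad U w) `^ q)%:E)%E by rewrite lee_fin powR_ge0.
rewrite (ge0_integral_rVS mm mm0') (ge0_integral_rVS md md0').
have mmc : measurable_fun setT (fun z : R * 'rV[R]_n => (`|U (rV_cons z)| `^ q)%:E).
  by apply: (measurableT_comp mm); exact: measurable_rV_cons.
have mdc : measurable_fun setT (fun z : R * 'rV[R]_n => (enorm (grad U (rV_cons z)) `^ q)%:E).
  by apply: (measurableT_comp md); exact: measurable_rV_cons.
have mm0 (z : R * 'rV[R]_n) : (0 <= (`|U (rV_cons z)| `^ q)%:E)%E by rewrite lee_fin powR_ge0.
have md0 (z : R * 'rV[R]_n) : (0 <= (enorm (grad U (rV_cons z)) `^ q)%:E)%E by rewrite lee_fin powR_ge0.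
have mF := @measurable_fun_fubini_tonelli_F _ _ _ _ _ (@leb R n) _ mmc mm0.
have mG := @measurable_fun_fubini_tonelli_F _ _ _ _ _ (@leb R n) _ mdc md0.
have mFi (t : R) : (0 <= \int[lebesgue_rV n]_v (`|U (rV_cons (t, v))| `^ q)%:E)%E.
  by apply: integral_ge0 => v _; exact: mm0'.
rewrite -ge0_integralZl_EFin; last 4 first.
- exact: measurableT.
- by move=> t _; exact: mFi.
- exact: mF.
- exact: c0.
apply: ge0_le_integral.
- exact: measurableT.
- by move=> t _; rewrite mule_ge0// lee_fin.
- exact: measurable_funeM mF.
- exact: mG.
- move=> t _; have uc := C1c_slice t Uc; have ucT := C1cT uc.
  have := lambda_mass_le q0 cW uc; rewrite -lee_fin EFinM -(massE q0 ucT) -(dirichletE q0 ucT).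
  move=> H; apply: (le_trans H).
  apply: ge0_le_integral => //.
  + by move=> v _; rewrite lee_fin powR_ge0.
  + by have /integrableP[] := dirichlet_integrable q0 (C1cT uc).
  + exact: (measurableT_comp mdc (pair1_measurable t)).
  + move=> v _; rewrite lee_fin ge0_ler_powR ?nnegrE ?enorm_ge0 ?(ltW q0)//.
    apply: le_trans (enorm_rV_tail _); rewrite le_eqVlt; apply/orP; left; apply/eqP; congr enorm.
    by apply/rowP => j; rewrite !mxE partial_slice.
Qed.

Lemma dsstep_le2 s : dsstep s <= 2 :> R.
Proof.
have [s0|] := boolP (s \in `[0, 1]); last by move/dsstep_out => ->.
move: s0; rewrite in_itv/= => /andP[s0 s1].
rewrite /dsstep (posx_pos _ s0) (posx_neg _ (_ : s - 1 <= 0)); last by rewrite subr_le0.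
have [s2|s2] := leP s 2^-1.
  by rewrite (posx_neg _ (_ : s - 2^-1 <= 0)) ?expr1; lra.
by rewrite (posx_pos _ (_ : 0 <= s - 2^-1)) ?expr1; lra.
Qed.

Lemma has_grad_tail n (u : 'rV[R]_n -> R) : C1 u ->
  has_grad (fun w : 'rV[R]_n.+1 => u (rV_tail w))
   (fun i w => if unlift ord0 i is Some j then partial j u (rV_tail w) else 0).
Proof.
move=> cu; split=> [i w|i]; last first.
  case: unliftP => [j _|_] x; last exact: cst_continuous.
  by apply: (continuous_comp_rV (@continuous_rV_tail n)); have [] := cu j.
case: unliftP => [j ->|->]; apply/is_derive_line.
  have /is_derive_line := C1_is_derive j (rV_tail w) cu.
  congr is_derive; apply/funext => t /=; congr u; apply/rowP => k; rewrite !mxE.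
  by rewrite (inj_eq lift_inj).
have -> : (fun t : R => u (rV_tail (t *: delta_mx ord0 ord0 + w))) = cst (u (rV_tail w)).
  by apply/funext => t /=; congr u; apply/rowP => k; rewrite !mxE/= mulr0 add0r.
exact: is_derive_cst.
Qed.

Lemma ge0_integral_tensor n (f : R -> R) (g : 'rV[R]_n -> R) :
  measurable_fun setT f -> measurable_fun setT g ->
  (forall t, 0 <= f t) -> (forall v, 0 <= g v) ->
  (\int[lebesgue_rV n.+1]_w (f (w ord0 ord0) * g (rV_tail w))%:E =
   (\int[mu]_t (f t)%:E) * \int[lebesgue_rV n]_v (g v)%:E)%E.
Proof.
move=> mf mg f0 g0.
have mgE : measurable_fun setT (EFin \o g) by exact/measurable_EFinP.
have mfE : measurable_fun setT (EFin \o f) by exact/measurable_EFinP.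
have mt : measurable_fun setT (@rV_tail n).
  by apply: measurable_fun_rVP => i; under eq_fun do rewrite mxE; exact: measurable_coord.
have mfg : measurable_fun setT (fun w : 'rV[R]_n.+1 => (f (w ord0 ord0) * g (rV_tail w))%:E).
  apply/measurable_EFinP; apply: measurable_funM; last exact: (measurableT_comp mg mt).
  exact: (measurableT_comp mf (measurable_coord ord0)).
rewrite ge0_integral_rVS//; last by move=> w; rewrite lee_fin mulr_ge0.
have gE0 v : setT v -> (0 <= (g v)%:E)%E by rewrite lee_fin.
have fE0 t : setT t -> (0 <= (f t)%:E)%E by rewrite lee_fin.
have G0 := integral_ge0 (lebesgue_rV n) gE0.
transitivity (\int[mu]_t ((f t)%:E * \int[lebesgue_rV n]_v (g v)%:E))%E; last first.
  by rewrite ge0_integralZr.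
apply: eq_integral => t _.
apply: (eq_trans _ (ge0_integralZl_EFin _ measurableT gE0 mgE (f0 t))).
by apply: eq_integral => v _; rewrite rV_cons0 rV_tail_cons EFinM.
Qed.

Lemma dsstep_ge1 s : 1 <= s -> dsstep s = 0 :> R.
Proof. by move=> s1; rewrite /dsstep !posx_pos; [lra|lra|lra|lra]. Qed.

Lemma dsstep_le0 s : s <= 0 -> dsstep s = 0 :> R.
Proof. by move=> s1; rewrite /dsstep !posx_neg; [lra|lra|lra|lra]. Qed.

Definition plateau (N t : R) : R := sstep (N + 1 - t) * sstep (N + 1 + t).

Definition dplateau (N t : R) : R :=
  sstep (N + 1 - t) * dsstep (N + 1 + t) - dsstep (N + 1 - t) * sstep (N + 1 + t).

Lemma is_derive_plateau N t : is_derive t (1 : R) (plateau N) (dplateau N t).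
Proof.
have d1 := is_deriveB (is_derive_cst (N + 1) t (1 : R)) (is_derive_id t (1 : R)).
have d2 := is_deriveD (is_derive_cst (N + 1) t (1 : R)) (is_derive_id t (1 : R)).
have e1 := @is_derive1_comp _ sstep _ t _ _ (is_derive_sstep (N + 1 - t)) d1.
have e2 := @is_derive1_comp _ sstep _ t _ _ (is_derive_sstep (N + 1 + t)) d2.
have := is_deriveM e1 e2; move/is_derive_eq; apply.
by rewrite /dplateau /GRing.scale/=; ring.
Qed.

Lemma continuous_dplateau N : continuous (dplateau N).
Proof.
have c1 : continuous (fun t : R => N + 1 - t).
  by move=> t; apply: cvgB; [exact: cvg_cst|exact: cvg_id].
have c2 : continuous (fun t : R => N + 1 + t).
  by move=> t; apply: cvgD; [exact: cvg_cst|exact: cvg_id].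
have cs : continuous (@sstep R) by move=> t; exact: is_derive_continuous (is_derive_sstep t).
have cc (f g : R -> R) : continuous f -> continuous g -> continuous (fun t => g (f t)).
  by move=> cf cg t; apply: (@cvg_comp _ _ _ f g _ (nbhs (f t))); [exact: cf|exact: cg].
move=> t; apply: cvgB; apply: cvgM.
- exact: (cc _ _ c1 cs).
- exact: (cc _ _ c2 (@continuous_dsstep R)).
- exact: (cc _ _ c1 (@continuous_dsstep R)).
- exact: (cc _ _ c2 cs).
Qed.

Lemma plateau_in N t : `|t| <= N -> plateau N t = 1 /\ dplateau N t = 0.
Proof.
rewrite ler_norml => /andP[t1 t2]; rewrite /plateau /dplateau.
have a1 : 1 <= N + 1 - t by lra.
have a2 : 1 <= N + 1 + t by lra.
by rewrite !sstep_ge1 ?dsstep_ge1//; split; ring.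
Qed.

Lemma plateau_out N t : N + 1 <= `|t| -> plateau N t = 0 /\ dplateau N t = 0.
Proof.
rewrite ler_normr => /orP[t1|t1]; rewrite /plateau /dplateau.
  have a1 : N + 1 - t <= 0 by lra.
  by rewrite (sstep_le0 a1) (dsstep_le0 a1); split; ring.
have a1 : N + 1 + t <= 0 by lra.
by rewrite (sstep_le0 a1) (dsstep_le0 a1); split; ring.
Qed.

Lemma plateau_ge0 N t : 0 <= plateau N t.
Proof. by rewrite mulr_ge0 ?sstep_ge0. Qed.

Lemma plateau_le1 N t : plateau N t <= 1.
Proof. by rewrite mulr_ile1 ?sstep_ge0 ?sstep_le1. Qed.

Lemma dplateau_le N t : `|dplateau N t| <= 4.
Proof.
have H (a b : R) : `|sstep a * dsstep b| <= 2.
  rewrite ger0_norm ?mulr_ge0 ?sstep_ge0 ?dsstep_ge0// -[leRHS]mul1r.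
  by rewrite ler_pM ?sstep_ge0 ?dsstep_ge0 ?sstep_le1 ?dsstep_le2.
apply: (le_trans (ler_normB _ _)).
by rewrite (mulrC (dsstep _)) (_ : 4 = 2 + 2 :> R) ?lerD//; ring.
Qed.

(** Multiply a near-optimal u by a plateau in the axial variable. Over [-N, N] the
    quotient is that of u, while the two transition layers contribute an energy that
    does not depend on N and is absorbed when N is large. *)
Lemma lambda_cylinder_le n (W : set 'rV[R]_n) (p z : R) : 1 <= p ->
  (lambda p W < z%:E)%E ->
  exists2 N, 0 < N & (lambda p (cylinder N W) <= z%:E)%E.
Proof.
move=> p1; have p0 := lt_le_trans ltr01 p1.
move=> /ereal_inf_lt[_ [u [uc [x ux]] <-]].
rewrite (rayleighE p0 uc ux) lte_fin.
have uT := C1cT uc; have M0 := mass_gt0 p0 uT ux.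
have [cu ku sW] := uc; have cuc := C1_continuous cu.
set M := mass p u in M0 *; set D := dirichlet p u; rewrite ltr_pdivrMr// => Dz.
pose h (v : 'rV[R]_n) := (enorm (grad u v) + 4 * `|u v|) `^ p.
have h0 v : 0 <= h v by exact: powR_ge0.
have inth : (lebesgue_rV n).-integrable setT (EFin \o h).
  have [r r0 ur] := C1c_vanish uT.
  apply: (@continuous_integrable _ _ _ r); last first.
    by move=> v vr; rewrite /h (grad_vanish ur vr) (ur _ vr) enorm0 normr0 mulr0 addr0 powR0// gt_eqF.
  rewrite (_ : h = fun v => `|enorm (grad u v) + 4 * `|u v| | `^ p); last first.
    by apply/funext => v; rewrite ger0_norm// addr_ge0 ?enorm_ge0// mulr_ge0.
  apply: (continuous_compR (g := fun t => `|t| `^ p)); last exact: abs_powR_continuous.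
  move=> v; apply: (@cvgD R _ 'rV[R]_n (nbhs v)); first exact: continuous_enorm_grad.
  apply: (@cvgM R 'rV[R]_n (nbhs v)); first exact: cvg_cst.
  exact: (continuous_compR cuc (@norm_continuous _ _)).
pose H := fine (\int[lebesgue_rV n]_v (h v)%:E)%E.
have HE : (\int[lebesgue_rV n]_v (h v)%:E = H%:E)%E by rewrite fineK//; exact: integrable_fin_num inth.
have H0 : 0 <= H by apply: fine_ge0; apply: integral_ge0 => v _; rewrite lee_fin.
have gap : 0 < z * M - D by rewrite subr_gt0.
(* Chosen so that N D + H <= z N M, where H is the cost of a transition layer. *)
pose N := H / (z * M - D) + 1.
have N0 : 0 < N by rewrite ltr_wpDl// divr_ge0// ltW.
exists N => //.
have NH : N * D + H <= z * (N * M).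
  have : H <= N * (z * M - D).
    by rewrite /N mulrDl mul1r mulfVK ?gt_eqF// lerDl ltW.
  by rewrite mulrBr mulrCA; lra.
pose U (w : 'rV[R]_n.+1) := plateau N (w ord0 ord0) * u (rV_tail w).
have Ug := has_gradM (has_grad_comp (is_derive_plateau N) (@continuous_dplateau N) (has_grad_coord ord0)) (has_grad_tail cu).
have Uc : C1c (cylinder N W) U.
  apply: (@C1cI _ _ _ (@rV_cons R n @` (`[- (N + 1), N + 1]%classic `*` supp u))).
  - exact: has_grad_C1 Ug.
  - apply: continuous_compact; last by apply: compact_setX => //; exact: segment_compact.
    by apply: continuous_subspaceT; exact: continuous_rV_cons.
  - move=> _ [[t v] [/= tN sv] <-]; apply/cylinder_cons; split; last exact: sW.
    by move: tN; rewrite in_itv/= -ler_norml => /le_lt_trans; apply; lra.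
  - move=> w wK; rewrite /U.
    have [wN|wN] := leP (N + 1) `|w ord0 ord0|.
      by have [-> _] := plateau_out wN; rewrite mul0r.
    rewrite supp_off ?mulr0// => sw; apply: wK; exists (w ord0 ord0, rV_tail w); last exact: rV_tailK.
    by split => //=; rewrite in_itv/= -ler_norml ltW.
have Ux : U (rV_cons (0, x)) != 0.
  rewrite /U rV_cons0 rV_tail_cons; have [|-> _] := @plateau_in N 0; first by rewrite normr0 ltW.
  by rewrite mul1r.
have UM := mass_gt0 p0 (C1cT Uc) Ux.
apply: (le_trans (lambda_le p0 Uc Ux)); rewrite lee_fin ler_pdivrMr//.
have z0 : 0 < z.
  have : 0 < z * M by apply: le_lt_trans Dz; exact: dirichlet_ge0.
  by rewrite pmulr_lgt0.
pose i1 : R -> R := \1_(`[- N, N]%classic).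
pose i2 : R -> R := fun t => \1_(`[- (N + 1), - N]%classic) t + \1_(`[N, N + 1]%classic) t.
have mi1 : measurable_fun setT i1 by exact: measurable_indic.
have mi2 : measurable_fun setT i2 by apply: measurable_funD; exact: measurable_indic.
have i10 t : 0 <= i1 t by rewrite /i1 indicE.
have i20 t : 0 <= i2 t by rewrite /i2 !indicE addr_ge0.
have I1 : (\int[mu]_t (i1 t)%:E = (2 * N)%:E)%E.
  rewrite /i1 integral_indic//= setIT lebesgue_measure_itv/= lte_fin ifT; last lra.
  by rewrite -EFinB; congr EFin; ring.
have I2 : (\int[mu]_t (i2 t)%:E = 2%:E)%E.
  under eq_integral do rewrite EFinD.
  rewrite ge0_integralD//; try by apply/measurable_EFinP; exact: measurable_indic.
  rewrite !integral_indic//= !setIT !lebesgue_measure_itv/= !lte_fin !ifT; [|lra|lra].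
  by rewrite -!EFinB -EFinD; congr EFin; ring.
pose m1 (v : 'rV[R]_n) : R := `|u v| `^ p.
pose d1 (v : 'rV[R]_n) : R := enorm (grad u v) `^ p.
have mm1 : measurable_fun setT m1 by apply/measurable_EFinP; have /integrableP[] := mass_integrable p0 uT.
have md1 : measurable_fun setT d1 by apply/measurable_EFinP; have /integrableP[] := dirichlet_integrable p0 uT.
have mh : measurable_fun setT h by apply/measurable_EFinP; have /integrableP[] := inth.
have m10 v : 0 <= m1 v by exact: powR_ge0.
have d10 v : 0 <= d1 v by exact: powR_ge0.
have mc0 := @measurable_coord R n.+1 ord0.
have mt : measurable_fun setT (@rV_tail n).
  by apply: measurable_fun_rVP => i; under eq_fun do rewrite mxE; exact: measurable_coord.
have mT (f : R -> R) (g : 'rV[R]_n -> R) : measurable_fun setT f -> measurable_fun setT g ->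
    measurable_fun setT (fun w : 'rV[R]_n.+1 => (f (w ord0 ord0) * g (rV_tail w))%:E).
  by move=> mf mg; apply/measurable_EFinP; apply: measurable_funM; [exact: (measurableT_comp mf mc0)|exact: (measurableT_comp mg mt)].
have massU : 2 * N * M <= mass p U.
  rewrite -lee_fin -(massE p0 (C1cT Uc)) EFinM -I1 /M -(massE p0 uT).
  rewrite -ge0_integral_tensor//.
  apply: ge0_le_integral => //.
  - by move=> w _; rewrite lee_fin mulr_ge0.
  - exact: (mT _ m1 mi1 mm1).
  - by have /integrableP[] := mass_integrable p0 (C1cT Uc).
  - move=> w _; rewrite lee_fin /i1 indicE mem_setE in_itv/= -ler_norml.
    have [wN|wN] := leP `|w ord0 ord0| N; last by rewrite mul0r powR_ge0.
    by rewrite mul1r /m1 /U; have [-> _] := plateau_in wN; rewrite mul1r.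
have dirU : dirichlet p U <= 2 * N * D + 2 * H.
  rewrite -lee_fin -(dirichletE p0 (C1cT Uc)) EFinD (EFinM (2 * N)) (EFinM 2 H) -I1 -I2 -HE /D -(dirichletE p0 uT).
  rewrite -!ge0_integral_tensor// -ge0_integralD//; last 4 first.
  - by move=> w _; rewrite lee_fin mulr_ge0 ?powR_ge0.
  - exact: (mT _ d1 mi1 md1).
  - by move=> w _; rewrite lee_fin mulr_ge0.
  - exact: (mT _ h mi2 mh).
  apply: ge0_le_integral => //.
  - by move=> w _; rewrite lee_fin powR_ge0.
  - by have /integrableP[] := dirichlet_integrable p0 (C1cT Uc).
  - by apply: emeasurable_funD; [exact: (mT _ d1 mi1 md1)|exact: (mT _ h mi2 mh)].
  - move=> w _; rewrite -EFinD lee_fin.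
    set t := w ord0 ord0; set v := rV_tail w.
    have gU : enorm (grad U w) <= plateau N t * enorm (grad u v) + `|dplateau N t| * `|u v|.
      apply: (le_trans (enorm_le_cons _)).
      rewrite mxE (has_grad_partial _ _ Ug) unlift_none eqxx mulr0 add0r mulr1 normrM addrC mulrC.
      rewrite (_ : rV_tail _ = plateau N t *: grad u v).
        by rewrite enormZ (ger0_norm (plateau_ge0 N t)) lexx.
      apply/rowP => j; rewrite !mxE (has_grad_partial _ _ Ug) liftK.
      by rewrite eq_sym (negbTE (neq_lift _ _)) !mulr0 addr0.
    have gp (a : R) : enorm (grad U w) <= a -> enorm (grad U w) `^ p <= a `^ p.
      by move=> ga; rewrite ge0_ler_powR ?nnegrE ?enorm_ge0 ?(ltW p0)// (le_trans (enorm_ge0 _) ga).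
    have [tN|tN] := leP `|t| N.
      apply: (@le_trans _ _ (1 * d1 v)).
        rewrite mul1r; apply: gp; apply: (le_trans gU).
        by have [-> ->] := plateau_in tN; rewrite normr0 mul0r mul1r addr0.
      rewrite /i1 indicE mem_setE in_itv/= -ler_norml tN lerDl mulr_ge0//.
    have [tN1|tN1] := leP (N + 1) `|t|.
      have := gp 0; rewrite powR0 ?gt_eqF// => H'; apply: (le_trans (H' _)).
        apply: (le_trans gU); have [-> ->] := plateau_out tN1.
        by rewrite normr0 !mul0r addr0.
      by apply: addr_ge0; apply: mulr_ge0 => //; exact: powR_ge0.
    apply: (@le_trans _ _ (1 * h v)).
      rewrite mul1r; apply: gp; apply: (le_trans gU); apply: lerD.
        by rewrite ler_piMl ?enorm_ge0// plateau_le1.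
      by rewrite ler_wpM2r// dplateau_le.
    apply: (@le_trans _ _ (i2 t * h v)); last by rewrite lerDr; apply: mulr_ge0 => //; exact: powR_ge0.
    rewrite ler_wpM2r// /i2 !indicE !mem_setE !in_itv/=.
    have [t0|t0] := leP 0 t.
      by rewrite ger0_norm// in tN tN1; rewrite (ltW tN) (ltW tN1) lerDr.
    rewrite ltr0_norm// in tN tN1.
    have -> : - (N + 1) <= t by lra.
    have -> : t <= - N by lra.
    by rewrite lerDl.
apply: (le_trans dirU); apply: (@le_trans _ _ (z * (2 * N * M))); last by rewrite ler_wpM2l// ltW.
by rewrite -!mulrA -mulrDr [leRHS]mulrCA ler_wpM2l.
Qed.

Lemma inradius_cylinder n (W : set 'rV[R]_n) (r N : R) x : 0 < r -> r <= N ->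
  eball x r `<=` W -> (r%:E <= inradius (cylinder N W))%E.
Proof.
move=> r0 rN xW; apply: ereal_sup_ubound; exists r => //; split => //.
exists (rV_cons (0, x)) => w; rewrite /eball/= => wr; split.
  have := le_lt_trans (ler_coord_enorm _ ord0) wr.
  rewrite mxE mxE rV_cons0 subr0 => /lt_le_trans; apply; lra.
apply: xW; rewrite /eball/=; apply: le_lt_trans wr.
apply: le_trans (enorm_rV_tail _); rewrite le_eqVlt; apply/orP; left; apply/eqP; congr enorm.
by apply/rowP => j; rewrite !mxE liftK.
Qed.

End Cylinder.

(** * Dimension one *)

Section OneDim.
Context {R : realType}.
Local Notation mu := (@lebesgue_measure R).

Definition pt (t : R) : 'rV[R]_1 := rV_cons (t, 0 : 'rV[R]_0).

Lemma ptE t : pt t ord0 ord0 = t.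
Proof. exact: rV_cons0. Qed.

Lemma rV1P (x y : 'rV[R]_1) : x ord0 ord0 = y ord0 ord0 -> x = y.
Proof. by move=> xy; apply/rowP => i; rewrite (ord1 i). Qed.

Lemma ptK (x : 'rV[R]_1) : pt (x ord0 ord0) = x.
Proof. by apply: rV1P; rewrite ptE. Qed.

Lemma continuous_pt : continuous pt.
Proof. exact: continuous_rV_consl. Qed.

Lemma enorm1 (x : 'rV[R]_1) : enorm x = `|x ord0 ord0|.
Proof. by rewrite /enorm big_ord1 sqrtr_sqr. Qed.

Lemma ge0_integral_rV1 (h : 'rV[R]_1 -> \bar R) : measurable_fun setT h ->
  (forall x, 0 <= h x)%E -> (\int[lebesgue_rV 1]_x h x = \int[mu]_t h (pt t))%E.
Proof.
move=> mh h0; rewrite (ge0_integral_rVS mh h0); apply: eq_integral => t _.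
exact: (ge0_integral_rV0 (fun v => h (rV_cons (t, v)))).
Qed.

Lemma mass1E p (u : 'rV[R]_1 -> R) : 0 < p -> C1c setT u ->
  (\int[mu]_t (`|u (pt t)| `^ p)%:E = (mass p u)%:E)%E.
Proof.
move=> p0 uc; rewrite -massE//.
rewrite (@ge0_integral_rV1 (fun x => (`|u x| `^ p)%:E))//.
by have /integrableP[] := mass_integrable p0 uc.
Qed.

Lemma dirichlet1E p (u : 'rV[R]_1 -> R) : 0 < p -> C1c setT u ->
  (\int[mu]_t (`|partial ord0 u (pt t)| `^ p)%:E = (dirichlet p u)%:E)%E.
Proof.
move=> p0 uc; rewrite -dirichletE//.
rewrite (@ge0_integral_rV1 (fun x => (enorm (grad u x) `^ p)%:E)).
- by apply: eq_integral => t _; rewrite enorm1 mxE.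
- by have /integrableP[] := dirichlet_integrable p0 uc.
- by move=> x; rewrite lee_fin powR_ge0.
Qed.

Lemma measurable_abs_powR_pt (p : R) (h : 'rV[R]_1 -> R) : 0 < p -> continuous h ->
  measurable_fun setT (fun t : R => (`|h (pt t)| `^ p)%:E).
Proof.
move=> p0 ch; apply/measurable_EFinP; apply: continuous_measurable_fun.
move=> t; apply: (@cvg_comp _ _ _ pt (fun x => `|h x| `^ p) _ (nbhs (pt t))).
  exact: continuous_pt.
by apply: (continuous_compR (g := fun t => `|t| `^ p)) => //; exact: abs_powR_continuous.
Qed.

(** Composing test functions with y -> a y + c divides masses by a and multiplies
    p-energies by a^(p-1). Only an inclusion between the sets is asked for, which
    covers scaling and domain monotonicity at once. *)
Lemma proot_scale (p a : R) c (V V' : set 'rV[R]_1) : 1 <= p -> 0 < a ->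
  A_all V -> A_all V' -> (forall y, V' (a *: y + c) -> V y) ->
  proot p V <= a * proot p V'.
Proof.
move=> p1 a0 AV AV' VV'; have p0 := lt_le_trans ltr01 p1.
have P0 := proot_ge0 p V.
rewrite mulrC -(ler_pdivrMr _ _ a0).
apply: (proot_ge p1 AV' (divr_ge0 P0 (ltW a0))).
apply: lambda_ge => // u uc _; have uT := C1cT uc.
have [cu ku sV'] := uc.
pose v (y : 'rV[R]_1) := u (a *: y + c).
have vg := has_grad_affine a c (C1_has_grad cu).
have vc : C1c V v.
  apply: (@C1cI _ _ _ ((fun x => a^-1 *: x + - (a^-1 *: c)) @` supp u)).
  - exact: has_grad_C1 vg.
  - apply: continuous_compact => //; apply: continuous_subspaceT.
    apply: continuous_rV => j; under eq_fun do rewrite !mxE.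
    move=> x; apply: (@cvgD R _ 'rV[R]_1 (nbhs x)); last exact: cst_continuous.
    by apply: (@cvgM R 'rV[R]_1 (nbhs x)); [exact: cst_continuous|exact: coord_continuous].
  - move=> _ [x sx <-]; apply: VV'; rewrite /= scalerDr scalerN !scalerA mulfV ?gt_eqF//.
    by rewrite !scale1r subrK; exact: sV'.
  - move=> y yK; apply: (@supp_off _ _ u) => sy; apply: yK; exists (a *: y + c) => //.
    by rewrite /= scalerDr scalerA mulVf ?gt_eqF// scale1r addrK.
have vT := C1cT vc.
have shift (t : R) : a *: pt t + c = pt (a * t + c ord0 ord0).
  by apply: rV1P; rewrite !mxE unlift_none.
have massv : mass p v = a^-1 * mass p u.
  apply: EFin_inj; rewrite -(mass1E p0 vT) EFinM -(mass1E p0 uT).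
  have mM := measurable_abs_powR_pt p0 (C1_continuous cu).
  have mM0 (t : R) : (0 <= (`|u (pt t)| `^ p)%:E)%E by rewrite lee_fin powR_ge0.
  rewrite -(@ge0_integral_affine _ a (c ord0 ord0) _ a0 mM mM0).
  by apply: eq_integral => t _; rewrite /v shift.
have dirv : dirichlet p v = a `^ p * (a^-1 * dirichlet p u).
  apply: EFin_inj; rewrite -(dirichlet1E p0 vT) 2!EFinM -(dirichlet1E p0 uT).
  have mD := measurable_abs_powR_pt p0 (proj2 (cu ord0)).
  have mD0 (t : R) : (0 <= (`|partial ord0 u (pt t)| `^ p)%:E)%E by rewrite lee_fin powR_ge0.
  rewrite -(@ge0_integral_affine _ a (c ord0 ord0) _ a0 mD mD0).
  rewrite -ge0_integralZl_EFin; last 4 first.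
  - exact: measurableT.
  - by move=> t _; exact: mD0.
  - apply: (measurableT_comp mD); apply: continuous_measurable_fun => t.
    by apply: cvgD; [apply: cvgM; [exact: cvg_cst|exact: cvg_id]|exact: cvg_cst].
  - exact: powR_ge0.
  apply: eq_integral => t _; rewrite (has_grad_partial _ _ vg) shift normrM powRM// gtr0_norm//.
have cl : ((proot p V `^ p)%:E <= lambda p V)%E by rewrite proot_powR.
have := lambda_mass_le p0 cl vc; rewrite massv dirv.
have ap : 0 < a `^ p by exact: powR_gt0.
rewrite mulrCA [leRHS]mulrCA ler_pM2l ?invr_gt0// => H.
rewrite -(ler_pM2r ap) mulrAC -powRM ?(ltW a0)//; last exact: divr_ge0 P0 (ltW a0).
by rewrite mulfVK ?gt_eqF// [leRHS]mulrC.
Qed.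

Definition itv1 (m r : R) : set 'rV[R]_1 := [set x | `|x ord0 ord0 - m| < r].

Lemma eball1 (x : 'rV[R]_1) r : eball x r = itv1 (x ord0 ord0) r.
Proof. by apply/seteqP; split=> y; rewrite /eball/itv1/= enorm1 !mxE. Qed.

Lemma unit_interval_itv1 : @unit_interval R = itv1 2^-1 2^-1.
Proof.
apply/seteqP; split=> x; rewrite /unit_interval /itv1/= ltr_norml; last by move=> /andP[? ?]; lra.
by move=> /andP[? ?]; lra.
Qed.

Lemma itv1_A_all m r : 0 < r -> A_all (itv1 m r).
Proof.
move=> r0.
have oI : open (itv1 m r).
  apply: (@open_comp _ _ (fun x : 'rV[R]_1 => `|x ord0 ord0 - m|) [set t | t < r]); last exact: open_lt.
  move=> x _; apply: (@cvg_comp _ _ _ (fun w : 'rV[R]_1 => w ord0 ord0 - m) Num.norm _ (nbhs (x ord0 ord0 - m))).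
    apply: (@cvgB R _ 'rV[R]_1 (nbhs x)); last exact: cst_continuous.
    exact: coord_continuous.
  exact: norm_continuous.
split => //; apply/andP; split.
  by apply: (@lebesgue_rV_open_gt0 R 1 _ (pt m)) => //; rewrite /itv1/= ptE subrr normr0.
apply: (@lebesgue_rV_bounded _ _ _ (`|m| + r)); last exact: open_measurable_rV.
move=> x xm i; rewrite (ord1 i) in_itv/= -ler_norml -[x ord0 ord0](subrK m) addrC.
by rewrite (le_trans (ler_normD _ _))// lerD2l ltW.
Qed.

Lemma proot_itv1_sub p m r (W : set 'rV[R]_1) : 1 <= p -> 0 < r -> A_all W ->
  itv1 m r `<=` W -> proot p W * (2 * r) <= proot p (@unit_interval R).
Proof.
move=> p1 r0 AW IW; have r20 : 0 < 2 * r by rewrite mulr_gt0.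
rewrite -ler_pdivlMr// mulrC.
apply: (@proot_scale p (2 * r)^-1 (pt (2^-1 - (2 * r)^-1 * m))) => //.
- by rewrite invr_gt0.
- by rewrite unit_interval_itv1; exact: itv1_A_all.
move=> y; rewrite unit_interval_itv1 /itv1/= !mxE unlift_none/= => H; apply: IW; rewrite /itv1/=.
move: H; rewrite (_ : _ - 2^-1 = (2 * r)^-1 * (y ord0 ord0 - m)); last by ring.
rewrite normrM gtr0_norm ?invr_gt0// mulrC ltr_pdivrMr// mulKf//.
Qed.

Lemma proot_itv1_ge p m r : 1 <= p -> 0 < r ->
  proot p (@unit_interval R) / (2 * r) <= proot p (itv1 m r).
Proof.
move=> p1 r0; have r20 : 0 < 2 * r by rewrite mulr_gt0.
rewrite ler_pdivrMr// mulrC.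
apply: (@proot_scale p (2 * r) (pt (m - r))) => //.
- by rewrite unit_interval_itv1; exact: itv1_A_all.
- exact: itv1_A_all.
move=> y; rewrite unit_interval_itv1 /itv1/= !mxE unlift_none/=.
rewrite (_ : _ - m = (2 * r) * (y ord0 ord0 - 2^-1)); last by field.
by rewrite normrM gtr0_norm// mulrC -ltr_pdivlMr// invfM mulrCA mulfV ?gt_eqF// mulr1.
Qed.

Lemma ball_pt (x : 'rV[R]_1) d b : `|x ord0 ord0 - b| < d -> ball x d (pt b).
Proof.
move=> xb; split=> [|i j]; first exact: le_lt_trans xb.
by rewrite (ord1 i) (ord1 j) ptE /ball/=.
Qed.

(** The end points of the interval lie outside W, so that the support of u stays
    away from them. Hence u times a cut-off equals u on the interval and 0 elsewhere,
    and is a test function on the interval. *)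
Lemma component_ineq (W : set 'rV[R]_1) (u : 'rV[R]_1 -> R) (p c m r : R) :
  1 <= p -> open W -> C1c W u -> 0 < r ->
  ~ W (pt (m - r)) -> ~ W (pt (m + r)) -> (c%:E <= lambda p (itv1 m r))%E ->
  (c%:E * \int[mu]_(t in [set t : R | (`|t - m| < r)%R]) (`|u (pt t)| `^ p)%:E <=
  \int[mu]_(t in [set t : R | (`|t - m| < r)%R]) (`|partial ord0 u (pt t)| `^ p)%:E)%E.
Proof.
move=> p1 oW uc r0 Wl Wr cI; set I := [set t | _].
have p0 := lt_le_trans ltr01 p1; have [cu ku sW] := uc.
have [d d0 dW] := compact_ball_sub ku oW sW.
(* A plateau rescaled so as to be 1 at distance at least d from both end points. *)
pose N := r / d - 1.
pose s (x : 'rV[R]_1) := d^-1 * x ord0 ord0 + - (d^-1 * m).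
have sE x : s x = (x ord0 ord0 - m) / d by rewrite /s -mulrBr mulrC.
have sg := has_gradD (has_gradZ d^-1 (has_grad_coord (ord0 : 'I_1))) (has_grad_cst 1 (- (d^-1 * m))).
have vg := has_gradM (has_grad_comp (is_derive_plateau N) (@continuous_dplateau R N) sg) (C1_has_grad cu).
pose v x := plateau N (s x) * u x.
have sabs x : `|s x| = `|x ord0 ord0 - m| / d by rewrite sE normrM normfV (gtr0_norm d0).
have s_in x : supp u x -> I (x ord0 ord0) -> `|x ord0 ord0 - m| <= r - d.
  move=> sx; rewrite /I/= ltr_distl => /andP[xl xr].
  rewrite ler_distl; apply/andP; split; rewrite leNgt; apply/negP => H.
    by apply/Wl/(dW _ sx)/ball_pt; rewrite gtr0_norm; lra.
  by apply/Wr/(dW _ sx)/ball_pt; rewrite ltr0_norm; lra.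
have inN (x : 'rV[R]_1) : `|x ord0 ord0 - m| <= r - d -> `|s x| <= N.
  by move=> xr; rewrite sabs ler_pdivrMr// /N mulrBl mulfVK ?gt_eqF// mul1r.
have outN (x : 'rV[R]_1) : ~ I (x ord0 ord0) -> N + 1 <= `|s x|.
  by move=> /negP; rewrite -leNgt => xr; rewrite sabs ler_pdivlMr// /N subrK mulfVK ?gt_eqF.
have vI x : v x = if x ord0 ord0 \in I then u x else 0.
  rewrite /v; case: ifPn => [|/negP]; rewrite inE => xI; last first.
    by have [-> _] := plateau_out (outN _ xI); rewrite mul0r.
  have [sx|sx] := pselect (supp u x); last by rewrite (supp_off sx) mulr0.
  by have [-> _] := plateau_in (inN _ (s_in _ sx xI)); rewrite mul1r.
have dvI x : partial ord0 v x = if x ord0 ord0 \in I then partial ord0 u x else 0.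
  rewrite (has_grad_partial _ _ vg) -/(s x).
  case: ifPn => [|/negP]; rewrite inE => xI; last first.
    by have [-> ->] := plateau_out (outN _ xI); rewrite !mul0r mulr0 addr0.
  have [sx|sx] := pselect (supp u x); last first.
    by rewrite (supp_off sx) (partial_off_supp _ sx) mulr0 mul0r addr0.
  by have [-> ->] := plateau_in (inN _ (s_in _ sx xI)); rewrite mul1r mul0r mulr0 addr0.
have vc : C1c (itv1 m r) v.
  apply: (@C1cI _ _ _ (supp u `&` [set x | `|s x| <= N])).
  - exact: has_grad_C1 vg.
  - apply: compact_closedI => //.
    apply: (@closed_comp _ _ (fun x => `|s x|) [set t | t <= N]); last exact: closed_le.
    move=> x _; apply: (@cvg_comp _ _ _ s Num.norm _ (nbhs (s x))).
      by have /(_ x) := has_grad_continuous sg.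
    exact: norm_continuous.
  - move=> x [_ /=]; rewrite sabs ler_pdivrMr// /N mulrBl mulfVK ?gt_eqF// mul1r /itv1/=.
    by move=> /le_lt_trans; apply; rewrite ltrBlDr ltrDl.
  - move=> x xK; rewrite vI; case: ifPn => //; rewrite inE => xI.
    apply: contrapT => /eqP ux; apply: xK.
    have sx : supp u x by apply: subset_closure.
    by split => //; exact/inN/s_in.
have := lambda_mass_le p0 cI vc.
rewrite -lee_fin EFinM -(mass1E p0 (C1cT vc)) -(dirichlet1E p0 (C1cT vc)).
have ptch (h k : R -> R) : (forall t, h t = if t \in I then k t else 0) ->
    (\int[mu]_t (`|h t| `^ p)%:E = \int[mu]_(t in I) (`|k t| `^ p)%:E)%E.
  move=> hk; rewrite [RHS]integral_mkcond; apply: eq_integral => t _.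
  rewrite patchE hk; case: ifP => //.
  by rewrite normr0 powR0// gt_eqF.
rewrite (ptch _ (fun t => u (pt t))); last by move=> t; rewrite vI ptE.
by rewrite (ptch _ (fun t => partial ord0 u (pt t)))// => t; rewrite dvI ptE.
Qed.

(** An end point in the union would belong to one of the open sets, which would then
    meet J i near that point, hence be J i itself, to which the point does not
    belong. *)
Lemma open_itv_disjoint_ends (J : nat -> set R) (i : nat) (a b : R) :
  (forall k, open (J k)) -> trivIset setT J -> J i = `]a, b[%classic -> a < b ->
  ~ (\bigcup_k J k) a /\ ~ (\bigcup_k J k) b.
Proof.
move=> oJ tJ Ji ab; split => -[k _ Jk].
- have /nbhs_ballP[e /= e0 eJ] : nbhs a (J k) by apply: open_nbhs_nbhs; split.
  pose t := a + Num.min (e / 2) ((b - a) / 2).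
  have t0 : 0 < Num.min (e / 2) ((b - a) / 2) by rewrite lt_min !divr_gt0 ?subr_gt0.
  have t1 : Num.min (e / 2) ((b - a) / 2) <= e / 2 by rewrite ge_min lexx.
  have t2 : Num.min (e / 2) ((b - a) / 2) <= (b - a) / 2 by rewrite ge_min lexx orbT.
  have Jkt : J k t by apply: eJ; rewrite /ball/= /t opprD addNKr normrN gtr0_norm//; lra.
  have Jit : J i t by rewrite Ji/= in_itv/= /t; apply/andP; split; lra.
  have ki : k = i by apply: (tJ k i) => //; exists t.
  by move: Jk; rewrite ki Ji/= in_itv/= ltxx.
- have /nbhs_ballP[e /= e0 eJ] : nbhs b (J k) by apply: open_nbhs_nbhs; split.
  pose t := b - Num.min (e / 2) ((b - a) / 2).
  have t0 : 0 < Num.min (e / 2) ((b - a) / 2) by rewrite lt_min !divr_gt0 ?subr_gt0.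
  have t1 : Num.min (e / 2) ((b - a) / 2) <= e / 2 by rewrite ge_min lexx.
  have t2 : Num.min (e / 2) ((b - a) / 2) <= (b - a) / 2 by rewrite ge_min lexx orbT.
  have Jkt : J k t by apply: eJ; rewrite /ball/= /t opprB addrC subrK gtr0_norm//; lra.
  have Jit : J i t by rewrite Ji/= in_itv/= /t; apply/andP; split; lra.
  have ki : k = i by apply: (tJ k i) => //; exists t.
  by move: Jk; rewrite ki Ji/= in_itv/= ltxx andbF.
Qed.

Lemma bounded_open_interval (J : set R) (rho : R) : open J -> is_interval J ->
  (forall x y, J x -> J y -> x < y -> y - x <= rho) -> J !=set0 ->
  exists a b, a < b /\ J = `]a, b[%classic.
Proof.
move=> oJ iJ Jr [x0 Jx0].
have rho_ge y : J y -> `|y - x0| <= `|rho|.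
  move=> Jy; have [yx|xy|->] := ltgtP y x0.
  - by rewrite ltr0_norm ?subr_lt0// opprB (le_trans (Jr _ _ Jy Jx0 yx))// ler_norm.
  - by rewrite gtr0_norm ?subr_gt0// (le_trans (Jr _ _ Jx0 Jy xy))// ler_norm.
  - by rewrite subrr normr0.
have JE : J = `]inf J, sup J[%classic.
  have lJ : has_lbound J by exists (x0 - `|rho|) => y /rho_ge; rewrite ler_distl => /andP[].
  have uJ : has_ubound J by exists (x0 + `|rho|) => y /rho_ge; rewrite ler_distl => /andP[].
  have := interval_bounded_interior iJ lJ uJ.
  rewrite (_ : J° = J); last by apply/interior_id.
  move=> JE; rewrite [LHS]JE.
  by apply/seteqP; split=> t; rewrite /= in_itv.
exists (inf J), (sup J); split => //.
have : (`]inf J, sup J[%classic : set R) x0 by rewrite -JE.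
by rewrite /= in_itv/= => /andP[]; exact: lt_trans.
Qed.

(** The inequality on each component, whose half-length is at most rho, summed over
    the components. *)
Lemma proot_1d_ge (W : set 'rV[R]_1) p rho : 1 <= p -> A_all W -> 0 < rho ->
  (forall m r, 0 < r -> itv1 m r `<=` W -> r <= rho) ->
  proot p (@unit_interval R) / (2 * rho) <= proot p W.
Proof.
move=> p1 AW rho0 Wrho; have p0 := lt_le_trans ltr01 p1.
have [oW _] := AW.
set P := proot p _.
have P0 : 0 <= P by exact: proot_ge0.
have q0 : 0 <= P / (2 * rho) by rewrite divr_ge0// mulr_ge0// ltW.
apply: (proot_ge p1 AW q0); set c := _ `^ p.
have c0 : 0 <= c by exact: powR_ge0.
apply: lambda_ge => // u uc _; have uT := C1cT uc; have [cu ku sW] := uc.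
rewrite -lee_fin EFinM -(mass1E p0 uT) -(dirichlet1E p0 uT).
pose W1 : set R := pt @^-1` W.
have oW1 : open W1 by apply: open_comp => // t _; exact: continuous_pt.
pose J := open_disjoint_itv oW1.
have WJ : W1 = \bigcup_k J k := @open_disjoint_itv_bigcup R W1 oW1.
have tJ : trivIset setT J := @open_disjoint_itv_trivIset R W1 oW1.
have oJ k : open (J k) := @open_disjoint_itv_open R W1 oW1 k.
have iJ k : is_interval (J k) := @open_disjoint_itv_is_interval R W1 oW1 k.
have JW k t : J k t -> W (pt t).
  by move=> Jt; have : W1 t by rewrite WJ; exists k.
have mJ k : measurable (J k) by exact: open_measurable.
have offW (h : 'rV[R]_1 -> R) : (forall x, ~ supp u x -> h x = 0) ->
    (\int[mu]_t (`|h (pt t)| `^ p)%:E = \int[mu]_(t in \bigcup_k J k) (`|h (pt t)| `^ p)%:E)%E.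
  move=> hu; rewrite -WJ [RHS]integral_mkcond; apply: eq_integral => t _.
  rewrite patchE; case: ifPn => // /negP; rewrite inE => tW.
  rewrite hu ?normr0 ?powR0 ?gt_eqF//.
  by move=> /sW.
rewrite (offW u); last by move=> x; exact: supp_off.
rewrite (offW (partial ord0 u)); last by move=> x; exact: partial_off_supp.
have big (h : 'rV[R]_1 -> R) : continuous h ->
    (\int[mu]_(t in \bigcup_k J k) (`|h (pt t)| `^ p)%:E =
     \sum_(k <oo) \int[mu]_(t in J k) (`|h (pt t)| `^ p)%:E)%E.
  move=> ch; apply: ge0_integral_bigcup => //.
  by apply: measurable_funTS; exact: measurable_abs_powR_pt.
rewrite !big; [|by have [] := cu ord0|exact: C1_continuous cu].
rewrite -nneseriesZl; last by move=> k _; apply: integral_ge0 => t _; rewrite lee_fin powR_ge0.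
apply: lee_nneseries => k.
  by move=> _ _; rewrite mule_ge0 ?lee_fin//; apply: integral_ge0 => t _; rewrite lee_fin powR_ge0.
move=> _; have [->|J0] := eqVneq (J k) set0; first by rewrite !integral_set0 mule0.
have [||a [b [ab Jab]]] := @bounded_open_interval (J k) (2 * rho) (oJ k) (iJ k).
- move=> x y Jx Jy xy; rewrite mulrC -ler_pdivrMr//.
  apply: (Wrho ((x + y) / 2)); first by rewrite divr_gt0// subr_gt0.
  move=> z; rewrite /itv1/= ltr_distl => /andP[z1 z2]; rewrite -(ptK z).
  by apply: (JW k); apply: (iJ k x y) => //; apply/andP; split; lra.
- exact/set0P.
have [Wa Wb] := open_itv_disjoint_ends oJ tJ Jab ab.
pose m := (a + b) / 2; pose r := (b - a) / 2.
have r0 : 0 < r by rewrite divr_gt0// subr_gt0.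
have JE : J k = [set t : R | `|t - m| < r].
  by rewrite Jab; apply/seteqP; split=> t; rewrite /= in_itv/= ltr_distl /m /r => /andP[t1 t2]; apply/andP; split; lra.
rewrite JE; apply: (component_ineq p1 oW uc r0).
- by rewrite (_ : m - r = a); [rewrite -WJ in Wa|rewrite /m /r; field].
- by rewrite (_ : m + r = b); [rewrite -WJ in Wb|rewrite /m /r; field].
have rrho : r <= rho.
  by apply: (Wrho m r r0) => z Iz; rewrite -(ptK z); apply: (JW k); rewrite JE.
have Pr : P / (2 * rho) <= proot p (itv1 m r).
  apply: le_trans (proot_itv1_ge m p1 r0).
  apply: ler_wpM2l; first exact: P0.
  have r2 : 2 * r <= 2 * rho by rewrite ler_pM2l.
  have r20 : 0 < 2 * r by exact: mulr_gt0.
  by rewrite lef_pV2 ?posrE// (lt_le_trans r20).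
rewrite -(proot_powR p1 (itv1_A_all m r0)) lee_fin.
apply: ge0_ler_powR; [exact: ltW|by rewrite nnegrE|by rewrite nnegrE proot_ge0|exact: Pr].
Qed.

(** The largest intervals contained in W bound the root from above by inclusion, and
    [proot_1d_ge] bounds it from below. Finiteness of the inradius follows from the
    upper bound, as the root is positive. *)
Lemma inradius_1d (W : set 'rV[R]_1) : A_all W ->
  exists2 rho, 0 < rho & inradius W = rho%:E /\
    forall p, 1 <= p -> proot p W = proot p (@unit_interval R) / (2 * rho).
Proof.
move=> AW; have [x Wx] := A_all_ex AW; have [oW _] := AW.
have AU : A_all (@unit_interval R) by rewrite unit_interval_itv1; exact: itv1_A_all.
pose S := [set r : R | 0 < r /\ exists m, itv1 m r `<=` W].
have bound p r : 1 <= p -> S r -> r <= proot p (@unit_interval R) / (2 * proot p W).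
  move=> p1 [r0 [m IW]]; have := proot_itv1_sub p1 r0 AW IW.
  have pW := proot_gt0 (ltn0Sn 0) p1 AW.
  have pW2 : 0 < 2 * proot p W by exact: mulr_gt0.
  rewrite (ler_pdivlMr _ _ pW2); set a := proot p W; set b := proot p _.
  by rewrite (_ : r * (2 * a) = a * (2 * r)); last by ring.
have [e Se] : S !=set0.
  have [rho rho0 rW] := @compact_ball_sub R 1 [set x] W (@compact_set1 _ x) oW (fun y yx => eq_ind_r W Wx yx).
  exists rho; split => //; exists (x ord0 ord0) => y; rewrite /itv1/= distrC => yx.
  by rewrite -(ptK y); apply: (rW x erefl); exact: ball_pt.
have hS : has_sup S.
  by split; [exists e|exists (proot 1 (@unit_interval R) / (2 * proot 1 W)) => r; exact: bound].
have e0 : 0 < e by case: Se.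
have rho0 : 0 < sup S by apply: (lt_le_trans e0); exact: ub_le_sup (proj2 hS) _ Se.
exists (sup S) => //; split.
  apply/eqP; rewrite eq_le; apply/andP; split.
    apply: ge_ereal_sup => _ [r [r0 [y yW]] <-]; rewrite lee_fin.
    apply: (ub_le_sup (proj2 hS)); split => //; exists (y ord0 ord0).
    by rewrite -eball1.
  apply/lee_addgt0Pr => d d0; have [r Sr rd] := sup_adherent d0 hS.
  apply: (@le_trans _ _ (r + d)%:E); first by rewrite lee_fin ltW// -ltrBlDr.
  rewrite EFinD leeD2r//; apply: ereal_sup_ubound; exists r => //.
  by case: Sr => r0 [m mW]; split => //; exists (pt m); rewrite eball1 ptE.
move=> p p1; apply/eqP; rewrite eq_le; apply/andP; split.
  have H : sup S <= proot p (@unit_interval R) / (2 * proot p W).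
    by apply: ge_sup; [exists e|move=> r; exact: bound].
  have pW := proot_gt0 (ltn0Sn 0) p1 AW.
  have pW2 : 0 < 2 * proot p W by exact: mulr_gt0.
  have s2 : 0 < 2 * sup S by exact: mulr_gt0.
  move: H; rewrite (ler_pdivlMr _ _ pW2) (ler_pdivlMr _ _ s2).
  by rewrite (_ : sup S * _ = proot p W * (2 * sup S)); last by ring.
apply: (proot_1d_ge p1 AW rho0) => m r r0 IW.
by apply: (ub_le_sup (proj2 hS)); split => //; exists m.
Qed.

Lemma F_ratio_1d (W : set 'rV[R]_1) (p q : R) : A_all W -> 1 <= q -> q <= p ->
  F_ratio p%:E q%:E W = (proot p (@unit_interval R) / proot q (@unit_interval R))%:E.
Proof.
move=> AW q1 qp; have p1 := le_trans q1 qp.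
have AU : A_all (@unit_interval R) by rewrite unit_interval_itv1; exact: itv1_A_all.
have [rho rho0 [irW WE]] := inradius_1d AW.
rewrite (F_ratioE (ltn0Sn 0) p1 q1 AW) (WE p p1) (WE q q1); congr EFin.
have := proot_gt0 (ltn0Sn 0) q1 AU; move: (proot q _) => b b0.
by field; rewrite !gt_eqF.
Qed.

Lemma F_ratio_infty_1d (W : set 'rV[R]_1) (q : R) : A_all W -> 1 <= q ->
  F_ratio +oo q%:E W = (2 / proot q (@unit_interval R))%:E.
Proof.
move=> AW q1.
have AU : A_all (@unit_interval R) by rewrite unit_interval_itv1; exact: itv1_A_all.
have [rho rho0 [irW WE]] := inradius_1d AW.
rewrite (F_ratio_inftyE (ltn0Sn 0) q1 AW rho0 irW) (WE q q1); congr EFin.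
have := proot_gt0 (ltn0Sn 0) q1 AU; move: (proot q _) => b b0.
by field; rewrite !gt_eqF.
Qed.

End OneDim.

(** * Dependence on the dimension *)

Section Dimension.
Context {R : realType}.

Lemma inradius_gt0 n (W : set 'rV[R]_n) : A_all W ->
  exists2 r, 0 < r & (r%:E <= inradius W)%E.
Proof.
move=> AW; have [x Wx] := A_all_ex AW; have [oW _] := AW.
have [r r0 rW] := @compact_ball_sub R n [set x] W (@compact_set1 _ x) oW (fun y yx => eq_ind_r W Wx yx).
exists r => //; apply: ereal_sup_ubound; exists r => //; split => //; exists x => y yx.
apply: (rW x erefl); split => // i j; rewrite (ord1 i) /ball/= distrC.
by apply: le_lt_trans yx; have := ler_coord_enorm (y - x) j; rewrite !mxE.
Qed.

Lemma F_ratio_infty_case n (q : R) (W : set 'rV[R]_n) : (0 < n)%N -> 1 <= q -> A_all W ->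
  (exists rho, [/\ 0 < rho, inradius W = rho%:E & F_ratio +oo q%:E W = (rho^-1 / proot q W)%:E]) \/
  (inradius W = +oo /\ F_ratio +oo q%:E W = 0)%E.
Proof.
move=> n0 q1 AW; have [r r0] := inradius_gt0 AW.
case E : (inradius W) => [rho| |] // rW.
- left; exists rho; rewrite lee_fin in rW; have rho0 := lt_le_trans r0 rW.
  by rewrite (F_ratio_inftyE n0 q1 AW rho0 E).
- by right; rewrite /F_ratio /lambda_root E mul0e.
Qed.

Lemma F_ratio_infty_ge0 n (q : R) (W : set 'rV[R]_n) : (0 < n)%N -> 1 <= q -> A_all W ->
  (0 <= F_ratio +oo q%:E W)%E.
Proof.
move=> n0 q1 AW; have [[rho [rho0 _ ->]]|[_ ->]] := F_ratio_infty_case n0 q1 AW => //.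
by rewrite lee_fin divr_ge0 ?invr_ge0 ?proot_ge0// ltW.
Qed.

Lemma F_ratio_infty_le n (q r : R) (W : set 'rV[R]_n) : (0 < n)%N -> 1 <= q -> A_all W ->
  0 < r -> (r%:E <= inradius W)%E -> (F_ratio +oo q%:E W <= (r^-1 / proot q W)%:E)%E.
Proof.
move=> n0 q1 AW r0 rW; have Q0 := proot_gt0 n0 q1 AW.
have [[rho [rho0 irW ->]]|[_ ->]] := F_ratio_infty_case n0 q1 AW; last first.
  by rewrite lee_fin divr_ge0 ?invr_ge0 ?(ltW Q0) ?(ltW r0).
move: rW; rewrite irW !lee_fin => rrho.
by rewrite ler_pM2r ?invr_gt0// lef_pV2.
Qed.

Lemma proot_cylinder_ge n N (W : set 'rV[R]_n) (q : R) : 1 <= q -> 0 < N -> A_all W ->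
  proot q W <= proot q (cylinder N W).
Proof.
move=> q1 N0 AW; apply: (proot_ge q1 (cylinder_A_all N0 AW) (proot_ge0 _ _)).
by rewrite (proot_powR q1 AW); exact: lambda_cylinder_ge.
Qed.

(** Competitors in dimension n + 1 are long cylinders over a competitor W. For
    p = +oo, a cylinder of half-length at least r over W contains the ball of radius r
    about (0, x) as soon as W contains the one about x. *)
Lemma m_inf_succ n (p : \bar R) (q : R) : (0 < n)%N -> 1 <= q -> (q%:E < p)%E ->
  (m_inf n.+1 p q%:E <= m_inf n p q%:E)%E.
Proof.
move=> n0 q1 qp; apply: le_ereal_inf_tmp => _ [W AW <-].
have Q0 := proot_gt0 n0 q1 AW.
have cyl N : 0 < N -> (m_inf n.+1 p q%:E <= F_ratio p q%:E (cylinder N W))%E.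
  by move=> N0; apply: ereal_inf_lbound; exists (cylinder N W) => //; exact: cylinder_A_all.
have ratio_le (z y : R) N : 0 < N -> 0 <= y -> z <= y * proot q W ->
    z / proot q (cylinder N W) <= y.
  move=> N0 y0 zy; rewrite ler_pdivrMr; last exact: (proot_gt0 (ltn0Sn n) q1 (cylinder_A_all N0 AW)).
  by apply: (le_trans zy); apply: ler_wpM2l => //; exact: proot_cylinder_ge.
case: p qp cyl => [p| |] qp cyl; last by exfalso; move: qp; rewrite ltNge leNye.
- rewrite lte_fin in qp; have p1 := le_trans q1 (ltW qp).
  have p0 := lt_le_trans ltr01 p1.
  rewrite (F_ratioE n0 p1 q1 AW); apply/lee_addgt0Pr => e e0.
  set y := proot p W / proot q W + e.
  have yQ : proot p W < y * proot q W.
    by rewrite /y mulrDl divfK ?gt_eqF// ltrDl mulr_gt0.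
  have yQ0 : 0 <= y * proot q W by apply: le_trans (ltW yQ); exact: proot_ge0.
  have y0 : 0 <= y by rewrite -(pmulr_lge0 _ Q0).
  have [|N N0 lN] := @lambda_cylinder_le _ _ W p ((y * proot q W) `^ p) p1.
    rewrite -(proot_powR p1 AW) lte_fin; apply: gt0_ltr_powR => //.
    by rewrite nnegrE proot_ge0.
  have AC := cylinder_A_all N0 AW.
  apply: (le_trans (cyl N N0)); rewrite (F_ratioE (ltn0Sn n) p1 q1 AC) -EFinD lee_fin.
  by apply: ratio_le => //; exact: proot_le.
- have key (y : R) : 0 < y -> (((y * proot q W)^-1)%:E < inradius W)%E ->
      (m_inf n.+1 +oo q%:E <= y%:E)%E.
    move=> y0 /ereal_sup_gt[_ [r [r0 [x xW]] <-]]; rewrite lte_fin => yr.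
    have AC := cylinder_A_all r0 AW.
    apply: (le_trans (cyl r r0)).
    apply: (le_trans (F_ratio_infty_le (ltn0Sn n) q1 AC r0 (inradius_cylinder r0 (lexx r) xW))).
    rewrite lee_fin; apply: ratio_le => //; first exact: ltW.
    by rewrite -[leRHS]invrK lef_pV2 ?posrE ?invr_gt0 ?mulr_gt0// ltW.
  have [[rho [rho0 irW ->]]|[irW ->]] := F_ratio_infty_case n0 q1 AW;
    apply/lee_addgt0Pr => e e0.
  + have y0 : 0 < rho^-1 / proot q W + e by rewrite addr_gt0// divr_gt0// invr_gt0.
    rewrite -EFinD; apply: key => //.
    rewrite irW lte_fin -[ltRHS]invrK ltf_pV2 ?posrE ?invr_gt0//; last exact: mulr_gt0.
    by rewrite mulrDl divfK ?gt_eqF// ltrDl mulr_gt0.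
  + by rewrite add0e; apply: key => //; rewrite irW ltry.
Qed.

Lemma proot_sball_ge n (q r : R) : (0 < n)%N -> 1 <= q -> 0 < r ->
  n%:R / (q * r) <= proot q (@sball R n r).
Proof.
move=> n0 q1 r0; have q0 := lt_le_trans ltr01 q1.
have AB := @sball_A_all R n r r0.
have H1 : n%:R / r <= proot 1 (@sball R n r).
  apply: (proot_ge (lexx 1) AB); first by rewrite divr_ge0// ltW.
  rewrite powRr1 ?divr_ge0 ?(ltW r0)// -(cheeger_lambda1 (@open_sball R n r)).
  exact: cheeger_sball.
rewrite invfM mulrCA mulrC ler_pdivrMr// mulrC.
rewrite [leLHS]mulrC [leRHS]mulrC; apply: (le_trans H1).
by have := proot_monotone (lexx 1) q1 AB; rewrite mul1r.
Qed.

(** Monotonicity in the exponent passes from p to an integer N >= p, for which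
    [lambda_sball_le] is available. *)
Lemma proot_sball_le n (p r : R) (N j : nat) : (0 < n)%N -> 1 <= p -> p <= N%:R -> 1 < r ->
  p * proot p (@sball R n r) <= j.+2%:R / j.+1%:R * (n%:R + 2 * (N * j.+2)%:R).
Proof.
move=> n0 p1 pN r1; have r0 := lt_trans ltr01 r1.
have AB := @sball_A_all R n r r0.
have N1 := le_trans p1 pN; have NR := lt_le_trans ltr01 N1.
have N0 : (0 < N)%N by rewrite -(ltr_nat R).
apply: (le_trans (proot_monotone p1 pN AB)).
rewrite mulrC -ler_pdivlMr// -[leRHS]mulrA.
apply: (proot_le N1 AB).
  by rewrite mulr_ge0// divr_ge0// addr_ge0// mulr_ge0.
rewrite powR_mulrn; first exact: lambda_sball_le.
by rewrite mulr_ge0// divr_ge0// addr_ge0// mulr_ge0.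
Qed.

(** Balls of radius 2, whose inradius is at least 1. *)
Lemma m_inf_ball_infty (q e : R) : 1 <= q -> 0 < e ->
  exists2 d, (0 < d)%N & (m_inf d +oo q%:E <= e%:E)%E.
Proof.
move=> q1 e0; have q0 := lt_le_trans ltr01 q1.
pose d := (Num.truncn (2 * q / e)).+1.
have dq : 2 * q / e < d%:R := truncnS_gt _.
have d0 : 0 < d%:R :> R by rewrite ltr0n.
exists d => //.
have AB := @sball_A_all R d 2 (ltr0n R 2).
apply: (@le_trans _ _ (F_ratio +oo q%:E (@sball R d 2))).
  by apply: ereal_inf_lbound; exists (sball 2).
have B1 : (1%:E <= inradius (@sball R d 2))%E.
  apply: ereal_sup_ubound; exists 1 => //; split => //; exists 0 => y.
  rewrite /eball/= subr0 /sball/= -sqr_enorm => y1.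
  by rewrite ltr_pXn2r// ?nnegrE ?enorm_ge0// (lt_trans y1)// ltr1n.
apply: (le_trans (F_ratio_infty_le (ltn0Sn _) q1 AB ltr01 B1)).
rewrite lee_fin invr1 mul1r -[leRHS]invrK lef_pV2 ?posrE ?invr_gt0//; last exact: proot_gt0.
apply: le_trans (proot_sball_ge (ltn0Sn _) q1 (ltr0n R 2)).
rewrite ler_pdivlMr ?mulr_gt0// mulrC ltW//.
by rewrite (mulrC q).
Qed.

(** Balls of radius 1 + a. The power j of the bump is chosen first, so that
    (j+2)/(j+1) <= 1 + a, and then the dimension d, so that the remaining term of
    [proot_sball_le] is at most a d. *)
Lemma m_inf_ball (p q e : R) : 1 <= q -> q <= p -> 0 < e ->
  exists2 d, (0 < d)%N & (m_inf d p%:E q%:E <= (q / p + e)%:E)%E.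
Proof.
move=> q1 qp e0; have q0 := lt_le_trans ltr01 q1; have p0 := lt_le_trans q0 qp.
have p1 := le_trans q1 qp.
pose N := (Num.truncn p).+1.
have pN : p <= N%:R by rewrite ltW// truncnS_gt.
(* The three errors combine to (1 + a)^3 <= 1 + 7 a, valid for a <= 1. *)
pose a := Num.min 1 (e / 7).
have a0 : 0 < a by rewrite lt_min ltr01 divr_gt0.
have a1 : a <= 1 by rewrite ge_min lexx.
have ae : 7 * a <= e.
  by rewrite mulrC -ler_pdivlMr// ge_min lexx orbT.
pose j := Num.truncn a^-1.
have ja : j.+2%:R / j.+1%:R <= 1 + a.
  have ja0 : a^-1 < j.+1%:R := truncnS_gt _.
  rewrite ler_pdivrMr// mulrDl mul1r -[j.+2%:R]natr1 lerD2l.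
  by rewrite -ler_pdivrMl// mulr1 ltW.
pose d := (Num.truncn (2 * (N * j.+2)%:R / a)).+1.
have d0 : 0 < d%:R :> R by rewrite ltr0n.
have da : 2 * (N * j.+2)%:R <= a * d%:R.
  by rewrite [leRHS]mulrC -ler_pdivrMr// ltW// truncnS_gt.
have r1 : 1 < 1 + a by rewrite ltrDl.
have r0 := lt_trans ltr01 r1.
exists d => //.
have AB := @sball_A_all R d (1 + a) r0.
apply: (@le_trans _ _ (F_ratio p%:E q%:E (@sball R d (1 + a)))).
  by apply: ereal_inf_lbound; exists (sball (1 + a)).
rewrite (F_ratioE (ltn0Sn _) p1 q1 AB) lee_fin.
have Q0 := proot_gt0 (ltn0Sn _) q1 AB.
have Qge := proot_sball_ge (ltn0Sn (Num.truncn (2 * (N * j.+2)%:R / a))) q1 r0.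
have Ple := proot_sball_le j (ltn0Sn (Num.truncn (2 * (N * j.+2)%:R / a))) p1 pN r1.
rewrite -/d in Qge Ple.
rewrite ler_pdivrMr//.
move: (proot p _) (proot q _) Q0 Qge Ple => P Q Q0 Qge Ple.
have P2 : P <= (1 + a) ^+ 2 * d%:R / p.
  rewrite ler_pdivlMr// mulrC; apply: (le_trans Ple).
  rewrite [leRHS](_ : _ = (1 + a) * ((1 + a) * d%:R)); last by ring.
  apply: ler_pM => //.
  by rewrite [leRHS]mulrDl mul1r lerD2l.
apply: (le_trans P2).
have e7 : (q / p) * (1 + a) ^+ 3 <= q / p + e.
  have qp1 : q / p <= 1 by rewrite ler_pdivrMr// mul1r.
  have qp0 : 0 <= q / p by rewrite divr_ge0// ltW.
  have a3 : (1 + a) ^+ 3 <= 1 + 7 * a.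
    have -> : (1 + a) ^+ 3 = 1 + 3 * a + 3 * (a * a) + a * a * a by ring.
    have aa : a * a <= a by rewrite ler_piMr// ltW.
    have aaa : a * a * a <= a by apply: le_trans aa; rewrite ler_piMr ?mulr_ge0// ltW.
    lra.
  apply: (@le_trans _ _ (q / p * (1 + 7 * a))); first by rewrite ler_wpM2l.
  by rewrite mulrDr mulr1 lerD2l; apply: le_trans ae; rewrite ler_piMl// mulr_ge0// ltW.
apply: (@le_trans _ _ ((q / p) * (1 + a) ^+ 3 * (d%:R / (q * (1 + a))))).
  rewrite le_eqVlt; apply/orP; left; apply/eqP; field.
  by rewrite !gt_eqF.
apply: ler_pM => //.
- by rewrite mulr_ge0 ?exprn_ge0 ?divr_ge0// ltW.
- by rewrite divr_ge0// mulr_ge0// ltW.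
Qed.

Lemma m_inf_1d (p : \bar R) (q : R) : 1 <= q -> (q%:E < p)%E ->
  m_inf 1 p q%:E = F_ratio p q%:E (@unit_interval R).
Proof.
move=> q1 qp.
have AU : A_all (@unit_interval R) by rewrite unit_interval_itv1; exact: itv1_A_all.
apply/eqP; rewrite eq_le; apply/andP; split.
  by apply: ereal_inf_lbound; exists unit_interval.
apply: le_ereal_inf_tmp => _ [W AW <-].
case: p qp => [p| |] qp; last by exfalso; move: qp; rewrite ltNge leNye.
- by have qp' := ltW qp; rewrite lee_fin in qp'; rewrite (F_ratio_1d AW q1 qp') (F_ratio_1d AU q1 qp').
- by rewrite (F_ratio_infty_1d AW q1) (F_ratio_infty_1d AU q1).
Qed.

End Dimension.


Local Open Scope ereal_scope.

(* [inve] sends +oo to 0, so that q / p = 0 when p = +oo *)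
Theorem theorem2p6 (R : realType) (p q : \bar R) (hq : 1 <= q) (hqp : q < p) :
  [/\ forall d d' : nat, (1 <= d)%N -> (d <= d')%N ->
        m_inf d' p q <= m_inf d p q,
      m_inf d p q @[d --> \oo] --> q / p,
      ereal_inf [set m_inf d p q | d in [set d : nat | (1 <= d)%N]] = q / p,
      forall d : nat, (1 <= d)%N -> q / p <= m_inf d p q <= m_inf 1 p q
    & m_inf 1 p q = pi_ p / pi_ q].
Proof.
case: q hq hqp => [q| |] hq hqp; [|by move: hqp; rewrite ltNge leey|by move: hq; rewrite leeNy_eq].
rewrite lee_fin in hq; have q0 := lt_le_trans ltr01 hq.
have mono d d' : (1 <= d)%N -> (d <= d')%N -> m_inf d' p q%:E <= m_inf d p q%:E.
  move=> d1; elim: d' => [|d' IH]; first by rewrite leqn0 => /eqP ->.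
  rewrite leq_eqVlt => /predU1P[->//|]; rewrite ltnS => dd'.
  by apply: le_trans (IH dd'); apply: m_inf_succ => //; exact: leq_trans dd'.
have lower d : (1 <= d)%N -> q%:E / p <= m_inf d p q%:E.
  move=> d1; apply: le_ereal_inf_tmp => _ [W AW <-].
  case: p hqp {mono} => [p| |] qp; last by exfalso; move: qp; rewrite ltNge leNye.
  - rewrite lte_fin in qp; rewrite inver gt_eqF ?(lt_trans q0 qp)//.
    by apply: F_ratio_ge => //; exact: ltW.
  - by rewrite [X in _ * X](_ : _ = 0)// mule0; exact: F_ratio_infty_ge0.
have approx (e : R) : (0 < e)%R -> exists2 d, (0 < d)%N & m_inf d p q%:E <= q%:E / p + e%:E.
  move=> e0; case: p hqp {mono lower} => [p| |] qp; last by exfalso; move: qp; rewrite ltNge leNye.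
  - rewrite lte_fin in qp; rewrite inver gt_eqF ?(lt_trans q0 qp)//.
    exact: (m_inf_ball hq (ltW qp) e0).
  - rewrite [X in _ * X + _](_ : _ = 0)// mule0 add0e.
    exact: m_inf_ball_infty.
have infE : ereal_inf [set m_inf d p q%:E | d in [set d : nat | (1 <= d)%N]] = q%:E / p.
  apply/eqP; rewrite eq_le; apply/andP; split; last first.
    by apply: le_ereal_inf_tmp => _ [d d1 <-]; exact: lower.
  apply/lee_addgt0Pr => e e0; have [d d1] := approx e e0; apply: le_trans.
  by apply: ereal_inf_lbound; exists d.
split => //.
- rewrite -cvg_shiftS -infE.
  rewrite (_ : [set _ | _ in _] = [set m_inf d.+1 p q%:E | d in setT]); last first.
    apply/seteqP; split=> x [d /= d1 <-]; last by exists d.+1.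
    by exists d.-1 => //; rewrite prednK.
  apply: (@ereal_nonincreasing_cvgn _ (fun d => m_inf d.+1 p q%:E)).
  by move=> d d' dd'; exact: mono.
- by move=> d d1; rewrite lower// mono.
- exact: m_inf_1d.
Qed.
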